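(* Let $U\subset\mathbb R^n$ be a smoothly bounded strictly convex domain and let $\varphi,\psi\in\mathcal S$. Then $\varphi$ and $\psi$ can be joined by a smooth geodesic if and only if $\partial\varphi(U)=\partial\psi(U)$, where for $v\in\mathcal S$ $$\partial v(U):=\{p\in\mathbb R^n\ |\ \exists x\in U:\ Dv(x)=p\}$$ denotes the gradient image of $v$.
   Context: For a smoothly bounded strictly convex domain $U\subset\mathbb R^n$, $$\mathcal S:=\{v\in C^\infty(\overline U)\ |\ D^2v>0 \text{ on } \overline U,\ v=0\text{ on }\partial U\}.$$ For $\varphi,\psi\in\mathcal S$ consider the problem of finding a convex function $u$ on $U\times(0,1)$, continuous up to the boundary, with $$\det(D^2_{x,t}u)=0\ \text{ in } U\times(0,1),\quad u(\cdot,0)=\varphi\ \text{ on }U,\quad u(\cdot,1)=\psi\ \text{ on }U,\quad u=0\ \text{ on }\partial U\times(0,1),$$ where $D^2_{x,t}u$ is the Hessian in all variables $(x,t)$ (the equation being understood in the weak Alexandrov sense in general). One says that $\varphi$ and $\psi$ can be joined by a smooth geodesic if this problem admits a solution $u$ which is smooth in space and time (up to the boundary, i.e. $u\in C^\infty(\overline U\times[0,1])$) and which, for each fixed time $t\in[0,1]$, is strictly convex in $x$ up to the boundary, i.e. $D^2_xu(\cdot,t)>0$ on $\overline U$. *)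

(* Defs.v *)
From HB Require Import structures.
From mathcomp Require Import all_boot all_order all_algebra.
From mathcomp Require Import all_classical all_reals all_analysis.

Set Implicit Arguments.
Unset Strict Implicit.
Unset Printing Implicit Defensive.

Import Order.TTheory GRing.Theory Num.Theory.
Import numFieldNormedType.Exports.

Local Open Scope classical_set_scope.
Local Open Scope ring_scope.

Section Smoothness.
Context {R : realType} {V : normedModType R}.
Implicit Types (W : set V) (f : V -> R).

Definition iter_derive (vs : seq V) f : V -> R :=
  foldr (fun v g => 'D_v g) f vs.

(* C^oo on an open set W of a finite-dimensional V. *)
Definition smooth_on W f : Prop :=
  forall (vs : seq V) (x : V), W x -> differentiable (iter_derive vs f) x.

(* C^oo(closure W), for W open: f is C^oo in W and f, as well as each of its
   derivatives, extends continuously from W to closure W (the extension of f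
   being f itself). *)
Definition smooth_upto W f : Prop :=
  [/\ smooth_on W f,
      {within closure W, continuous f} &
      forall vs : seq V, exists2 g : V -> R,
        {within closure W, continuous g} &
        {in W, g =1 iter_derive vs f}].

(* The value at x \in closure W of the continuous extension of g from W; a
   derivative of a function in C^oo(closure W) is evaluated at a boundary point
   this way. *)
Definition ext_value (T : ptopologicalType) W (g : V -> T) (x : V) : T :=
  lim (g y @[y --> within W (nbhs x)]).

Definition hessian m (e : 'I_m -> V) f (x : V) : 'M[R]_m :=
  \matrix_(i, j) iter_derive [:: e i; e j] f x.

End Smoothness.

Definition posdef {R : realType} m (A : 'M[R]_m) : Prop :=
  A^T = A /\ forall w : 'rV[R]_m, w != 0 -> 0 < (w *m A *m w^T) 0 0.

Section Domains.
Context {R : realType} {n : nat}.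
Implicit Types (U : set 'rV[R]_n) (v : 'rV[R]_n -> R).

Definition boundary U : set 'rV[R]_n := closure U `\` interior U.

Definition smooth_boundary U : Prop :=
  forall p, boundary U p ->
    exists (O : set 'rV[R]_n) (rho : 'rV[R]_n -> R),
      [/\ open O, O p, smooth_on O rho,
          exists w, 'D_w rho p != 0 &
          forall x, O x -> (U x <-> rho x < 0)].

Definition strictly_convex U : Prop :=
  forall x y, closure U x -> closure U y -> x != y ->
    forall s : R, 0 < s < 1 -> interior U ((1 - s) *: x + s *: y).

(* Connectedness follows from strict convexity. *)
Definition smooth_strictly_convex_domain U : Prop :=
  [/\ open U, U !=set0, bounded_set U, smooth_boundary U & strictly_convex U].

Definition std_basis (i : 'I_n) : 'rV[R]_n := delta_mx 0 i.

Definition gradient v (x : 'rV[R]_n) : 'rV[R]_n :=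
  \row_i 'D_(std_basis i) v x.

Definition gradient_image U v : set 'rV[R]_n :=
  [set p | exists2 x, U x & gradient v x = p].

Definition calS U : set ('rV[R]_n -> R) :=
  [set v | [/\ smooth_upto U v,
      forall x, closure U x -> posdef (ext_value U (hessian std_basis v) x) &
      forall x, boundary U x -> v x = 0]].

End Domains.

Section Geodesics.
Context {R : realType} {n : nat}.

Definition space_time : normedModType R := ('rV[R]_n * R)%type.

Definition space_basis (i : 'I_n) : space_time := (std_basis i, 0).

Definition space_time_basis (i : 'I_(n + 1)) : space_time :=
  match fintype.split i with
  | inl j => space_basis j
  | inr _ => (0, 1)
  end.

Definition cylinder (U : set 'rV[R]_n) : set space_time := U `*` `]0, 1[.

(* For u in C^oo(closure U x [0, 1]), the Monge-Ampere equation holds in the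
   Alexandrov sense exactly when it holds pointwise. *)
Definition smooth_geodesic (U : set 'rV[R]_n) (phi psi : 'rV[R]_n -> R)
    (u : space_time -> R) : Prop :=
  [/\ convex_function (cylinder U) u /\
        {within closure (cylinder U), continuous u},
      forall z, cylinder U z -> \det (hessian space_time_basis u z) = 0,
      [/\ forall x, U x -> u (x, 0) = phi x,
          forall x, U x -> u (x, 1) = psi x &
          forall (x : 'rV[R]_n) (t : R), boundary U x -> 0 < t < 1 -> u (x, t) = 0],
      smooth_upto (cylinder U) u &
      forall (x : 'rV[R]_n) (t : R), closure U x -> 0 <= t <= 1 ->
        posdef (ext_value (cylinder U) (hessian space_basis u) (x, t))].

Definition joined_by_smooth_geodesic (U : set 'rV[R]_n)
    (phi psi : 'rV[R]_n -> R) : Prop :=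
  exists u : space_time -> R, smooth_geodesic U phi psi u.

End Geodesics.

(* Main.v *)
Require Import Defs.
From HB Require Import structures.
From mathcomp Require Import all_boot all_order all_algebra.
From mathcomp Require Import all_classical all_reals all_analysis.
From mathcomp Require Import perm ring lra.

Set Implicit Arguments.
Unset Strict Implicit.
Unset Printing Implicit Defensive.

Import Order.TTheory GRing.Theory Num.Theory.
Import numFieldNormedType.Exports.

Local Open Scope classical_set_scope.
Local Open Scope ring_scope.

(** A smooth geodesic is affine in time after the Legendre transform in space:
   [u(., t)^* = (1 - t) phi^* + t psi^*]. Both directions rest on the fact that
   the gradient image, the domain of the transform, is then fixed.

   Necessity. Let [u] be a smooth geodesic and let [b] be a boundary point of [U].
   As [u] vanishes on the lateral boundary, so do [u_t] and [u_tt] there. The full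
   Hessian is degenerate and its space block is positive definite, which forces
   the mixed derivatives [D_x u_t] to vanish at [(b, t)] ([degenerate_block]).
   So the spatial gradient at [b] does not depend on time ([lateral_gradient]), and
   [phi] and [psi] have the same gradient at every boundary point. This
   determines the gradient image ([gradient_image_sub]): to reach the slope
   [D phi x0] with [psi], minimize [psi - <D phi x0, .>]; a minimizer on the
   boundary would contradict the strict monotonicity of [D phi].

   Sufficiency. If the gradient images agree, every [(y, t)] determines a unique
   pair of interior points [X], [Z] with [D phi X = D psi Z] and
   [(1 - t) X + t Z = y]: existence comes from minimizing
   [(1 - t) phi x + t psi z] under the last constraint ([interpolation_exists]),
   uniqueness and Lipschitz dependence from strong monotonicity of the gradients
   ([interpolation_lipschitz]). The geodesic is
   [u = (1 - t) phi X + t psi Z]. Adding the supporting hyperplanes of [phi] at [X]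
   and of [psi] at [Z], which have the same slope, gives an affine function of
   [(y, t)] below [u] and touching it ([geodesic_support]). Convexity, the
   Lipschitz bound and the space-time gradient of [u] follow at once. This gradient
   is constant along the segments on which [X] and [Z] are constant, whence the
   Monge-Ampere equation ([geodesic_det]); it is strongly monotone in space,
   whence the bound from below on the space Hessian ([geodesic_hessian_pos]).

   Smoothness up to the boundary is handled through uniform continuity. On a set
   with compact closure a function extends continuously to the closure exactly
   when it is uniformly continuous, so it is enough that all iterated derivatives
   be uniformly continuous in the interior. The derivatives of [X] and [Z] are
   rational expressions in the second derivatives of [phi] at [X] and of [psi] at
   [Z], with a denominator bounded away from zero. Hence the algebra
   generated by these expressions is closed under differentiation, and
   all its members are smooth up to the boundary ([alg_usmooth],
   [pulled_back_usmooth]). *)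

(** * Uniform continuity and extension to the closure *)

Section UniformContinuity.
Context {R : realType} {V : normedModType R}.
Implicit Types (W : set V) (f g : V -> R).

(** On a set with compact closure this is equivalent to having a continuous
   extension to the closure. *)
Definition ucont W f := forall e : R, 0 < e ->
  exists2 d : R, 0 < d & forall x y, W x -> W y ->
    `|x - y| < d -> `|f x - f y| <= e.

Lemma within_cvgP W f x (l : R) :
  (f @ within W (nbhs x) --> l) <->
  forall e : R, 0 < e -> exists2 d : R, 0 < d &
    forall y, W y -> `|x - y| < d -> `|l - f y| <= e.
Proof.
split.
  move=> /cvgrPdist_le fl e e0.
  have /nbhs_normP[d /= d0 dP] := fl e e0.
  by exists d => // y Wy xy; apply: dP.
move=> fl; apply/cvgrPdist_le => e e0; have [d d0 dP] := fl e e0.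
by apply/nbhs_normP; exists d => //= y xy Wy; apply: dP.
Qed.

Lemma within_continuousP W f :
  {within W, continuous f} <->
  forall x, W x -> f @ within W (nbhs x) --> f x.
Proof. exact: subspace_continuousP. Qed.

Lemma ucont_within W f : ucont W f -> {within W, continuous f}.
Proof.
move=> uf; apply/within_continuousP => x Wx; apply/within_cvgP => e e0.
by have [d d0 dP] := uf e e0; exists d => // y Wy; apply: dP.
Qed.

Lemma closure_normP W x :
  closure W x <-> forall d : R, 0 < d -> exists2 y, W y & `|x - y| < d.
Proof.
split=> [cx d d0|cx B /nbhs_normP[d /= d0 dB]].
  have /cx[y [Wy xy]] : nbhs x [set y | `|x - y| < d].
    by apply/nbhs_normP; exists d.
  by exists y.
by have [y Wy xy] := cx d d0; exists y; split => //; apply: dB.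
Qed.

Lemma cvg_within_extension W f g z : closure W z ->
  {within closure W, continuous g} -> (forall x, W x -> g x = f x) ->
  f @ within W (nbhs z) --> g z.
Proof.
move=> cz /within_continuousP gc gf; apply/within_cvgP => e e0.
have /within_cvgP/(_ e e0)[d d0 dP] := gc z cz.
exists d => // y Wy zy; rewrite -gf//.
by apply: dP => //; apply: subset_closure.
Qed.

Lemma ext_value_lim (T : ptopologicalType) W (f : V -> T) (l : T) z :
  hausdorff_space T -> closure W z ->
  f @ within W (nbhs z) --> l -> ext_value W f z = l.
Proof.
move=> hT cz fl; have PF := within_nbhs_proper cz.
exact: (@cvg_lim T hT _ _ PF f l).
Qed.

(** The extension is the limit of [f] at each point of the closure, which exists
   because [R] is complete. *)
Lemma ucont_extension W f : ucont W f ->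
  exists2 g, ucont (closure W) g & forall x, W x -> g x = f x.
Proof.
move=> uf.
have fcvg z : closure W z -> cvg (f @ within W (nbhs z)).
  move=> cz; have PF := within_nbhs_proper cz.
  apply/cauchy_cvgP/cauchy_exP => e e0.
  have e20 : 0 < e / 2 by rewrite divr_gt0.
  have [d d0 dP] := uf _ e20.
  have d20 : 0 < d / 2 by rewrite divr_gt0.
  have /closure_normP/(_ _ d20)[y Wy zy] := cz.
  exists (f y); apply/nbhs_normP; exists (d / 2) => //= x zx Wx.
  rewrite -ball_normE /=.
  apply: le_lt_trans (_ : e / 2 < e); last by lra.
  apply: dP => //.
  by rewrite (splitr d) (le_lt_trans (ler_distD z _ _))// ltrD// distrC.
exists (ext_value W f); last first.
  move=> x Wx; have cx := @subset_closure _ W x Wx.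
  apply: ext_value_lim => //.
  by have /within_continuousP := ucont_within uf; exact.
move=> e e0; have e30 : 0 < e / 3 by rewrite divr_gt0.
have [d d0 dP] := uf _ e30.
have d30 : 0 < d / 3 by rewrite divr_gt0.
have near z : closure W z ->
    exists2 x, W x & `|z - x| < d / 3 /\ `|ext_value W f z - f x| <= e / 3.
  move=> cz; have /within_cvgP/(_ _ e30)[r r0 rP] := fcvg z cz.
  have m0 : 0 < Num.min r (d / 3) by rewrite lt_min r0 d30.
  have /closure_normP/(_ _ m0)[x Wx] := cz.
  rewrite lt_min => /andP[zr zd]; exists x => //; split => //; exact: rP.
exists (d / 3) => // z z' /near[x Wx [zx fx]] /near[x' Wx' [zx' fx']] zz'.
have xx' : `|f x - f x'| <= e / 3.
  apply: dP => //; rewrite (le_lt_trans (ler_distD z _ _))//.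
  rewrite distrC (_ : d = d / 3 + (d / 3 + d / 3)); last by field.
  by rewrite ltrD// (le_lt_trans (ler_distD z' _ _))// ltrD.
rewrite (le_trans (ler_distD (f x) _ _))//.
rewrite (_ : e = e / 3 + (e / 3 + e / 3)); last by field.
by rewrite lerD// (le_trans (ler_distD (f x') _ _))// lerD// distrC.
Qed.

(** Heine-Cantor, by the near-covering form of compactness. *)
Lemma compact_ucont (K : set V) f :
  compact K -> {within K, continuous f} -> ucont K f.
Proof.
move=> /compact_near_coveringP/near_covering_withinP cK.
move=> /within_continuousP fc e e0.
have e20 : 0 < e / 2 by rewrite divr_gt0.
have := cK R 0^'+ (fun d x => forall y, K y -> `|x - y| < d ->
  `|f x - f y| <= e) _.
case=> [x Kx|d /= d0 dP].
  have /within_cvgP/(_ _ e20)[d d0 dP] := fc x Kx.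
  have d20 : 0 < d / 2 by rewrite divr_gt0.
  exists ([set x' | `|x - x'| < d / 2], [set r | r < d / 2]) => /=.
    split; first by apply/nbhs_normP; exists (d / 2).
    exact: nbhs_right_lt.
  move=> [x' r] /= [xx' rd] Kx' y Ky x'y.
  rewrite (le_trans (ler_distD (f x) _ _))// (splitr e) lerD//.
    by rewrite distrC; apply: dP => //; lra.
  apply: dP => //; rewrite (le_lt_trans (ler_distD x' _ _))//.
  by rewrite (splitr d) ltrD// (lt_trans x'y).
exists (d / 2); first by rewrite divr_gt0.
move=> x y Kx Ky xy; apply: (dP (d / 2)) => //=.
  by rewrite sub0r normrN gtr0_norm ?divr_gt0//; lra.
by rewrite divr_gt0.
Qed.

Lemma ucontS W W' f : W `<=` W' -> ucont W' f -> ucont W f.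
Proof.
move=> sW uf e /uf[d d0 dP]; exists d => // x y Wx Wy; exact: dP (sW _ _) (sW _ _).
Qed.

Lemma eq_ucont W f g : (forall x, W x -> f x = g x) -> ucont W f -> ucont W g.
Proof.
move=> fg uf e /uf[d d0 dP]; exists d => // x y Wx Wy xy.
by rewrite -!fg//; exact: dP.
Qed.

Definition bounded_on W f := exists2 M : R, 0 < M &
  forall x, W x -> `|f x| <= M.

Lemma ucont_bounded W f : compact (closure W) -> ucont W f -> bounded_on W f.
Proof.
move=> cW /ucont_extension[g /ucont_within gc gf].
have := compact_bounded (continuous_compact gc cW).
move=> /ex_strict_bound_gt0[M M0 MP]; exists M => // x Wx.
rewrite -gf//; apply/ltW/MP; exists x => //; exact: subset_closure.
Qed.

Lemma ucont_cst W (c : R) : ucont W (fun=> c).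
Proof. by move=> e e0; exists 1 => // x y _ _ _; rewrite subrr normr0 ltW. Qed.

Lemma ucontD W f g : ucont W f -> ucont W g -> ucont W (fun x => f x + g x).
Proof.
move=> uf ug e e0; have e20 : 0 < e / 2 by rewrite divr_gt0.
have [d d0 dP] := uf _ e20; have [d' d'0 d'P] := ug _ e20.
exists (Num.min d d'); first by rewrite lt_min d0.
move=> x y Wx Wy; rewrite lt_min => /andP[xd xd'].
rewrite opprD addrACA (le_trans (ler_normD _ _))// (splitr e) lerD//.
  exact: dP.
exact: d'P.
Qed.

Lemma ucontM W f g : bounded_on W f -> bounded_on W g ->
  ucont W f -> ucont W g -> ucont W (fun x => f x * g x).
Proof.
move=> [M M0 fM] [N N0 gN] uf ug e e0.
have eN : 0 < e / 2 / N by rewrite !divr_gt0.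
have eM : 0 < e / 2 / M by rewrite !divr_gt0.
have [d d0 dP] := uf _ eN; have [d' d'0 d'P] := ug _ eM.
exists (Num.min d d'); first by rewrite lt_min d0.
move=> x y Wx Wy; rewrite lt_min => /andP[xd xd'].
have -> : f x * g x - f y * g y = (f x - f y) * g x + f y * (g x - g y) by ring.
rewrite (le_trans (ler_normD _ _))// (splitr e) lerD// normrM.
  rewrite -[leRHS](@divfK _ N) ?gt_eqF//.
  by apply: ler_pM => //; [exact: dP|exact: gN].
rewrite -[leRHS](@divfK _ M) ?gt_eqF// mulrC.
by apply: ler_pM => //; [exact: d'P|exact: fM].
Qed.

Lemma ucontV W f : bounded_on W (fun x => (f x)^-1) ->
  (forall x, W x -> f x != 0) -> ucont W f -> ucont W (fun x => (f x)^-1).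
Proof.
move=> [M M0 fM] fN0 uf e e0.
have eM : 0 < e / (M * M) by rewrite divr_gt0// mulr_gt0.
have [d d0 dP] := uf _ eM; exists d => // x y Wx Wy xy.
have -> : (f x)^-1 - (f y)^-1 = (f y - f x) * ((f x)^-1 * (f y)^-1).
  by field; rewrite !fN0.
rewrite normrM distrC -[leRHS](@divfK _ (M * M)) ?gt_eqF ?mulr_gt0//.
apply: ler_pM => //; first exact: dP.
by rewrite normrM; apply: ler_pM => //; apply: fM.
Qed.

End UniformContinuity.

(** * Directional derivatives *)

Section Calculus.
Context {R : realType} {V : normedModType R}.

Lemma derive_eps (V' : normedModType R) (f : V -> V') x v : derivable f x v ->
  forall e : R, 0 < e -> exists2 d : R, 0 < d & forall h, `|h| < d ->
    `|f (x + h *: v) - f x - h *: 'D_v f x| <= e * `|h|.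
Proof.
move=> /derivable_nbhs/eqaddoP fD e e0.
have /nbhs_normP[d /= d0 dP] := fD e e0; exists d => // h hd.
have := dP h; rewrite /= sub0r normrN => /(_ hd).
rewrite !fctE /= [h *: v + x]addrC; by rewrite opprD addrA.
Qed.

Lemma eps_derive (V' : normedModType R) (f : V -> V') x v (l : V') :
  (forall e : R, 0 < e -> exists2 d : R, 0 < d & forall h, `|h| < d ->
    `|f (x + h *: v) - f x - h *: l| <= e * `|h|) ->
  is_derive x v f l.
Proof.
move=> fl.
have cvl : h^-1 *: ((f \o shift x) (h *: v) - f x) @[h --> 0^'] --> l.
  apply/cvgrPdist_le => e e0; have [d d0 dP] := fl e e0.
  apply/nbhs_normP; exists d => //= h; rewrite /ball_/= sub0r normrN => hd hN0.
  have hp : 0 < `|h| by rewrite normr_gt0.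
  rewrite -(ler_pM2r hp) mulrC -normrZ.
  rewrite scalerBr scalerA mulfV// scale1r distrC.
  by rewrite [h *: v + x]addrC dP.
split; first by apply/cvg_ex; exists l.
exact: cvg_lim cvl.
Qed.

Lemma differentiable_eps (V' : normedModType R) (f : V -> V') x :
  differentiable f x -> forall e : R, 0 < e ->
  exists2 d : R, 0 < d & forall h, `|h| < d ->
    `|f (x + h) - f x - 'd f x h| <= e * `|h|.
Proof.
move=> /diff_locally/eqaddoP fD e e0.
have /nbhs_normP[d /= d0 dP] := fD e e0; exists d => // h hd.
have := dP h; rewrite /= sub0r normrN => /(_ hd).
by rewrite !fctE /= [h + x]addrC opprD addrA.
Qed.

Lemma eps_differentiable (V' : normedModType R) (f : V -> V') x
    (L : {linear V -> V'}) : continuous L ->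
  (forall e : R, 0 < e ->
  exists2 d : R, 0 < d & forall h, `|h| < d ->
    `|f (x + h) - f x - L h| <= e * `|h|) ->
  differentiable f x /\ 'd f x = L :> (V -> V').
Proof.
move=> cL fL.
have fE : f \o shift x = cst (f x) + L +o_ 0 id.
  apply/eqaddoP => e e0; have [d d0 dP] := fL e e0.
  apply/nbhs_normP; exists d => //= h; rewrite /ball_/= sub0r normrN => hd.
  by rewrite !fctE /= [h + x]addrC opprD addrA dP.
have dL : 'd f x = L :> (V -> V') by apply: diff_unique.
split => //; apply/diff_locallyP; split; rewrite dL//.
Qed.

Lemma deriveZv (V' : normedModType R) (f : V -> V') x v (a : R) :
  differentiable f x -> 'D_(a *: v) f x = a *: 'D_v f x.
Proof. by move=> df; rewrite !deriveE// linearZ. Qed.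

End Calculus.

Section MeanValue.
Context {R : realType} {V : normedModType R}.

Lemma is_derive_line (f : V -> R) x v (s : R) : derivable f (x + s *: v) v ->
  is_derive s 1 (fun r => f (x + r *: v)) ('D_v f (x + s *: v)).
Proof.
move=> df; apply: eps_derive => e e0.
have [d d0 dP] := derive_eps df e0; exists d => // h hd.
by rewrite scaler1 scalerDl addrA dP.
Qed.

Lemma mvt_line (f : V -> R) x v :
  (forall s : R, 0 <= s <= 1 -> differentiable f (x + s *: v)) ->
  exists2 s : R, 0 < s < 1 & f (x + v) - f x = 'D_v f (x + s *: v).
Proof.
move=> df; pose g (r : R) := f (x + r *: v).
have dg (s : R) : 0 <= s <= 1 -> is_derive s 1 g ('D_v f (x + s *: v)).
  by move=> s01; apply: is_derive_line; apply: diff_derivable; exact: df.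
have [s| |s] := @MVT R g (fun s => 'D_v f (x + s *: v)) 0 1 ltr01.
- by rewrite in_itv/= => /andP[s0 s1]; apply: dg; rewrite !ltW.
- apply: derivable_within_continuous => s; rewrite in_itv/= => s01.
  by have [] := dg s s01.
rewrite in_itv/= => s01 gE; exists s => //.
by move: gE; rewrite /g scale1r scale0r addr0 subr0 mulr1.
Qed.

(** Two applications of the mean value theorem; the symmetry of the left-hand
   side in [v] and [w] is what makes mixed derivatives agree. *)
Lemma second_difference (f : V -> R) x v w (r : R) :
  (forall y, `|y - x| < r ->
     differentiable f y /\ differentiable ('D_v f) y) ->
  `|v| + `|w| < r ->
  exists2 a, `|a - x| <= `|v| + `|w| &
    f (x + v + w) - f (x + v) - (f (x + w) - f x) = 'D_w ('D_v f) a.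
Proof.
move=> df vwr.
have lev (s : R) (u : V) : 0 <= s <= 1 -> `|s *: u| <= `|u|.
  by move=> /andP[s0 s1]; rewrite normrZ ger0_norm// ler_piMl.
have inb (s t : R) : 0 <= s <= 1 -> 0 <= t <= 1 ->
    `|x + s *: v + t *: w - x| <= `|v| + `|w|.
  move=> s01 t01; rewrite -[x + _ + _]addrA [x + _]addrC addrK.
  by rewrite (le_trans (ler_normD _ _))// lerD// lev.
pose k y := f (y + w) - f y.
have i01 : 0 <= (1 : R) <= 1 by rewrite ler01 lexx.
have i00 : 0 <= (0 : R) <= 1 by rewrite ler01 lexx.
have dfw (s : R) : 0 <= s <= 1 -> differentiable f (x + s *: v + w).
  move=> s01; apply: (df _ _).1; apply: le_lt_trans vwr.
  by have := inb s 1 s01 i01; rewrite scale1r.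
have df0 (s : R) : 0 <= s <= 1 -> differentiable f (x + s *: v).
  move=> s01; apply: (df _ _).1; apply: le_lt_trans vwr.
  by have := inb s 0 s01 i00; rewrite scale0r addr0.
have dk (s : R) : 0 <= s <= 1 -> is_diff (x + s *: v) k
    (fun u => 'd f (x + s *: v + w) u - 'd f (x + s *: v) u).
  move=> s01; have sh : is_diff (x + s *: v) (fun y => y + w) id.
    have -> : (fun y : V => y + w) = id + cst w by [].
    by apply: is_diff_eq; rewrite addr0.
  have := dfw s s01 => /differentiableP dfw1.
  have := df0 s s01 => /differentiableP df01.
  have := @is_diff_comp _ _ _ _ (fun y => y + w) id f _ (x + s *: v) sh dfw1.
  by move=> dcomp; exact: is_diffB.
have [s s01 kE] : exists2 s : R, 0 < s < 1 &
    k (x + v) - k x = 'D_v k (x + s *: v).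
  by apply: mvt_line => s s01; have [] := dk s s01.
have s01' : 0 <= s <= 1 by case/andP: s01 => s0 s1; rewrite !ltW.
have [t t01 DE] : exists2 t : R, 0 < t < 1 &
    'D_v f (x + s *: v + w) - 'D_v f (x + s *: v) =
    'D_w ('D_v f) (x + s *: v + t *: w).
  apply: (mvt_line (f := 'D_v f)) => t t01.
  by apply: (df _ _).2; apply: le_lt_trans vwr; exact: inb.
exists (x + s *: v + t *: w).
  by apply: inb => //; case/andP: t01 => t0 t1; rewrite !ltW.
rewrite -DE !deriveE//; last 2 first.
  exact: df0.
  exact: dfw.
move: kE; rewrite /k [x + v + w]addrAC => kE.
rewrite kE.
by have [dk1 dk2] := dk s s01'; rewrite deriveE// dk2.
Qed.

Lemma open_normP (W : set V) x : open W -> W x ->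
  exists2 r : R, 0 < r & forall y, `|y - x| < r -> W y.
Proof.
move=> oW Wx; have /nbhs_normP[r /= r0 rP] := open_nbhs_nbhs (conj oW Wx).
by exists r => // y yr; apply: rP; rewrite /= distrC.
Qed.

Lemma eq_derive_open (V' : normedModType R) (W : set V) (f g : V -> V') x v :
  open W -> W x -> (forall y, W y -> f y = g y) -> 'D_v f x = 'D_v g x.
Proof.
move=> oW Wx fg; apply: near_eq_derive.
by apply: filterS (open_nbhs_nbhs (conj oW Wx)) => y; exact: fg.
Qed.

Lemma eq_differentiable_open (V' : normedModType R) (W : set V) (f g : V -> V')
  x : open W -> W x -> (forall y, W y -> f y = g y) ->
  differentiable f x -> differentiable g x.
Proof.
move=> oW Wx fg df; have [r r0 rP] := open_normP oW Wx.
have [] // := @eps_differentiable R V V' g x ('d f x) _ _.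
  exact: diff_continuous.
move=> e e0; have [d d0 dP] := differentiable_eps df e0.
exists (Num.min r d); first by rewrite lt_min r0.
move=> h; rewrite lt_min => /andP[hr hd]; rewrite -!fg//; first exact: dP.
by apply: rP; rewrite [_ + _ - _]addrAC subrr add0r.
Qed.

(** The second differences in both orders coincide, and divided by the square
   of the step they converge to either mixed derivative. *)
Lemma mixed_derivatives (W : set V) (f : V -> R) x v w :
  open W -> W x -> smooth_on W f ->
  'D_v ('D_w f) x = 'D_w ('D_v f) x.
Proof.
move=> oW Wx sf.
suff H : forall e : R, 0 < e -> `|'D_v ('D_w f) x - 'D_w ('D_v f) x| <= e.
  apply/eqP; rewrite -subr_eq0 -normr_le0; apply/ler_addgt0Pr => e e0.
  by rewrite add0r; exact: H.
move=> e e0; have e20 : 0 < e / 2 by rewrite divr_gt0.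
have [r r0 rP] := open_normP oW Wx.
have cont u u' : exists2 d : R, 0 < d & forall y, `|y - x| < d ->
    `|'D_u ('D_u' f) x - 'D_u ('D_u' f) y| <= e / 2.
  have := differentiable_continuous (sf [:: u; u'] x Wx).
  move=> /cvgrPdist_le/(_ _ e20)/nbhs_normP[d /= d0 dP].
  by exists d => // y yx; apply: dP; rewrite /= distrC.
have [d1 d10 d1P] := cont v w; have [d2 d20 d2P] := cont w v.
pose m := Num.min r (Num.min d1 d2).
have m0 : 0 < m by rewrite !lt_min r0 d10 d20.
pose N := `|v| + `|w| + 1.
have N0 : 0 < N by rewrite ltr_wpDl// addr_ge0.
pose h := m / N.
have h0 : 0 < h by rewrite divr_gt0.
have hm : `|h *: v| + `|h *: w| < m.
  have -> : m = h * N by rewrite divfK// gt_eqF.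
  by rewrite (normrZ h v) (normrZ h w) -mulrDr gtr0_norm// ltr_pM2l// ltrDl.
have scal u u' y : W y -> 'D_(h *: u) ('D_(h *: u') f) y =
    h * h * 'D_u ('D_u' f) y.
  move=> Wy.
  rewrite (@eq_derive_open _ W _ (fun z => h *: 'D_u' f z) _ _ oW Wy); last first.
    by move=> z Wz; rewrite deriveZv//; exact: (sf [::] z Wz).
  have dd := sf [:: u'] y Wy.
  rewrite deriveZ; last exact: diff_derivable.
  by rewrite deriveZv// scalerA.
have main u u' : `|h *: u| + `|h *: u'| < m ->
    exists2 a, `|a - x| < m &
    f (x + h *: u + h *: u') - f (x + h *: u) - (f (x + h *: u') - f x)
      = h * h * 'D_u' ('D_u f) a.
  move=> hu.
  have hr : `|h *: u| + `|h *: u'| < r.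
    by move: hu; rewrite lt_min => /andP[].
  have [|a ax aE] := @second_difference f x (h *: u) (h *: u') r _ hr.
    move=> y /rP Wy; split; first exact: (sf [::]).
    exact: (sf [:: h *: u]).
  exists a; first exact: le_lt_trans hu.
  rewrite aE scal//; apply: rP; exact: le_lt_trans hr.
have [a am aE] := main v w hm.
have [|b bm bE] := main w v; first by rewrite addrC.
have ab : 'D_w ('D_v f) a = 'D_v ('D_w f) b.
  have hh : h * h != 0 by rewrite mulf_neq0// gt_eqF.
  apply: (mulfI hh); apply: (etrans (esym aE)); apply: (etrans _ bE).
  by rewrite [x + h *: w + h *: v]addrAC; ring.
move: am bm; rewrite !lt_min => /and3P[_ _ am] /and3P[_ bm _].
have := d1P b bm; have := d2P a am; rewrite ab.
move: ('D_v ('D_w f) x) ('D_v ('D_w f) b) ('D_w ('D_v f) x) => p q r' rq pq.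
by rewrite (le_trans (ler_distD q _ _))// (splitr e) lerD// distrC.
Qed.

(** Tested with steps [h] of both signs, the one-sided bound determines the
   derivative. *)
Lemma derive_support (W : set V) (f : V -> R) x v (c : R) :
  open W -> W x -> derivable f x v ->
  (forall h, W (x + h *: v) -> f x + h * c <= f (x + h *: v)) ->
  'D_v f x = c.
Proof.
move=> oW Wx df sup.
suff H : forall e : R, 0 < e -> `|'D_v f x - c| <= e.
  apply/eqP; rewrite -subr_eq0 -normr_le0; apply/ler_addgt0Pr => e e0.
  by rewrite add0r; exact: H.
move=> e e0; have [d d0 dP] := derive_eps df e0.
have [r r0 rP] := open_normP oW Wx.
pose m := Num.min d (r / (`|v| + 1)).
have v1 : 0 < `|v| + 1 by rewrite ltr_wpDl.
have m0 : 0 < m by rewrite lt_min d0 divr_gt0.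
have Wh h : `|h| < m -> W (x + h *: v).
  rewrite lt_min => /andP[_ hr]; apply: rP; rewrite [_ + _ - _]addrAC subrr add0r normrZ.
  rewrite -[r](@divfK _ (`|v| + 1)) ?gt_eqF//.
  apply: le_lt_trans (_ : `|h| * (`|v| + 1) < _); last by rewrite ltr_pM2r.
  by rewrite ler_wpM2l// lerDl.
have key h : `|h| < m -> h * (c - 'D_v f x) <= e * `|h|.
  move=> hm; have := sup h (Wh h hm).
  have := dP h; rewrite (lt_le_trans hm) ?ge_min ?lexx// => /(_ isT).
  rewrite -[h *: 'D_v f x]/(h * 'D_v f x) ler_norml mulrBr => /andP[_]; lra.
have m2 : 0 < m / 2 by rewrite divr_gt0.
have := key (m / 2); have := key (- (m / 2)).
rewrite normrN gtr0_norm//.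
have -> : m / 2 < m by lra.
move=> /(_ isT) k1 /(_ isT) k2.
have {}k2 : c - 'D_v f x <= e by rewrite -(ler_pM2l m2) [leRHS]mulrC.
have {}k1 : 'D_v f x - c <= e by rewrite -(ler_pM2l m2) [leRHS]mulrC; lra.
by rewrite ler_norml; apply/andP; split; lra.
Qed.

Definition is_convex (W : set V) := forall x y, W x -> W y ->
  forall s : R, 0 <= s <= 1 -> W ((1 - s) *: x + s *: y).

Lemma segment_convex (W : set V) x v (s : R) : is_convex W -> W x ->
  W (x + v) -> 0 <= s <= 1 -> W (x + s *: v).
Proof.
move=> cW Wx Wv s01; have := cW _ _ Wx Wv s s01.
by rewrite scalerDr addrA -scalerDl subrK scale1r.
Qed.

(** The segment from [z] to [z + h *: v] may lie in the boundary of [W]. A small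
   translation [a] carries it into [W], where the mean value theorem applies
   with the modulus of continuity of the derivative; then let [a] tend to zero. *)
Lemma boundary_derivative (W : set V) (f F G : V -> R) v (e : R) :
  is_convex W -> smooth_on W f ->
  {within closure W, continuous F} -> (forall x, W x -> F x = f x) ->
  ucont (closure W) G -> (forall x, W x -> G x = 'D_v f x) ->
  0 < e -> exists2 d : R, 0 < d & forall z (h : R), `|h *: v| < d ->
    (forall r : R, 0 < r ->
       exists a, [/\ `|a| < r, W (z + a) & W (z + h *: v + a)]) ->
    `|F (z + h *: v) - F z - h * G z| <= e * `|h|.
Proof.
move=> cW sf Fc Ff Gu Gf e0.
have [d d0 dP] := Gu e e0; exists d => // z h hd za.
have inner y : W y -> W (y + h *: v) ->
    `|F (y + h *: v) - F y - h * G y| <= e * `|h|.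
  move=> Wy Wyv.
  have Ws (s : R) : 0 <= s <= 1 -> W (y + s *: (h *: v)).
    by move=> s01; exact: segment_convex.
  have [s s01 sE] : exists2 s : R, 0 < s < 1 &
      f (y + h *: v) - f y = 'D_(h *: v) f (y + s *: (h *: v)).
    by apply: mvt_line => s s01; apply: (sf [::]); exact: Ws.
  have s01' : 0 <= s <= 1 by case/andP: s01 => s0 s1; rewrite !ltW.
  have Wsy := Ws s s01'.
  rewrite !Ff// sE deriveZv; last exact: (sf [::]).
  rewrite -Gf// -[h *: G _]/(h * G _) -mulrBr normrM mulrC ler_wpM2r//.
  apply: dP; try exact: subset_closure.
  rewrite [_ + _ - _]addrAC subrr add0r; apply: le_lt_trans hd.
  rewrite normrZ ger0_norm; last by case/andP: s01'.
  by rewrite ler_piMl//; case/andP: s01'.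
have cl y : (forall r : R, 0 < r -> exists2 a, `|a| < r & W (y + a)) ->
    closure W y.
  move=> ya; apply/closure_normP => r /ya[a ar Wa]; exists (y + a) => //.
  by rewrite opprD addrA subrr sub0r normrN.
have cz : closure W z by apply: cl => r /za[a [? ? ?]]; exists a.
have czv : closure W (z + h *: v) by apply: cl => r /za[a [? ? ?]]; exists a.
apply/ler_addgt0Pr => r r0.
have q0 : 0 < r / (2 + `|h|) by rewrite divr_gt0// ltr_pwDl.
have /within_continuousP Fc' := Fc.
have /within_cvgP/(_ _ q0)[d1 d10 d1P] := Fc' _ cz.
have /within_cvgP/(_ _ q0)[d2 d20 d2P] := Fc' _ czv.
have [d3 d30 d3P] := Gu _ q0.
have [|a [am Wa Wva]] := za (Num.min d1 (Num.min d2 d3)).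
  by rewrite !lt_min d10 d20.
move: am; rewrite !lt_min => /and3P[ad1 ad2 ad3].
have sub y : `|y - (y + a)| = `|a| by rewrite opprD addrA subrr sub0r normrN.
have E1 : `|F z - F (z + a)| <= r / (2 + `|h|).
  by apply: d1P; rewrite ?sub//; exact: subset_closure.
have E2 : `|F (z + h *: v) - F (z + h *: v + a)| <= r / (2 + `|h|).
  by apply: d2P; rewrite ?sub//; exact: subset_closure.
have E3 : `|G z - G (z + a)| <= r / (2 + `|h|).
  by apply: d3P; rewrite ?sub//; exact: subset_closure.
have := inner (z + a) Wa; rewrite addrAC => /(_ Wva) E4.
have -> : F (z + h *: v) - F z - h * G z =
  (F (z + h *: v + a) - F (z + a) - h * G (z + a)) +
  ((F (z + h *: v) - F (z + h *: v + a)) - (F z - F (z + a))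
   - h * (G z - G (z + a))) by ring.
rewrite (le_trans (ler_normD _ _))// lerD//.
apply: le_trans (ler_normB _ _) _.
have -> : r = (r / (2 + `|h|) + r / (2 + `|h|)) + `|h| * (r / (2 + `|h|)).
  by field; rewrite gt_eqF// ltr_pwDl.
rewrite lerD// ?normrM ?ler_wpM2l//.
by apply: le_trans (ler_normB _ _) _; rewrite lerD.
Qed.

End MeanValue.

(** * The algebra of functions smooth up to the boundary *)

Section SmoothAlgebra.
Context {R : realType} {V : normedModType R}.
Variable W : set V.
Hypothesis oW : open W.
Hypothesis cW : compact (closure W).
Implicit Types f g : V -> R.

(** [C^oo] up to the boundary without naming the extensions: each derivative is
   uniformly continuous, a condition inherited by products, compositions and
   inverses. *)
Definition usmooth f := forall vs : seq V,
  (forall x, W x -> differentiable (iter_derive vs f) x) /\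
  ucont W (iter_derive vs f).

(** Each derivative has a continuous extension to the compact closure, which is
   uniformly continuous. *)
Lemma smooth_upto_usmooth f : smooth_upto W f -> usmooth f.
Proof.
move=> [sf _ ef] vs; split=> [x Wx|]; first exact: sf.
have [g gc gf] := ef vs.
apply: (@eq_ucont _ _ W g); first by move=> x Wx; rewrite gf ?inE.
by apply: ucontS (compact_ucont cW gc); exact: subset_closure.
Qed.

Lemma usmooth_smooth_upto f : {within closure W, continuous f} ->
  usmooth f -> smooth_upto W f.
Proof.
move=> fc sf; split=> //; first by move=> vs x; apply: (sf vs).1.
move=> vs; have [g /ucont_within gc gf] := ucont_extension (sf vs).2.
by exists g => // x; rewrite inE => Wx; exact: gf.
Qed.

Lemma usmooth_smooth_on f : usmooth f -> smooth_on W f.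
Proof. by move=> sf vs x; apply: (sf vs).1. Qed.

Lemma usmooth_derive f v : usmooth f -> usmooth ('D_v f).
Proof.
by move=> sf vs; have := sf (rcons vs v); rewrite /iter_derive foldr_rcons.
Qed.

Lemma usmooth_diff f x : usmooth f -> W x -> differentiable f x.
Proof. by move=> sf; exact: (sf [::]).1. Qed.

Lemma usmooth_ucont f : usmooth f -> ucont W f.
Proof. by move=> sf; exact: (sf [::]).2. Qed.

(** Equality on [W] is built in because the derivatives of the generators are
   only known there. *)
Inductive alg (G : set (V -> R)) : (V -> R) -> Prop :=
| alg_gen g : G g -> alg G g
| alg_cst c : alg G (fun=> c)
| algD f g : alg G f -> alg G g -> alg G (fun x => f x + g x)
| algM f g : alg G f -> alg G g -> alg G (fun x => f x * g x)
| alg_eq f g : (forall x, W x -> f x = g x) -> alg G f -> alg G g.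

Lemma algS (G H : set (V -> R)) f : G `<=` H -> alg G f -> alg H f.
Proof.
move=> GH; elim=> {f} [g Gg|c|f g _ Hf _ Hg|f g _ Hf _ Hg|f g fg _ Hf].
- exact/alg_gen/GH.
- exact: alg_cst.
- exact: algD.
- exact: algM.
- exact: alg_eq fg Hf.
Qed.

Lemma alg_sum (G : set (V -> R)) (I : Type) (r : seq I) (P : pred I)
    (F : I -> V -> R) :
  (forall i, P i -> alg G (F i)) -> alg G (fun x => \sum_(i <- r | P i) F i x).
Proof.
move=> GF; elim: r => [|i r IH].
  by apply: alg_eq (alg_cst _ 0) => x _; rewrite big_nil.
case Pi : (P i).
  apply: alg_eq (algD (GF i Pi) IH) => x _; by rewrite big_cons Pi.
by apply: alg_eq IH => x _; rewrite big_cons Pi.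
Qed.

Lemma alg_prod (G : set (V -> R)) (I : Type) (r : seq I) (P : pred I)
    (F : I -> V -> R) :
  (forall i, P i -> alg G (F i)) -> alg G (fun x => \prod_(i <- r | P i) F i x).
Proof.
move=> GF; elim: r => [|i r IH].
  by apply: alg_eq (alg_cst _ 1) => x _; rewrite big_nil.
case Pi : (P i).
  apply: alg_eq (algM (GF i Pi) IH) => x _; by rewrite big_cons Pi.
by apply: alg_eq IH => x _; rewrite big_cons Pi.
Qed.

Lemma algN (G : set (V -> R)) f : alg G f -> alg G (fun x => - f x).
Proof.
move=> Gf; apply: alg_eq (algM (alg_cst _ (-1)) Gf) => x _.
by rewrite mulN1r.
Qed.

Lemma algB (G : set (V -> R)) f g :
  alg G f -> alg G g -> alg G (fun x => f x - g x).
Proof. by move=> Gf Gg; apply: algD => //; exact: algN. Qed.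

Lemma alg_diff (G : set (V -> R)) f :
  (forall g, G g -> forall x, W x -> differentiable g x) ->
  alg G f -> forall x, W x -> differentiable f x.
Proof.
move=> dG; elim=> {f} [g Gg|c|f g _ Hf _ Hg|f g _ Hf _ Hg|f g fg _ Hf] x Wx.
- exact: dG.
- exact: differentiable_cst.
- by apply: differentiableD; [exact: Hf|exact: Hg].
- by apply: differentiableM; [exact: Hf|exact: Hg].
- by apply: (eq_differentiable_open oW Wx fg); exact: Hf.
Qed.

Lemma alg_ucont (G : set (V -> R)) f :
  (forall g, G g -> ucont W g) -> alg G f -> ucont W f.
Proof.
move=> uG; elim=> {f} [g Gg|c|f g _ Hf _ Hg|f g _ Hf _ Hg|f g fg _ Hf].
- exact: uG.
- exact: ucont_cst.
- exact: ucontD.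
- by apply: ucontM => //; exact: ucont_bounded.
- exact: eq_ucont Hf.
Qed.

Lemma alg_derive (G H : set (V -> R)) f v : G `<=` H ->
  (forall g, G g -> forall x, W x -> differentiable g x) ->
  (forall g, G g -> alg H ('D_v g)) ->
  alg G f -> alg H ('D_v f).
Proof.
move=> GH dG DG.
elim=> {f} [g Gg|c|f g Af Hf Ag Hg|f g Af Hf Ag Hg|f g fg _ Hf].
- exact: DG.
- by apply: alg_eq (alg_cst _ 0) => x _; rewrite derive_cst.
- apply: alg_eq (algD Hf Hg) => x Wx.
  by rewrite deriveD//; apply: diff_derivable; apply: alg_diff Wx; eauto.
- apply: alg_eq (algD (algM (algS GH Af) Hg) (algM (algS GH Ag) Hf)) => x Wx.
  by rewrite deriveM//; apply: diff_derivable; apply: alg_diff Wx; eauto.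
- by apply: alg_eq Hf => x Wx; apply: (eq_derive_open _ oW).
Qed.

(** Derivatives of all orders are controlled by those of order one: once the
   derivatives of the generators are polynomials in the generators, so are all
   iterated derivatives. *)
Lemma alg_usmooth (G : set (V -> R)) f :
  (forall g, G g -> forall x, W x -> differentiable g x) ->
  (forall g, G g -> ucont W g) ->
  (forall g v, G g -> alg G ('D_v g)) ->
  alg G f -> usmooth f.
Proof.
move=> dG uG DG Gf vs.
have Gvs : alg G (iter_derive vs f).
  elim: vs => [|v vs IH] //=.
  by apply: (@alg_derive G G) => //; move=> g; exact: DG.
split; first exact: alg_diff dG Gvs.
exact: alg_ucont uG Gvs.
Qed.

Lemma alg_usmooth_closed f : alg usmooth f -> usmooth f.
Proof.
move=> af; apply: (alg_usmooth _ _ _ af) => g.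
- by move=> sg x; exact: usmooth_diff.
- exact: usmooth_ucont.
- by move=> v sg; apply: alg_gen; exact: usmooth_derive.
Qed.

Lemma derive_inv f x v : f x != 0 -> differentiable f x ->
  'D_v (fun y => (f y)^-1) x = - ((f x)^-1 * (f x)^-1 * 'D_v f x).
Proof.
move=> f0 df; rewrite deriveV//; last exact: diff_derivable.
by rewrite expr2 invfM scaleNr.
Qed.

Lemma usmoothV f : (forall x, W x -> f x != 0) ->
  bounded_on W (fun x => (f x)^-1) -> usmooth f ->
  usmooth (fun x => (f x)^-1).
Proof.
move=> f0 bf sf.
pose G := usmooth `|` [set (fun x => (f x)^-1)].
apply: (@alg_usmooth G); last by apply: alg_gen; right.
- move=> g [sg x Wx|-> x Wx]; first exact: usmooth_diff.
  by apply: differentiableV; [exact: usmooth_diff|exact: f0].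
- move=> g [|->]; first exact: usmooth_ucont.
  by apply: ucontV => //; exact: usmooth_ucont.
- move=> g v [sg|->]; first by apply: alg_gen; left; exact: usmooth_derive.
  have Gi : alg G (fun x => (f x)^-1) by apply: alg_gen; right.
  have GD : alg G ('D_v f) by apply: alg_gen; left; exact: usmooth_derive.
  apply: alg_eq (algN (algM (algM Gi Gi) GD)) => x Wx.
  by rewrite derive_inv//; [exact: f0|exact: usmooth_diff].
Qed.

Lemma alg_det (G : set (V -> R)) m (A : V -> 'M[R]_m) :
  (forall i j, alg G (fun x => A x i j)) -> alg G (fun x => \det (A x)).
Proof.
move=> GA; apply: alg_sum => s _; apply: algM; first exact: alg_cst.
by apply: alg_prod => i _; exact: GA.
Qed.

Lemma alg_invmx (G : set (V -> R)) m (A : V -> 'M[R]_m) i j :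
  (forall x, W x -> A x \in unitmx) ->
  (forall i j, alg G (fun x => A x i j)) ->
  alg G (fun x => (\det (A x))^-1) -> alg G (fun x => invmx (A x) i j).
Proof.
move=> uA GA Gd.
have Gc : alg G (fun x => cofactor (A x) j i).
  apply: algM; first exact: alg_cst.
  by apply: alg_det => k l; apply: alg_eq (GA _ _) => x _; rewrite !mxE.
apply: alg_eq (algM Gd Gc) => x Wx.
by rewrite /invmx uA// !mxE.
Qed.

End SmoothAlgebra.

Lemma alg_ucont_compact {R : realType} {V : normedModType R} (K : set V)
    (f : V -> R) : compact K -> alg K (ucont K) f -> ucont K f.
Proof.
move=> cK; apply: alg_ucont => //.
have /closure_id <- // : closed K.
by apply: (compact_closed _ cK); exact: norm_hausdorff.
Qed.

Lemma differentiable_bigsum {R : realType} {V V' : normedModType R} n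
    (F : 'I_n -> V -> V') x : (forall i, differentiable (F i) x) ->
  differentiable (fun y => \sum_i F i y) x.
Proof.
move=> dF; have := differentiable_sum dF.
by congr (differentiable _ _); apply/funext => y; rewrite fct_sumE.
Qed.

Section Gradient.
Context {R : realType} {n : nat}.
Implicit Types (f : 'rV[R]_n -> R).

Definition dot (u w : 'rV[R]_n) : R := \sum_i u 0 i * w 0 i.

Lemma derive_gradient f x w : differentiable f x ->
  'D_w f x = dot (gradient f x) w.
Proof.
move=> df; rewrite {1}(row_sum_delta w) deriveE// linear_sum /dot.
apply: eq_bigr => i _; rewrite linearZ mxE [RHS]mulrC.
by rewrite /std_basis deriveE.
Qed.

Lemma differentiable_rV (V : normedModType R) (X : V -> 'rV[R]_n) z :
  (forall i, differentiable (fun y => X y 0 i) z) -> differentiable X z.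
Proof.
move=> dX; rewrite (_ : X = (fun y => \sum_i X y 0 i *: std_basis i)).
  apply: (@differentiable_bigsum _ _ _ n (fun i y => X y 0 i *: std_basis i)).
  by move=> i; exact: differentiableZl.
by apply/funext => y; exact: row_sum_delta.
Qed.

Lemma derive_coord (V : normedModType R) (X : V -> 'rV[R]_n) z v i :
  differentiable X z -> 'D_v X z 0 i = 'D_v (fun y => X y 0 i) z.
Proof.
move=> dX; rewrite derive_mx; last exact: diff_derivable.
by rewrite mxE.
Qed.

Lemma chain_gradient (V : normedModType R) f (X : V -> 'rV[R]_n) z v :
  differentiable X z -> differentiable f (X z) ->
  differentiable (fun y => f (X y)) z /\
  'D_v (fun y => f (X y)) z = dot (gradient f (X z)) ('D_v X z).
Proof.
move=> dX df; have dfX : differentiable (f \o X) z by exact: differentiable_comp.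
split => //; rewrite -derive_gradient//.
by rewrite (deriveE _ dfX) diff_comp//= deriveE// deriveE.
Qed.

End Gradient.

Section Extension.
Context {R : realType} {V : normedModType R}.
Variable W : set V.

Lemma mx_normP m p (A : 'M[R]_(m, p)) (e : R) : 0 <= e ->
  (`|A| <= e <-> forall i j, `|A i j| <= e).
Proof.
move=> e0; rewrite [`|A|]/Num.Def.normr/= mx_normrE; split.
  move=> /bigmax_leP[_ Ae] i j; exact: (Ae (i, j)).
by move=> Ae; apply/bigmax_leP; split => // -[i j] _; exact: Ae.
Qed.

Lemma cvg_mx (T : Type) (F : set_system T) {FF : Filter F} m p
    (A : T -> 'M[R]_(m, p)) (L : 'M[R]_(m, p)) :
  (forall i j, A x i j @[x --> F] --> L i j) -> A @ F --> L.
Proof.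
move=> AL; apply/cvgrPdist_le => e e0.
have : \forall x \near F, forall i j, `|L i j - A x i j| <= e.
  apply: filter_forall => i; apply: filter_forall => j.
  by have /cvgrPdist_le := AL i j; exact.
apply: filterS => x xe; apply/mx_normP; first exact: ltW.
by move=> i j; rewrite !mxE.
Qed.

Lemma hessian_cvg m (e : 'I_m -> V) f (g : 'I_m -> 'I_m -> V -> R) z :
  closure W z ->
  (forall i j, ucont (closure W) (g i j)) ->
  (forall i j x, W x -> g i j x = iter_derive [:: e i; e j] f x) ->
  hessian e f @ within W (nbhs z) --> \matrix_(i, j) g i j z.
Proof.
move=> cz gu gf; apply: cvg_mx => i j; rewrite mxE.
have := @cvg_within_extension R V W (fun x => hessian e f x i j) (g i j) z cz.
apply; first exact: ucont_within.
by move=> x Wx; rewrite mxE gf.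
Qed.

Lemma ext_hessian m (e : 'I_m -> V) f (g : 'I_m -> 'I_m -> V -> R) z :
  closure W z ->
  (forall i j, ucont (closure W) (g i j)) ->
  (forall i j x, W x -> g i j x = iter_derive [:: e i; e j] f x) ->
  ext_value W (hessian e f) z = \matrix_(i, j) g i j z.
Proof.
move=> cz gu gf; by apply: ext_value_lim => //; exact: hessian_cvg.
Qed.

End Extension.

(** * The scalar product and convex domains *)

Section Dot.
Context {R : realType} {n : nat}.
Implicit Types u w : 'rV[R]_n.

Lemma dotC u w : dot u w = dot w u.
Proof. by apply: eq_bigr => i _; rewrite mulrC. Qed.

Lemma dotDl u u' w : dot (u + u') w = dot u w + dot u' w.
Proof. by rewrite -big_split; apply: eq_bigr => i _; rewrite mxE mulrDl. Qed.

Lemma dotZl (a : R) u w : dot (a *: u) w = a * dot u w.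
Proof. by rewrite /dot mulr_sumr; apply: eq_bigr => i _; rewrite mxE mulrA. Qed.

Lemma dotNl u w : dot (- u) w = - dot u w.
Proof. by rewrite -scaleN1r dotZl mulN1r. Qed.

Lemma dotBl u u' w : dot (u - u') w = dot u w - dot u' w.
Proof. by rewrite dotDl dotNl. Qed.

Lemma dotDr u w w' : dot u (w + w') = dot u w + dot u w'.
Proof. by rewrite dotC dotDl !(dotC _ u). Qed.

Lemma dotZr (a : R) u w : dot u (a *: w) = a * dot u w.
Proof. by rewrite dotC dotZl dotC. Qed.

Lemma dotNr u w : dot u (- w) = - dot u w.
Proof. by rewrite dotC dotNl dotC. Qed.

Lemma dotBr u w w' : dot u (w - w') = dot u w - dot u w'.
Proof. by rewrite dotDr dotNr. Qed.

Lemma dot0l w : dot 0 w = 0.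
Proof. by rewrite -(scale0r w) dotZl mul0r. Qed.

Lemma dot_mx u w : dot u w = (u *m w^T) 0 0.
Proof. by rewrite mxE; apply: eq_bigr => i _; rewrite mxE. Qed.

Lemma dot_ge0 w : 0 <= dot w w.
Proof. by apply: sumr_ge0 => i _; rewrite -expr2 sqr_ge0. Qed.

Lemma coord_norm u i : `|u 0 i| <= `|u|.
Proof. by apply: (mx_normP u (normr_ge0 u)).1. Qed.

Lemma rV_normP u (e : R) : 0 <= e ->
  (`|u| <= e <-> forall i, `|u 0 i| <= e).
Proof.
move=> e0; split=> [ue i|ue]; first exact: le_trans (coord_norm _ _) ue.
by apply/(mx_normP u e0) => i j; rewrite ord1.
Qed.

Lemma norm_dot u w : `|dot u w| <= n%:R * (`|u| * `|w|).
Proof.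
apply: le_trans (ler_norm_sum _ _ _) _.
rewrite mulr_natl -[X in _ *+ X](card_ord n) -sumr_const.
by apply: ler_sum => i _; rewrite normrM ler_pM// coord_norm.
Qed.

Lemma sqr_norm_dot w : `|w| * `|w| <= dot w w.
Proof.
have [->|w0] := eqVneq w 0; first by rewrite normr0 mul0r dot_ge0.
have [[i0 i] /= wi] : exists ij : 'I_1 * 'I_n, `|w| = `|w ij.1 ij.2|.
  by apply: mx_norm_neq0; rewrite -[mx_norm w]/(`|w|) normr_eq0.
rewrite wi ord1 /dot (bigD1 i)//= -normrM ger0_norm -?expr2 ?sqr_ge0//.
by rewrite lerDl; apply: sumr_ge0 => j _; rewrite -expr2 sqr_ge0.
Qed.

Lemma dot_le_norm w : dot w w <= n%:R * (`|w| * `|w|).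
Proof. exact: le_trans (ler_norm _) (norm_dot _ _). Qed.

Lemma dot_eq0 w : dot w w <= 0 -> w = 0.
Proof.
move=> w0; apply/eqP; rewrite -normr_le0.
have := le_trans (sqr_norm_dot w) w0.
by rewrite -expr2 real_exprn_even_le0 ?normr_real//= => /eqP->.
Qed.

Lemma dot_gt0 w : w != 0 -> 0 < dot w w.
Proof.
by rewrite ltNge => /negP w0; apply/negP => /dot_eq0/eqP.
Qed.

End Dot.

Section ConvexDomain.
Context {R : realType} {n : nat}.
Variable U : set 'rV[R]_n.
Hypothesis dU : smooth_strictly_convex_domain U.

Lemma domain_open : open U. Proof. by case: dU. Qed.

Lemma domain_norm_bound : exists2 M : R, 0 < M & forall x, U x -> `|x| <= M.
Proof.
have [_ _ bU _ _] := dU; have [M M0 MP] := ex_strict_bound_gt0 bU.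
by exists M => // x Ux; exact/ltW/MP.
Qed.

Lemma domain_compact : compact (closure U).
Proof.
apply: bounded_closed_compact; last exact: closed_closure.
have [M M0 MP] := domain_norm_bound.
exists (M + 1); split; first exact: num_real.
move=> r Mr x /closure_normP/(_ _ ltr01)[y Uy xy].
apply: le_trans (ltW Mr); rewrite -(subrK y x) addrC.
by rewrite (le_trans (ler_normD _ _))// lerD//; [exact: MP|exact: ltW].
Qed.

Lemma closure_segment x y (s : R) : U x -> closure U y -> 0 <= s < 1 ->
  U ((1 - s) *: x + s *: y).
Proof.
case: dU => oU _ _ _ scU Ux cy /andP[]; rewrite le_eqVlt => /orP[/eqP<- _|s0 s1].
  by rewrite subr0 scale1r scale0r addr0.
have [<-|xy] := eqVneq x y; first by rewrite -scalerDl subrK scale1r.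
apply: interior_subset; apply: scU => //; last by rewrite s0.
exact: subset_closure.
Qed.

Lemma domain_convex : is_convex U.
Proof.
move=> x y Ux Uy s /andP[s0]; rewrite le_eqVlt => /orP[/eqP->|s1].
  by rewrite subrr scale0r scale1r add0r.
by apply: closure_segment => //; [exact: subset_closure|rewrite s0].
Qed.

Lemma boundaryE x : boundary U x <-> closure U x /\ ~ U x.
Proof.
rewrite /boundary; have /interior_id -> := domain_open; split => [[]|[]] //.
Qed.

Lemma closure_cases x : closure U x -> U x \/ boundary U x.
Proof.
by move=> cx; have [Ux|Ux] := pselect (U x); [left|right; apply/boundaryE].
Qed.

End ConvexDomain.

(** * Uniform convexity of the data *)

Lemma bounded_family {R : realType} {V : normedModType R} (W : set V) m
    (F : 'I_m -> V -> R) :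
  (forall i, bounded_on W (F i)) ->
  exists2 M : R, 0 < M & forall i x, W x -> `|F i x| <= M.
Proof.
move=> FB; have /choice[M MP] : forall i, exists M : R,
    0 < M /\ forall x, W x -> `|F i x| <= M.
  by move=> i; have [M M0 MF] := FB i; exists M.
exists (1 + \sum_i M i).
  by rewrite ltr_pwDl// sumr_ge0// => i _; rewrite ltW//; case: (MP i).
move=> i x Wx; apply: le_trans ((MP i).2 x Wx) _.
rewrite (bigD1 i)//= addrCA lerDl addr_ge0// sumr_ge0// => j _.
by rewrite ltW//; case: (MP j).
Qed.

Section UsmoothOnConvex.
Context {R : realType} {n : nat}.
Variable U : set 'rV[R]_n.
Hypothesis oU : open U.
Hypothesis cU : compact (closure U).
Hypothesis vU : is_convex U.

Lemma second_derive f x u w : usmooth U f -> U x ->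
  'D_u ('D_w f) x = dot (u *m hessian std_basis f x) w.
Proof.
move=> sf Ux.
have df y : U y -> differentiable f y by exact: usmooth_diff.
have ddf y i : U y -> differentiable ('D_(std_basis i) f) y.
  by move=> Uy; apply: usmooth_diff Uy; exact: usmooth_derive.
rewrite (@eq_derive_open _ _ _ U _
  (fun y => \sum_i w 0 i * 'D_(std_basis i) f y) _ _ oU Ux); last first.
  move=> y Uy; rewrite derive_gradient; last exact: df.
  by rewrite dotC; apply: eq_bigr => i _; rewrite mxE.
have dsum i : differentiable (fun y => w 0 i * 'D_(std_basis i) f y) x.
  by apply: differentiableM; [exact: differentiable_cst|exact: ddf].
rewrite -fct_sumE derive_sum; last by move=> i; exact: diff_derivable.
rewrite dotC; apply: eq_bigr => j _.
rewrite deriveMl; last by apply: diff_derivable; exact: ddf.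
congr (_ * _); rewrite derive_gradient; last exact: ddf.
rewrite dotC mxE; apply: eq_bigr => i _; by rewrite !mxE.
Qed.

Lemma usmooth_mvt f x y : usmooth U f -> U x -> U y ->
  exists s : R, [/\ 0 < s < 1, U (x + s *: (y - x)) &
    f y - f x = dot (gradient f (x + s *: (y - x))) (y - x)].
Proof.
move=> sf Ux Uy; have Us (s : R) : 0 <= s <= 1 -> U (x + s *: (y - x)).
  by apply: segment_convex => //; rewrite subrKC.
have [s s01 fE] : exists2 s : R, 0 < s < 1 &
    f (x + (y - x)) - f x = 'D_(y - x) f (x + s *: (y - x)).
  by apply: mvt_line => s s01; apply: usmooth_diff (Us s s01).
have Uss : U (x + s *: (y - x)).
  by apply: Us; case/andP: s01 => s0 s1; rewrite !ltW.
exists s; split => //.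
rewrite -derive_gradient; last exact: usmooth_diff Uss.
by rewrite -fE subrKC.
Qed.

Lemma usmooth_lipschitz f : usmooth U f ->
  exists2 L : R, 0 < L & forall x y, U x -> U y -> `|f y - f x| <= L * `|y - x|.
Proof.
move=> sf; have [M M0 MP] := @bounded_family _ _ U _
  (fun i => 'D_(std_basis i) f) (fun i =>
  ucont_bounded cU (usmooth_ucont (usmooth_derive (std_basis i) sf))).
exists (n.+1%:R * M); first by rewrite mulr_gt0.
move=> x y Ux Uy; have [s [_ Us ->]] := usmooth_mvt sf Ux Uy.
apply: le_trans (norm_dot _ _) _; rewrite -mulrA.
apply: ler_pM; rewrite ?ler_nat//.
rewrite ler_wpM2r//; apply/rV_normP; first exact: ltW.
by move=> i; rewrite mxE; exact: MP.
Qed.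

Lemma gradient_lipschitz f : usmooth U f ->
  exists2 L : R, 0 < L & forall x y, U x -> U y ->
    `|gradient f y - gradient f x| <= L * `|y - x|.
Proof.
move=> sf; have /choice[L LP] : forall i, exists L : R, 0 < L /\
    forall x y, U x -> U y ->
    `|'D_(std_basis i) f y - 'D_(std_basis i) f x| <= L * `|y - x|.
  move=> i; have [L L0 LP] := usmooth_lipschitz (usmooth_derive (std_basis i) sf).
  by exists L.
have S0 : 0 <= \sum_i L i by rewrite sumr_ge0// => i _; case: (LP i) => /ltW.
exists (1 + \sum_i L i) => [|x y Ux Uy]; first by rewrite ltr_pwDl.
have L0 : 0 <= (1 + \sum_i L i) * `|y - x| by rewrite mulr_ge0// addr_ge0.
apply/rV_normP => // i; rewrite !mxE.
apply: le_trans ((LP i).2 x y Ux Uy) _; rewrite ler_wpM2r//.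
rewrite (bigD1 i)//= addrCA lerDl addr_ge0// sumr_ge0// => j _.
by case: (LP j) => /ltW.
Qed.

End UsmoothOnConvex.

Section ClassS.
Context {R : realType} {n : nat}.
Hypothesis n0 : (0 < n)%N.
Variable U : set 'rV[R]_n.
Hypothesis dU : smooth_strictly_convex_domain U.
Variable v : 'rV[R]_n -> R.
Hypothesis Sv : calS U v.

Let oU := domain_open dU.
Let cU := domain_compact dU.
Let vU := domain_convex dU.

Lemma calS_usmooth : usmooth U v.
Proof. by case: Sv => sv _ _; exact: smooth_upto_usmooth. Qed.
Let sv := calS_usmooth.

Lemma calS_continuous : {within closure U, continuous v}.
Proof. by case: Sv => -[]. Qed.

Lemma calS_boundary x : boundary U x -> v x = 0.
Proof. by case: Sv => _ _; exact. Qed.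

Lemma calS_hessian_ext : exists2 g : 'I_n -> 'I_n -> 'rV[R]_n -> R,
  forall i j, ucont (closure U) (g i j) &
  (forall x, U x -> hessian std_basis v x = \matrix_(i, j) g i j x) /\
  (forall x, closure U x -> posdef (\matrix_(i, j) g i j x)).
Proof.
have /choice[g gP] : forall ij : 'I_n * 'I_n, exists g, ucont (closure U) g /\
    forall x, U x -> g x = iter_derive [:: std_basis ij.1; std_basis ij.2] v x.
  move=> [i j]; have [_ uv] := sv [:: std_basis i; std_basis j].
  by have [g gu gv] := ucont_extension uv; exists g.
exists (fun i j => g (i, j)); first by move=> i j; case: (gP (i, j)).
split=> [x Ux|x cx].
  by apply/matrixP => i j; rewrite !mxE (gP (i, j)).2.
case: Sv => _ pd _; have := pd x cx.
rewrite (@ext_hessian _ _ U _ _ _ (fun i j => g (i, j)))//.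
  by move=> i j; case: (gP (i, j)).
by move=> i j y Uy; exact: (gP (i, j)).2.
Qed.

(** The Hessian is positive definite on the compact set [closure U], hence
   uniformly so: minimize the quadratic form over [closure U] and the unit
   sphere. *)
Lemma calS_hessian_pos : exists2 c : R, 0 < c & forall x w, U x ->
  c * dot w w <= dot (w *m hessian std_basis v x) w.
Proof.
have [x0 Ux0] : exists x, U x by case: dU.
have [g gu [gE pd]] := calS_hessian_ext.
pose S := [set w : 'rV[R]_n | `|w| = 1].
have cS : compact S.
  apply: bounded_closed_compact.
    exists 1; split; first exact: num_real.
    by move=> r r1 w /= ->; exact: ltW.
  apply: (@closed_comp _ _ (Num.norm : 'rV[R]_n -> R) [set 1]).
    by move=> w _; exact: norm_continuous.
  exact: closed_eq.
pose K := closure U `*` S.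
have cK : compact K by apply: compact_setX.
pose q (z : 'rV[R]_n * 'rV[R]_n) :=
  \sum_i (\sum_j z.2 0 j * g j i z.1) * z.2 0 i.
have sub1 x y : `|x.1 - y.1| <= `|x - y :> 'rV[R]_n * 'rV[R]_n|.
  by rewrite [leRHS]prod_normE le_max lexx.
have sub2 x y : `|x.2 - y.2| <= `|x - y :> 'rV[R]_n * 'rV[R]_n|.
  by rewrite [leRHS]prod_normE le_max lexx orbT.
have uw i : ucont K (fun z => z.2 0 i).
  move=> e e0; exists e => // x y _ _ xy; apply: ltW; apply: le_lt_trans xy.
  apply: le_trans (sub2 x y); have := coord_norm (x.2 - y.2) i.
  by rewrite !mxE.
have ug i j : ucont K (fun z => g i j z.1).
  move=> e e0; have [d d0 dP] := gu i j e e0; exists d => // x y [Kx _] [Ky _] xy.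
  by apply: dP => //; exact: le_lt_trans (sub1 x y) xy.
have uq : ucont K q.
  apply: (alg_ucont_compact cK).
  apply: alg_sum => i _; apply: algM; last by apply: alg_gen; exact: uw.
  by apply: alg_sum => j _; apply: algM; apply: alg_gen; [exact: uw|exact: ug].
have qE x w : q (x, w) = dot (w *m \matrix_(i, j) g i j x) w.
  rewrite /q /dot; apply: eq_bigr => i _; rewrite mxE; congr (_ * _).
  by apply: eq_bigr => j _; rewrite mxE.
have K0 : K !=set0.
  exists (x0, const_mx 1); split; first exact: subset_closure.
  rewrite /S /=; apply/eqP; rewrite eq_le; apply/andP; split.
    by apply/rV_normP => // i; rewrite mxE normr1.
  have := coord_norm (const_mx 1 : 'rV[R]_n) (Ordinal n0).
  by rewrite mxE normr1.
have [[x1 w1]] := compact_EVT_min K0 cK (ucont_within uq).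
rewrite inE => -[/= cx1 w11] qmin.
have m0 : 0 < q (x1, w1).
  have [_] := pd x1 cx1; rewrite qE dot_mx; apply.
  by rewrite -normr_gt0 w11.
exists (q (x1, w1) / n%:R) => [|x w Ux]; first by rewrite divr_gt0// ltr0n.
have [->|w0] := eqVneq w 0; first by rewrite mul0mx !dot0l mulr0.
have wp : 0 < `|w| by rewrite normr_gt0.
have : q (x1, w1) <= q (x, `|w|^-1 *: w).
  apply: qmin; rewrite inE; split => /=; first exact: subset_closure.
  by rewrite /S /= normrZ normfV normr_id mulVf// gt_eqF.
rewrite [X in _ <= X]qE -gE// -scalemxAl dotZl dotZr mulrA -invfM => qm.
apply: le_trans (_ : q (x1, w1) * (`|w| * `|w|) <= _); last first.
  by rewrite mulrC -ler_pdivlMl// mulr_gt0.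
rewrite -mulrA ler_pM2l// ler_pdivrMl ?ltr0n//.
exact: dot_le_norm.
Qed.

(** Mean value theorem for the derivative of [v] along [x - y]. *)
Lemma calS_monotone : exists2 c : R, 0 < c & forall x y, U x -> U y ->
  c * dot (x - y) (x - y) <= dot (gradient v x - gradient v y) (x - y).
Proof.
have [c c0 cP] := calS_hessian_pos; exists c => // x y Ux Uy.
have Us (s : R) : 0 <= s <= 1 -> U (y + s *: (x - y)).
  by apply: segment_convex => //; rewrite subrKC.
have [s s01] : exists2 s : R, 0 < s < 1 &
    'D_(x - y) v (y + (x - y)) - 'D_(x - y) v y =
    'D_(x - y) ('D_(x - y) v) (y + s *: (x - y)).
  apply: (@mvt_line _ _ ('D_(x - y) v)) => s s01; apply: usmooth_diff (Us s s01).
  exact: usmooth_derive.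
have s01' : 0 <= s <= 1 by case/andP: s01 => s0 s1; rewrite !ltW.
rewrite subrKC (second_derive oU)//; last exact: Us.
rewrite !derive_gradient; try exact: usmooth_diff.
rewrite -dotBl => ->.
by apply: cP; exact: Us.
Qed.

End ClassS.

Lemma ucont_coord {R : realType} {n : nat} (W : set 'rV[R]_n) i :
  ucont W (fun y => y 0 i).
Proof.
move=> e e0; exists e => // x y _ _ xy; apply: ltW; apply: le_lt_trans xy.
by have := coord_norm (x - y) i; rewrite !mxE.
Qed.

Lemma closure_ge0 {R : realType} {V : normedModType R} (W : set V)
    (F : V -> R) : {within closure W, continuous F} ->
  (forall x, W x -> 0 <= F x) -> forall x, closure W x -> 0 <= F x.
Proof.
move=> Fc F0 x cx; apply/ler_addgt0Pr => e e0.
have /within_cvgP/(_ e e0)[d d0 dP] := (within_continuousP _ _).1 Fc x cx.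
have [y Wy xy] := (closure_normP _ _).1 cx d d0.
have := dP y (subset_closure Wy) xy; rewrite ler_norml => /andP[+ _].
have := F0 y Wy; lra.
Qed.

Lemma closure_eq {R : realType} {V : normedModType R} (W : set V)
    (F G : V -> R) z : ucont (closure W) F -> ucont (closure W) G ->
  (forall z, W z -> F z = G z) -> closure W z -> F z = G z.
Proof.
move=> uF uG FG cz.
have sub (H K : V -> R) : ucont (closure W) H -> ucont (closure W) K ->
    (forall z, W z -> H z = K z) -> 0 <= H z - K z.
  move=> uH uK HK; apply: (closure_ge0 (F := fun y => H y - K y) _ _ cz).
    apply: ucont_within; apply: (ucontD uH) => e /uK[d d0 dP].
    by exists d => // x y cx cy xy; rewrite -opprD normrN; exact: dP.
  by move=> y Wy; rewrite HK// subrr.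
apply/eqP; rewrite eq_le -subr_ge0 sub//=; last by move=> *; rewrite FG.
by rewrite -subr_ge0 sub.
Qed.

(** The supremum of the parameters whose points stay in [U] is a boundary
   point. *)
Lemma segment_exit {R : realType} {V : normedModType R} (W : set V) x y :
  open W -> W x -> ~ W y -> exists s : R,
    [/\ 0 <= s <= 1, closure W (x + s *: (y - x)) & ~ W (x + s *: (y - x))].
Proof.
move=> oW Wx Wy; pose A := [set s : R | 0 <= s <= 1 /\ W (x + s *: (y - x))].
have A0 : A 0 by split; rewrite ?lexx ?ler01// scale0r addr0.
have sA : has_sup A.
  by split; [exists 0|exists 1 => s [/andP[]]].
have s0 : 0 <= sup A by apply: sup_upper_bound.
have s1 : sup A <= 1 by apply: ge_sup => [|s [/andP[]]]; first by exists 0.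
have yx0 : 0 < `|y - x|.
  by rewrite normr_gt0 subr_eq0; apply/eqP => yx; apply: Wy; rewrite yx.
exists (sup A); split; first by rewrite s0.
  apply/closure_normP => d d0.
  have dd : 0 < d / `|y - x| by rewrite divr_gt0.
  have [s [s01 Ws] ls] := sup_adherent dd sA.
  exists (x + s *: (y - x)) => //.
  rewrite opprD addrACA subrr add0r -scalerBl normrZ -ltr_pdivlMr//.
  rewrite ger0_norm ?subr_ge0; last exact: (sup_upper_bound sA).
  by move: ls; move: (d / `|y - x|) => q; lra.
move=> Wb; have [r r0 rP] := open_normP oW Wb.
have lt1 : sup A < 1.
  rewrite lt_neqAle s1 andbT; apply/eqP => e1.
  by apply: Wy; move: Wb; rewrite e1 scale1r subrKC.
pose m := Num.min (1 - sup A) (r / `|y - x| / 2).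
have m0 : 0 < m by rewrite lt_min subr_gt0 lt1 !divr_gt0.
suff /(sup_upper_bound sA) : A (sup A + m) by rewrite gerDl leNgt m0.
split.
  rewrite addr_ge0 ?(ltW m0)//= -lerBrDl.
  by rewrite /m ge_min lexx.
apply: rP; rewrite opprD addrACA subrr add0r -scalerBl [_ + m]addrC addrK.
rewrite normrZ gtr0_norm// -ltr_pdivlMr//.
apply: le_lt_trans (_ : r / `|y - x| / 2 < _); first by rewrite ge_min lexx orbT.
have : 0 < r / `|y - x| by rewrite divr_gt0.
by move: (r / `|y - x|) => q; lra.
Qed.

Section ClassSConvexity.
Context {R : realType} {n : nat}.
Hypothesis n0 : (0 < n)%N.
Variable U : set 'rV[R]_n.
Hypothesis dU : smooth_strictly_convex_domain U.
Variable v : 'rV[R]_n -> R.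
Hypothesis Sv : calS U v.

Let oU := domain_open dU.
Let cU := domain_compact dU.
Let vU := domain_convex dU.
Let sv := calS_usmooth dU Sv.

(* The mean value theorem on the first half of the segment gives the supporting
   hyperplane; on the second half the gradient has already grown by half of the
   modulus of monotonicity, which yields the quadratic term. *)
Let support_inside : exists2 c : R, 0 < c & forall x y, U x -> U y ->
  v x + dot (gradient v x) (y - x) + c * dot (y - x) (y - x) <= v y.
Proof.
have [c c0 cP] := calS_monotone n0 dU Sv.
have [c4 {}cP] : 0 < c / 4 /\ forall x z s, U x -> U z -> 0 < s ->
    U (x + s *: (z - x)) -> c * s * dot (z - x) (z - x) <=
    dot (gradient v (x + s *: (z - x))) (z - x) - dot (gradient v x) (z - x).
  split; first by rewrite divr_gt0.
  move=> x z s Ux Uz s0 Us; have := cP _ _ Us Ux.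
  rewrite [_ + _ - _]addrAC subrr add0r !dotZr dotZl -dotBl.
  move=> mono; rewrite -(ler_pM2l s0); apply: le_trans mono.
  rewrite le_eqVlt; apply/orP; left; apply/eqP; ring.
have D0 (w : 'rV[R]_n) : 0 <= dot w w := dot_ge0 w.
have weak x z : U x -> U z -> v x + dot (gradient v x) (z - x) <= v z.
  move=> Ux Uz; have [s [/andP[s0 _] Us vE]] := usmooth_mvt vU sv Ux Uz.
  have := cP x z s Ux Uz s0 Us; rewrite -vE.
  have : 0 <= c * s * dot (z - x) (z - x) by rewrite !mulr_ge0// ltW.
  lra.
exists (c / 4) => // x y Ux Uy; pose m := x + 2^-1 *: (y - x).
have Um : U m.
  by apply: segment_convex => //; rewrite ?subrKC//; apply/andP; split; lra.
have [s [/andP[s0 s1] Us vE]] := usmooth_mvt vU sv Um Uy.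
have xE : m + s *: (y - m) = x + (2^-1 + s / 2) *: (y - x).
  by rewrite /m; apply/rowP => k; rewrite !mxE; field.
have yE : y - m = 2^-1 *: (y - x).
  by rewrite /m; apply/rowP => k; rewrite !mxE; field.
have mE : m - x = 2^-1 *: (y - x) by rewrite /m [x + _]addrC addrK.
have := weak x m Ux Um; rewrite mE dotZr => w1.
rewrite xE in Us vE; have q0 : 0 < 2^-1 + s / 2 by lra.
have := cP x y _ Ux Uy q0 Us.
rewrite yE dotZr in vE.
have : 0 <= s / 2 * (c * dot (y - x) (y - x)).
  by rewrite !mulr_ge0// ltW.
move: vE w1.
move: (dot (gradient v _) _) (dot (gradient v x) _) (dot (y - x) (y - x)).
move=> a b D; lra.
Qed.

Lemma calS_support : exists2 c : R, 0 < c & forall x y, U x -> closure U y ->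
  v x + dot (gradient v x) (y - x) + c * dot (y - x) (y - x) <= v y.
Proof.
have [c c0 cP] := support_inside; exists c => // x y Ux cy.
rewrite -subr_ge0; move: y cy; apply: closure_ge0; last first.
  by move=> y Uy; rewrite subr_ge0; exact: cP.
apply: ucont_within; apply: (alg_ucont_compact cU).
apply: algB.
  by apply: alg_gen; apply: (compact_ucont cU); exact: calS_continuous.
have yc i : alg (closure U) (ucont (closure U)) (fun y : 'rV[R]_n => (y - x) 0 i).
  rewrite (_ : (fun y => _) = (fun y : 'rV[R]_n => y 0 i - x 0 i)); last first.
    by apply/funext => y; rewrite !mxE.
  by apply: algB; [apply: alg_gen; exact: ucont_coord|exact: alg_cst].
apply: algD; first (apply: algD; first exact: alg_cst).
  by apply: alg_sum => i _; apply: algM; [exact: alg_cst|exact: yc].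
apply: algM; first exact: alg_cst.
by apply: alg_sum => i _; apply: algM; exact: yc.
Qed.

(** Both ends are estimated by the supporting hyperplane at the intermediate
   point. *)
Lemma calS_convex x y (s : R) : U x -> closure U y -> 0 <= s < 1 ->
  v ((1 - s) *: x + s *: y) <= (1 - s) * v x + s * v y.
Proof.
move=> Ux cy s01; have [c c0 cP] := calS_support.
have Uz := closure_segment dU Ux cy s01; set z := _ + _ in Uz *.
have /andP[s0 s1] := s01.
have := cP z x Uz (subset_closure Ux); have := cP z y Uz cy.
have xz : x - z = s *: (x - y).
  by apply/rowP => k; rewrite !mxE; ring.
have yz : y - z = (1 - s) *: (y - x).
  by apply/rowP => k; rewrite !mxE; ring.
rewrite xz yz !dotZr !dotZl -[y - x]opprB !dotNr dotNl opprK.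
have D0 : 0 <= c * dot (x - y) (x - y) by rewrite mulr_ge0 ?dot_ge0// ltW.
move: D0; move: (dot (gradient v z) _) (dot (x - y) _) => a D D0 hy hx.
have s10 : 0 <= 1 - s by lra.
have hx' : v z + s * a <= v x.
  by apply: le_trans hx; rewrite lerDl mulrCA mulr_ge0// mulrCA mulr_ge0.
have hy' : v z + (1 - s) * - a <= v y.
  by apply: le_trans hy; rewrite lerDl mulrCA mulr_ge0// mulrCA mulr_ge0.
have := ler_wpM2l s10 hx'; have := ler_wpM2l s0 hy'; lra.
Qed.

(** The quadratic term in [calS_support], applied with opposite increments,
   excludes interior maxima; so the maximum over [closure U] is the boundary
   value zero, attained at no interior point. *)
Lemma calS_neg x : U x -> v x < 0.
Proof.
have [c c0 cP] := calS_support.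
have [x0 Ux0] : exists x, U x by case: dU.
have [m] := compact_EVT_max (ex_intro _ x0 (subset_closure Ux0)) cU
  (calS_continuous Sv).
rewrite inE => cm mmax.
have vm y : U y -> v y <= v m.
  by move=> Uy; apply: mmax; rewrite inE; exact: subset_closure.
have nomax z : U z -> v z < v m.
  move=> Uz; rewrite lt_neqAle vm// andbT; apply/eqP => vzm.
  have [r r0 rP] := open_normP oU Uz.
  pose w : 'rV[R]_n := (r / 2) *: const_mx 1.
  have w0 : w != 0.
    apply/eqP => /rowP/(_ (Ordinal n0)); rewrite !mxE mulr1 => r20; lra.
  have wr : `|w| < r.
    apply: le_lt_trans (_ : r / 2 < r); last by lra.
    apply/rV_normP => [|i]; first by lra.
    by rewrite !mxE mulr1 ger0_norm//; lra.
  have Up : U (z + w) by apply: rP; rewrite [z + w]addrC addrK.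
  have Um : U (z - w) by apply: rP; rewrite [z - w]addrC addrK normrN.
  have := cP z _ Uz (subset_closure Up); have := cP z _ Uz (subset_closure Um).
  rewrite [z + w]addrC [z - w]addrC !addrK !dotNr dotNl opprK.
  have := vm _ Up; have := vm _ Um; rewrite [z + w]addrC [z - w]addrC.
  have : 0 < c * dot w w by rewrite mulr_gt0// dot_gt0.
  lra.
have bm : boundary U m.
  by apply/boundaryE => //; split => // /nomax; rewrite ltxx.
by move=> Ux; rewrite -(calS_boundary Sv bm); exact: nomax.
Qed.

Lemma calS_lipschitz : exists2 L : R, 0 < L & forall x y, U x -> closure U y ->
  `|v y - v x| <= L * `|y - x|.
Proof.
have [L L0 LP] := usmooth_lipschitz cU vU sv.
exists L => // x y Ux cy; apply/ler_addgt0Pr => e e0.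
have e20 : 0 < e / 2 by lra.
have eL : 0 < e / 2 / L by rewrite divr_gt0.
have /within_cvgP/(_ _ e20)[d d0 dP] :=
  (within_continuousP _ _).1 (calS_continuous Sv) y cy.
have [|z Uz yz] := (closure_normP _ _).1 cy (Num.min d (e / 2 / L)).
  by rewrite lt_min d0.
move: yz; rewrite lt_min => /andP[yd ye].
apply: le_trans (ler_distD (v z) _ _) _.
have h1 := dP z (subset_closure Uz) yd.
have h2 := LP x z Ux Uz.
have h3 : L * `|z - x| <= L * `|y - x| + e / 2.
  have -> : e / 2 = L * (e / 2 / L) by field; rewrite gt_eqF.
  rewrite -mulrDr ler_pM2l//; apply: le_trans (ler_distD y _ _) _.
  by rewrite addrC lerD2l distrC ltW.
lra.
Qed.

(** Outside of [U] the function may be anything, but the segment from [x] to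
   [y] meets the boundary, where [v] vanishes. *)
Lemma calS_exit : exists2 L : R, 0 < L & forall x y, U x -> ~ U y ->
  `|v x| <= L * `|y - x|.
Proof.
have [L L0 LP] := calS_lipschitz; exists L => // x y Ux Uy.
have [s [/andP[s0 s1] cs Us]] := segment_exit oU Ux Uy.
have := LP x _ Ux cs; rewrite (calS_boundary Sv); last by apply/boundaryE.
rewrite sub0r normrN [x + _]addrC addrK normrZ ger0_norm// => /le_trans; apply.
by rewrite ler_pM2l// ler_piMl.
Qed.

End ClassSConvexity.

(** * Gradient images and boundary gradients *)

Lemma dot_basis {R : realType} {n : nat} (q : 'rV[R]_n) i :
  dot q (std_basis i) = q 0 i.
Proof.
rewrite /dot /std_basis (bigD1 i)//= mxE !eqxx mulr1 big1 ?addr0// => j ji.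
by rewrite mxE (negbTE ji) andbF mulr0.
Qed.

Section GradientImages.
Context {R : realType} {n : nat}.
Hypothesis n0 : (0 < n)%N.
Variable U : set 'rV[R]_n.
Hypothesis dU : smooth_strictly_convex_domain U.

Let oU := domain_open dU.
Let cU := domain_compact dU.

(** If [p] is the gradient of [phi] at [x0], minimize [psi - <p, .>] over
   [closure U]. An interior minimizer is a point where the gradient of [psi] is
   [p]. At a boundary minimizer [b] the gradient of [psi] makes a nonnegative
   product with [x0 - b] after subtraction of [p]; as [psi] and [phi] have the
   same gradient at [b], this contradicts the strict monotonicity of the
   gradient of [phi]. *)
Lemma gradient_image_sub (phi psi : 'rV[R]_n -> R)
    (P0 P1 : 'I_n -> 'rV[R]_n -> R) : calS U phi -> calS U psi ->
  (forall i, ucont (closure U) (P0 i)) -> (forall i, ucont (closure U) (P1 i)) ->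
  (forall i x, U x -> P0 i x = gradient phi x 0 i) ->
  (forall i x, U x -> P1 i x = gradient psi x 0 i) ->
  (forall i b, boundary U b -> P0 i b = P1 i b) ->
  gradient_image U phi `<=` gradient_image U psi.
Proof.
move=> Sphi Spsi u0 u1 E0 E1 Eb p [x0 Ux0 <-]; set q := gradient phi x0.
have spsi := calS_usmooth dU Spsi.
have alin (a : 'rV[R]_n) : ucont (closure U) (fun x => dot a x).
  apply: (alg_ucont_compact cU).
  apply: alg_sum => i _; apply: algM; first exact: alg_cst.
  by apply: alg_gen; exact: ucont_coord.
have uF : ucont (closure U) (fun x => psi x - dot q x).
  apply: (alg_ucont_compact cU).
  apply: algB; apply: alg_gen => //.
  exact: (compact_ucont cU (calS_continuous Spsi)).
have [b] := compact_EVT_min (ex_intro _ x0 (subset_closure Ux0)) cU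
  (ucont_within uF).
rewrite inE => cb bmin0.
have bmin x : U x -> psi b - dot q b <= psi x - dot q x.
  by move=> Ux; apply: bmin0; rewrite inE; exact: subset_closure.
have [Ub|bb] := closure_cases dU cb.
  exists b => //; apply/rowP => i; rewrite mxE.
  rewrite (@derive_support _ _ U psi b (std_basis i) (q 0 i) oU Ub)//.
    by apply: diff_derivable; exact: usmooth_diff Ub.
  move=> h Uh; have := bmin _ Uh; rewrite dotDr dotZr.
  rewrite dot_basis.
  lra.
have [c c0 cP] := calS_monotone n0 dU Sphi.
have [c' c'0 sP] := calS_support n0 dU Spsi.
have x0b : x0 != b.
  by apply/eqP => xb; move: bb => /(boundaryE dU)[_]; rewrite -xb.
set w := x0 - b; have w0 : w != 0 by rewrite subr_eq0.
have wp : 0 < `|w| by rewrite normr_gt0.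
have D0 := dot_gt0 w0; set D := dot w w in D0.
pose K x := \sum_i (P1 i x - P0 i x) * w 0 i.
have uK : ucont (closure U) K.
  apply: (alg_ucont_compact cU).
  apply: alg_sum => i _; apply: algM; last exact: alg_cst.
  by apply: algB; apply: alg_gen.
have e0 : 0 < c * D / 4 by rewrite divr_gt0// mulr_gt0.
have [d d0 dP] := uK _ e0.
have Kb : K b = 0 by apply: big1 => i _; rewrite Eb// subrr mul0r.
pose r := Num.min 2^-1 (d / `|w| / 2).
have r0 : 0 < r by rewrite lt_min invr_gt0 ltr0n !divr_gt0.
have r2 : r <= 2^-1 by rewrite ge_min lexx.
pose x := b + r *: w.
have Ux : U x.
  have := @closure_segment _ _ U dU x0 b (1 - r) Ux0 cb.
  rewrite (_ : _ + _ = x); last first.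
    by rewrite /x /w; apply/rowP => k; rewrite !mxE; ring.
  by apply; apply/andP; split; lra.
have xb : x - b = r *: w by rewrite /x [b + _]addrC addrK.
have xx0 : x - x0 = (1 - r) *: - w.
  by rewrite /x /w; apply/rowP => k; rewrite !mxE; ring.
have KE : K x = dot (gradient psi x) w - dot (gradient phi x) w.
  by rewrite -dotBl; apply: eq_bigr => i _; rewrite E0// E1// !mxE.
have Kx : K x <= c * D / 4.
  have /= := dP x b (subset_closure Ux) cb.
  rewrite Kb subr0 xb normrZ gtr0_norm// => H.
  apply: le_trans (ler_norm _) (H _).
  rewrite -ltr_pdivlMr//; apply: le_lt_trans (_ : d / `|w| / 2 < _).
    by rewrite ge_min lexx orbT.
  have : 0 < d / `|w| by rewrite divr_gt0.
  by move: (d / `|w|) => k; lra.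
have := cP x x0 Ux Ux0; rewrite xx0 !dotZl !dotZr !dotNr !dotNl opprK -/D.
rewrite -/q mulrCA => mono.
have r10 : 0 < 1 - r by lra.
have {}mono : c * ((1 - r) * D) <= - dot (gradient phi x - q) w.
  by rewrite -(ler_pM2l r10); lra.
have := bmin x Ux; have := sP x b Ux cb.
have -> : b - x = - (r *: w) by rewrite -xb opprB.
rewrite /x dotDr dotNr !dotZr -/x => s1 s2.
have s3 : 0 <= c' * dot (- (r *: w)) (- (r *: w)).
  by rewrite mulr_ge0 ?dot_ge0// ltW.
have {s1 s2 s3} : 0 <= r * (dot (gradient psi x) w - dot q w) by lra.
rewrite pmulr_rge0// => fin.
rewrite dotBl in mono.
have : c * D * 2^-1 <= c * ((1 - r) * D).
  rewrite -mulrA ler_pM2l// mulrC ler_pM2r//; lra.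
have : 0 < c * D by rewrite mulr_gt0.
by move: mono fin Kx; rewrite KE; move: (c * D) => cD; lra.
Qed.

End GradientImages.

(** * The space-time cylinder *)

Section Cylinder.
Context {R : realType} {n : nat}.
Variable U : set 'rV[R]_n.
Hypothesis dU : smooth_strictly_convex_domain U.

Let oU := domain_open dU.
Let cU := domain_compact dU.
Let vU := domain_convex dU.
Let ST : normedModType R := @space_time R n.
Let W : set ST := cylinder U.

Lemma prod_norm_le (z : ST) (e : R) :
  (`|z| <= e) = (`|z.1| <= e) && (`|z.2| <= e).
Proof. by rewrite prod_normE ge_max. Qed.

Lemma prod_norm_lt (z : ST) (e : R) :
  (`|z| < e) = (`|z.1| < e) && (`|z.2| < e).
Proof. by rewrite prod_normE gt_max. Qed.

Lemma cylinderE (z : ST) : W z <-> U z.1 /\ 0 < z.2 < 1.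
Proof.
by split=> [[? /=]|[? zt]]; rewrite ?in_itv//; split => //=; rewrite in_itv.
Qed.

Lemma cylinder_open : open W.
Proof.
rewrite openE => -[x t] [/= Ux t01]; exists (U, `]0, 1[%classic) => //=.
by split; apply: open_nbhs_nbhs; split => //; exact: interval_open.
Qed.

Lemma cylinder_convex : is_convex W.
Proof.
move=> z z' /cylinderE[Uz /andP[t0 t1]] /cylinderE[Uz' /andP[t0' t1']] s s01.
have /andP[s0 s1] := s01.
apply/cylinderE; split; first exact: vU.
rewrite /= -![_ *: _]/(_ * _).
have [->|sN0] := eqVneq s 0; first by rewrite subr0 mul1r mul0r addr0 t0.
have sp : 0 < s by rewrite lt_neqAle eq_sym sN0.
have h1 : 0 <= (1 - s) * z.2 by rewrite mulr_ge0 ?subr_ge0// ltW.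
have h2 : 0 < s * z'.2 by rewrite mulr_gt0.
have h3 : 0 <= (1 - s) * (1 - z.2) by rewrite mulr_ge0 ?subr_ge0// ltW.
have h4 : 0 < s * (1 - z'.2) by rewrite mulr_gt0 ?subr_gt0.
by apply/andP; split; lra.
Qed.

Lemma interval_approx (t d : R) : 0 <= t <= 1 -> 0 < d ->
  exists2 a : R, `|a| < d & 0 < t + a < 1.
Proof.
move=> /andP[t0 t1] d0; pose r := Num.min (d / 2) 4^-1.
have r0 : 0 < r by rewrite lt_min divr_gt0//= invr_gt0.
have rd : r < d by rewrite gt_min; apply/orP; left; lra.
have r4 : r <= 4^-1 by rewrite ge_min lexx orbT.
have [t2|t2] := leP t 2^-1.
  by exists r; rewrite ?gtr0_norm//; apply/andP; split; lra.
by exists (- r); rewrite ?normrN ?gtr0_norm//; apply/andP; split; lra.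
Qed.

Lemma cylinder_closure (x : 'rV[R]_n) (t : R) :
  closure W ((x, t) : ST) <-> closure U x /\ 0 <= t <= 1.
Proof.
split=> [cz|[cx t01]]; last first.
  apply/closure_normP => d d0.
  have [y Uy xy] := (closure_normP _ _).1 cx d d0.
  have [a ad ta] := interval_approx t01 d0.
  exists (y, t + a); first exact/cylinderE.
  by rewrite prod_norm_lt/= xy/= opprD addrA subrr sub0r normrN.
split.
  apply/closure_normP => d /((closure_normP _ _).1 cz)[[y s] /cylinderE[/= Uy _]].
  by rewrite prod_norm_lt => /andP[/= xy _]; exists y.
apply/andP; split.
  apply/ler_addgt0Pr => d /((closure_normP _ _).1 cz)[[y s] /cylinderE[/= _]].
  move=> /andP[s0 s1]; rewrite prod_norm_lt => /andP[/= _].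
  rewrite ltr_norml => /andP[]; lra.
apply/ler_addgt0Pr => d /((closure_normP _ _).1 cz)[[y s] /cylinderE[/= _]].
move=> /andP[s0 s1]; rewrite prod_norm_lt => /andP[/= _].
rewrite ltr_norml => /andP[]; lra.
Qed.

Lemma cylinder_compact : compact (closure W).
Proof.
apply: (@subclosed_compact _ (closure W) (closure U `*` `[0, 1])).
- exact: closed_closure.
- by apply: compact_setX => //; exact: segment_compact.
- by move=> [x t] /cylinder_closure[cx t01]; split => //=; rewrite in_itv.
Qed.

End Cylinder.

(** * The gradient along the lateral boundary *)

Section Necessity.
Context {R : realType} {n : nat}.
Hypothesis n0 : (0 < n)%N.
Variable U : set 'rV[R]_n.
Hypothesis dU : smooth_strictly_convex_domain U.

Let oU := domain_open dU.
Let ST : normedModType R := @space_time R n.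
Let W : set ST := cylinder U.
Let oW : open W := cylinder_open dU.
Let cW : compact (closure W) := cylinder_compact dU.
Let vW : is_convex W := cylinder_convex dU.
Let et : ST := (0, 1).

Lemma time_shift (x : 'rV[R]_n) (t h : R) :
  ((x, t) : ST) + h *: et = (x, t + h).
Proof. by congr pair; rewrite /= ?scaler0 ?addr0// -[h *: 1]/(h * 1) mulr1. Qed.

Lemma space_shift (x w : 'rV[R]_n) (t h : R) :
  ((x, t) : ST) + h *: ((w, 0) : ST) = (x + h *: w, t).
Proof. by congr pair; rewrite /= ?scaler0 ?addr0. Qed.

(** Along the lateral boundary the continuous extension of the time derivative
   still is the time derivative of the extension. *)
Lemma lateral_derivative (f F G : ST -> R) b (t : R) : usmooth W f ->
  {within closure W, continuous F} -> (forall z, W z -> F z = f z) ->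
  ucont (closure W) G -> (forall z, W z -> G z = 'D_et f z) ->
  closure U b -> 0 < t < 1 ->
  is_derive t 1 (fun s => F (b, s)) (G (b, t)).
Proof.
move=> sf Fc Ff Gu Gf cb /andP[t0 t1]; apply: eps_derive => e e0.
have [d d0 dP] := boundary_derivative vW (usmooth_smooth_on sf) Fc Ff Gu Gf e0.
pose m := Num.min d (Num.min t (1 - t)).
exists m; first by rewrite !lt_min d0 t0 subr_gt0.
move=> h; rewrite !lt_min => /and3P[hd ht ht1].
have := dP (b, t) h; rewrite time_shift scaler1; apply.
  rewrite normrZ (_ : `|et| = 1) ?mulr1//.
  by rewrite prod_normE/= normr0 normr1 max_r.
move=> r r0; have [x Ux bx] := (closure_normP _ _).1 cb r r0.
exists (x - b, 0); split.
- by rewrite prod_norm_lt/= normr0 r0 distrC bx.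
- by apply/cylinderE; rewrite /= addrC subrK addr0 t0.
- apply/cylinderE; rewrite /= addrC subrK addr0; split => //.
  move: ht ht1; rewrite !ltr_norml => /andP[h1 h2] /andP[h3 h4].
  by apply/andP; split; lra.
Qed.

(** Likewise for the spatial derivatives on the two ends of the cylinder. *)
Lemma base_derivative (f F G : ST -> R) x (t : R) w : usmooth W f ->
  {within closure W, continuous F} -> (forall z, W z -> F z = f z) ->
  ucont (closure W) G -> (forall z, W z -> G z = 'D_((w, 0) : ST) f z) ->
  U x -> 0 <= t <= 1 ->
  is_derive x w (fun y => F (y, t)) (G (x, t)).
Proof.
move=> sf Fc Ff Gu Gf Ux t01; apply: eps_derive => e e0.
have [d d0 dP] := boundary_derivative vW (usmooth_smooth_on sf) Fc Ff Gu Gf e0.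
have [r r0 rP] := open_normP oU Ux.
have w1 : 0 < `|w| + 1 by rewrite ltr_wpDl.
exists (Num.min d r / (`|w| + 1)); first by rewrite divr_gt0// lt_min d0.
move=> h; rewrite ltr_pdivlMr// => hm.
have {}hm : `|h *: w| < Num.min d r.
  apply: le_lt_trans hm; rewrite normrZ ler_wpM2l// lerDl//.
move: hm; rewrite lt_min => /andP[hd hr].
have := dP (x, t) h; rewrite space_shift; apply.
  rewrite normrZ (_ : `|((w, 0) : ST)| = `|w|) -?normrZ//.
  by rewrite prod_normE/= normr0 max_l.
move=> k k0; have [a ak ta] := interval_approx t01 k0.
exists (0, a); split.
- by rewrite prod_norm_lt/= normr0 k0.
- by apply/cylinderE; rewrite /= addr0.
- apply/cylinderE; rewrite /= addr0; split => //.
  by apply: rP; rewrite [x + _]addrC addrK.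
Qed.

Lemma lateral_zero (f F G : ST -> R) b : usmooth W f ->
  {within closure W, continuous F} -> (forall z, W z -> F z = f z) ->
  ucont (closure W) G -> (forall z, W z -> G z = 'D_et f z) ->
  closure U b -> (forall t, 0 < t < 1 -> F (b, t) = 0) ->
  forall t, 0 < t < 1 -> G (b, t) = 0.
Proof.
move=> sf Fc Ff Gu Gf cb F0 t t01.
have [_ <-] := lateral_derivative sf Fc Ff Gu Gf cb t01.
have oI : open [set s : R | 0 < s < 1].
  rewrite (_ : [set s | _] = `]0, 1[%classic); first exact: interval_open.
  by apply/seteqP; split => s /=; rewrite in_itv.
rewrite (@near_eq_derive _ _ _ _ (fun=> 0)) ?derive_cst//.
by apply: filterS (open_nbhs_nbhs (conj oI t01)) => s; exact: F0.
Qed.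

Lemma usmooth_extension (f : ST -> R) : usmooth W f ->
  exists G, ucont (closure W) G /\ forall z, W z -> G z = f z.
Proof.
by move=> sf; have [G] := ucont_extension (usmooth_ucont sf); exists G.
Qed.

(** A null vector [(w, s)] of [M] satisfies [w H = - s q] and [<w, q> = 0]. Hence
   [w H w^T = 0], so [w = 0]; what remains is [s q = 0] with [s != 0]. *)
Lemma degenerate_block (M : 'M[R]_(n + 1)) (H : 'M[R]_n) (q : 'rV[R]_n) :
  posdef H -> \det M = 0 ->
  (forall i j, M (lshift 1 i) (lshift 1 j) = H i j) ->
  (forall i, M (lshift 1 i) (rshift n 0) = q 0 i) ->
  (forall j, M (rshift n 0) (lshift 1 j) = q 0 j) ->
  M (rshift n 0) (rshift n 0) = 0 -> q = 0.
Proof.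
move=> [_ pH] /eqP/det0P[k k0 kM] MH Mq Mq' M0.
pose w := lsubmx k; pose s := rsubmx k 0 0.
have colj j : (w *m H) 0 j + s * q 0 j = 0.
  have := congr1 (fun A : 'rV[R]_(n + 1) => A 0 (lshift 1 j)) kM.
  rewrite !mxE big_split_ord/= big_ord1 Mq' => kj; rewrite -[RHS]kj.
  congr (_ + _ * _); last by rewrite /s mxE.
  by apply: eq_bigr => i _; rewrite MH mxE.
have colt : dot w q = 0.
  have := congr1 (fun A : 'rV[R]_(n + 1) => A 0 (rshift n 0)) kM.
  rewrite !mxE big_split_ord/= big_ord1 M0 mulr0 addr0 => kt; rewrite -[RHS]kt.
  by apply: eq_bigr => i _; rewrite Mq mxE.
have wH : w *m H = - s *: q.
  apply/rowP => j; rewrite [RHS]mxE mulNr.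
  by apply/eqP; rewrite -addr_eq0 colj.
have w0 : w = 0.
  apply/eqP; apply: contraT => /pH; rewrite -dot_mx wH dotZl dotC colt mulr0.
  by rewrite ltxx.
have sq : s *: q = 0.
  by apply/eqP; rewrite -oppr_eq0 -scaleNr -wH w0 mul0mx.
have s0 : s != 0.
  apply: contra k0 => /eqP s0; rewrite -(hsubmxK k) -/w w0.
  apply/eqP/rowP => i; rewrite !mxE; case: fintype.split => j; rewrite ?mxE//.
  by rewrite ord1; move: s0; rewrite /s mxE.
by apply/eqP; move/eqP: sq; rewrite scaler_eq0 (negbTE s0).
Qed.

Lemma space_time_basisl (i : 'I_n) :
  @space_time_basis R n (lshift 1 i) = space_basis i.
Proof.
by rewrite /space_time_basis; have := unsplitK (inl i : 'I_n + 'I_1) => /= ->.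
Qed.

Lemma space_time_basisr : @space_time_basis R n (rshift n 0) = et.
Proof.
by rewrite /space_time_basis; have := unsplitK (inr 0 : 'I_n + 'I_1) => /= ->.
Qed.

Lemma ucont_slice (G : ST -> R) (t : R) : 0 <= t <= 1 ->
  ucont (closure W) G -> ucont (closure U) (fun x => G (x, t)).
Proof.
move=> t01 uG e /uG[d d0 dP]; exists d => // x y cx cy xy.
apply: dP; try exact/cylinder_closure.
by rewrite prod_norm_lt/= subrr normr0 d0 xy.
Qed.

Lemma continuous_fiber (G : ST -> R) b : closure U b ->
  ucont (closure W) G -> {within `[0, 1], continuous (fun t : R => G (b, t))}.
Proof.
move=> cb uG; apply/subspace_continuousP => s; rewrite /= in_itv/= => s01.
apply/cvgrPdist_le => e /uG[d d0 dP].
apply/nbhs_normP; exists d => //= t; rewrite /ball_/= => st.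
rewrite in_itv/= => t01; apply: dP; try exact/cylinder_closure.
by rewrite prod_norm_lt/= subrr normr0 d0 st.
Qed.

(** At a lateral boundary point [u], hence [u_t] and [u_tt], vanish; as the full
   Hessian is degenerate there and its space block is positive definite, the
   mixed derivatives vanish too. So the spatial gradient does not depend on
   time along the lateral boundary. *)
Lemma lateral_gradient (phi psi : 'rV[R]_n -> R) (u : ST -> R)
    (P : 'I_n -> ST -> R) : smooth_geodesic U phi psi u ->
  (forall i, ucont (closure W) (P i)) ->
  (forall i z, W z -> P i z = 'D_(space_basis i) u z) ->
  forall i b, boundary U b -> P i (b, 0) = P i (b, 1).
Proof.
move=> [[_ uc] det0 [_ _ u0] su pd] Pu PE i b bb.
have cb : closure U b by case: bb.
have {}su : usmooth W u by exact: smooth_upto_usmooth.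
have /choice[H HP] : forall ij : 'I_(n + 1) * 'I_(n + 1), exists G,
    ucont (closure W) G /\ forall z, W z -> G z =
    iter_derive [:: space_time_basis ij.1; space_time_basis ij.2] u z.
  move=> [k j]; apply: usmooth_extension.
  by do 2 apply: usmooth_derive.
have [T [Tu TE]] := usmooth_extension (usmooth_derive et su).
pose M z : 'M[R]_(n + 1) := \matrix_(k, j) H (k, j) z.
have detM z : closure W z -> \det (M z) = 0.
  apply: (@closure_eq _ _ W (fun z => \det (M z)) (fun=> 0)).
  - apply: (alg_ucont_compact cW); apply: alg_det => k j; apply: alg_gen.
    by apply: eq_ucont (HP (k, j)).1 => y _; rewrite mxE.
  - exact: ucont_cst.
  - move=> y Wy; rewrite -(det0 y Wy); congr (\det _).
    by apply/matrixP => k j; rewrite !mxE (HP (k, j)).2.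
have mixed j z : closure W z ->
    H (rshift n 0, lshift 1 j) z = H (lshift 1 j, rshift n 0) z.
  apply: closure_eq; [exact: (HP _).1|exact: (HP _).1|move=> y Wy].
  rewrite ((HP (rshift n 0, lshift 1 j)).2 y Wy).
  rewrite ((HP (lshift 1 j, rshift n 0)).2 y Wy).
  apply: (mixed_derivatives _ _ oW Wy).
  exact: usmooth_smooth_on.
have Hq t : 0 < t < 1 -> H (rshift n 0, lshift 1 i) (b, t) = 0.
  move=> t01; have /andP[t0 t1] := t01.
  have cbt : closure W ((b, t) : ST).
    by apply/cylinder_closure => //; split => //; rewrite !ltW.
  have T0 := lateral_zero su uc (fun _ _ => erefl) Tu TE cb (fun s => u0 b s bb).
  have Htt : H (rshift n 0, rshift n 0) (b, t) = 0.
    apply: (lateral_zero (usmooth_derive et su) (ucont_within Tu) TE) => //.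
      exact: (HP _).1.
    move=> z Wz; rewrite ((HP (rshift n 0, rshift n 0)).2 z Wz) /=.
    by rewrite space_time_basisr.
  have pdH : posdef (\matrix_(k, j) H (lshift 1 k, lshift 1 j) (b, t)).
    have := pd b t cb; rewrite !ltW// => /(_ isT).
    rewrite (@ext_hessian _ _ W _ space_basis u
      (fun k j => H (lshift 1 k, lshift 1 j)) _ cbt)//.
      by move=> k j; exact: (HP _).1.
    move=> k j z Wz; rewrite ((HP (lshift 1 k, lshift 1 j)).2 z Wz) /=.
    by rewrite !space_time_basisl.
  have q0 : \row_j H (lshift 1 j, rshift n 0) (b, t) = 0.
    apply: (degenerate_block pdH (detM _ cbt)).
    - by move=> k j; rewrite !mxE.
    - by move=> k; rewrite !mxE.
    - by move=> j; rewrite !mxE mixed.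
    - by rewrite mxE.
  by move/rowP/(_ i): q0; rewrite !mxE mixed.
have dP (t : R) : t \in `]0, 1[%R -> is_derive t 1 (fun s => P i (b, s)) ((fun=> 0) t).
  rewrite in_itv/= => t01; rewrite /= -(Hq t t01).
  apply: (lateral_derivative (usmooth_derive _ su) (ucont_within (Pu i)) (PE i)) => //.
    exact: (HP _).1.
  move=> z Wz; rewrite ((HP (rshift n 0, lshift 1 i)).2 z Wz) /=.
  by rewrite space_time_basisr space_time_basisl.
have [c _] := MVT ltr01 dP (continuous_fiber cb (Pu i)).
by rewrite mul0r => /eqP; rewrite subr_eq0 => /eqP.
Qed.

Lemma geodesic_gradient_image (phi psi : 'rV[R]_n -> R) (u : ST -> R) :
  calS U phi -> calS U psi -> smooth_geodesic U phi psi u ->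
  gradient_image U phi = gradient_image U psi.
Proof.
move=> Sphi Spsi geo; have [[_ uc] _ [uphi upsi _] su' _] := geo.
have su : usmooth W u by exact: smooth_upto_usmooth.
have /choice[P PP] : forall i : 'I_n, exists G,
    ucont (closure W) G /\ forall z, W z -> G z = 'D_(space_basis i) u z.
  by move=> i; apply: usmooth_extension; exact: usmooth_derive.
have Pb := lateral_gradient geo (fun i => (PP i).1) (fun i => (PP i).2).
have i0 : 0 <= (0 : R) <= 1 by rewrite lexx ler01.
have i1 : 0 <= (1 : R) <= 1 by rewrite lexx ler01.
have base (v : 'rV[R]_n -> R) (t : R) : 0 <= t <= 1 ->
    (forall x, U x -> u (x, t) = v x) ->
    forall i x, U x -> P i (x, t) = gradient v x 0 i.
  move=> t01 uv i x Ux; rewrite mxE.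
  have [_ <-] := base_derivative su uc (fun _ _ => erefl) (PP i).1 (PP i).2 Ux t01.
  exact: (eq_derive_open _ oU Ux).
apply/seteqP; split.
- apply: (@gradient_image_sub _ _ n0 _ dU _ _
    (fun i x => P i (x, 0)) (fun i x => P i (x, 1))) => //.
  + by move=> i; apply: ucont_slice => //; exact: (PP i).1.
  + by move=> i; apply: ucont_slice => //; exact: (PP i).1.
  + exact: base.
  + exact: base.
- apply: (@gradient_image_sub _ _ n0 _ dU _ _
    (fun i x => P i (x, 1)) (fun i x => P i (x, 0))) => //.
  + by move=> i; apply: ucont_slice => //; exact: (PP i).1.
  + by move=> i; apply: ucont_slice => //; exact: (PP i).1.
  + exact: base.
  + exact: base.
  + by move=> i b bb; rewrite Pb.
Qed.

End Necessity.

(** * Interpolation between points with equal gradients *)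

Lemma lipschitz_continuous {R : realType} {V V' : normedModType R}
    (f : V -> V') (k : R) : 0 < k ->
  (forall x y, `|f x - f y| <= k * `|x - y|) -> continuous f.
Proof.
move=> k0 fk x; apply/cvgrPdist_le => e e0; apply/nbhs_normP.
exists (e / k) => /=; first by rewrite divr_gt0.
move=> y /= xy; apply: le_trans (fk _ _) _.
by rewrite mulrC -ler_pdivlMr// ltW.
Qed.

Section Interpolation.
Context {R : realType} {n : nat}.
Hypothesis n0 : (0 < n)%N.
Variable U : set 'rV[R]_n.
Hypothesis dU : smooth_strictly_convex_domain U.

Let oU := domain_open dU.
Let cU := domain_compact dU.

(** Comparing a minimizer [(x, z)] with the pairs obtained by moving [x] towards
   the point [x'] with the same gradient as [z] forces [x = x']. In particular
   [x] cannot be a boundary point. *)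
Lemma minimizer_interior (phi psi : 'rV[R]_n -> R) (t : R) x z :
  calS U phi -> calS U psi -> gradient_image U psi `<=` gradient_image U phi ->
  0 < t < 1 -> closure U x -> U z ->
  (forall x' z', U x' -> U z' ->
     (1 - t) *: x' + t *: z' = (1 - t) *: x + t *: z ->
     (1 - t) * phi x + t * psi z <= (1 - t) * phi x' + t * psi z') ->
  U x /\ gradient phi x = gradient psi z.
Proof.
move=> Sphi Spsi sub /andP[t0 t1] cx Uz xzmin.
have [|x1 Ux1 x1z] := sub (gradient psi z); first by exists z.
suff -> : x = x1 by [].
apply/eqP; apply: contraT => xx1.
have [c c0 cP] := calS_support n0 dU Sphi.
set D := dot (x - x1) (x - x1).
have D0 : 0 < D by rewrite dot_gt0// subr_eq0.
have := cP x1 x Ux1 cx; rewrite -/D x1z; set p := gradient psi z => sup.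
have q0 : 0 < 1 - t by lra.
pose e := (1 - t) * (c * D) / 2.
have e0 : 0 < e by rewrite divr_gt0// !mulr_gt0.
pose w := (- ((1 - t) / t)) *: (x1 - x).
have dpsi : differentiable psi z by exact: usmooth_diff (calS_usmooth dU Spsi) Uz.
have [d d0 dP] := derive_eps (@diff_derivable _ _ _ psi z w dpsi) e0.
have [r r0 rP] := open_normP oU Uz.
have w1 : 0 < `|w| + 1 by rewrite ltr_wpDl.
pose s := Num.min (d / 2) (Num.min 2^-1 (r / (`|w| + 1))).
have s0 : 0 < s by rewrite !lt_min !divr_gt0// invr_gt0 ltr0n.
have s1 : s < 1 by rewrite !gt_min; apply/orP; right; apply/orP; left; lra.
have sd : `|s| < d by rewrite gtr0_norm// gt_min; apply/orP; left; lra.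
have Uzs : U (z + s *: w).
  apply: rP; rewrite [z + _]addrC addrK normrZ gtr0_norm//.
  apply: lt_le_trans (_ : s * (`|w| + 1) <= _); first by rewrite ltr_pM2l// ltrDl.
  by rewrite -ler_pdivlMr// !ge_min lexx !orbT.
have s01 : 0 <= 1 - s < 1 by apply/andP; split; lra.
have Uxs := closure_segment dU Ux1 cx s01.
have := calS_convex n0 dU Sphi Ux1 cx s01.
have := xzmin _ _ Uxs Uzs.
have -> : (1 - t) *: ((1 - (1 - s)) *: x1 + (1 - s) *: x) + t *: (z + s *: w) =
    (1 - t) *: x + t *: z.
  by rewrite /w; apply/rowP => k; rewrite !mxE; field; rewrite gt_eqF.
move=> /(_ erefl).
set xs := _ *: x1 + _ => xzs conv.
have := dP s sd; rewrite (gtr0_norm s0) ler_norml => /andP[_].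
rewrite derive_gradient// -[s *: dot _ _]/(s * dot _ _) /w dotZr -/p.
move=> psis.
have tp : t * (psi (z + s *: w) - psi z) <=
    s * (e - (1 - t) * dot p (x1 - x)).
  apply: le_trans (_ : t * (s * (e - (1 - t) / t * dot p (x1 - x))) <= _).
    by rewrite ler_pM2l//; rewrite /w; lra.
  have -> : t * (s * (e - (1 - t) / t * dot p (x1 - x))) =
    s * (t * e - (1 - t) * dot p (x1 - x)) by field; rewrite gt_eqF.
  by rewrite ler_pM2l// lerB// ler_piMl// ltW.
have k1 := ler_wpM2l (ltW q0) conv.
have : 0 <= s * ((1 - t) * (phi x1 - phi x) + (e - (1 - t) * dot p (x1 - x))).
  lra.
rewrite pmulr_rge0// => fin.
have k2 := ler_wpM2l (ltW q0) sup.
have dE : dot p (x1 - x) = - dot p (x - x1) by rewrite -dotNr opprB.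
rewrite dE in fin; move: fin k2; rewrite /e.
have : 0 < (1 - t) * (c * D) by rewrite !mulr_gt0.
move: (c * D) (dot p _) => cD a; lra.
Qed.

(** Minimize [(1 - t) phi x + t psi z] among the pairs in [closure U] whose
   weighted mean is [y]. A minimizer made of two boundary points has value zero,
   more than the value at [(y, y)]; so one of its points is interior, and
   [minimizer_interior] applies. *)
Lemma interpolation_exists (phi psi : 'rV[R]_n -> R) y (t : R) :
  calS U phi -> calS U psi -> gradient_image U phi = gradient_image U psi ->
  U y -> 0 <= t <= 1 ->
  exists x z, [/\ U x, U z, gradient phi x = gradient psi z &
    (1 - t) *: x + t *: z = y].
Proof.
move=> Sphi Spsi E Uy /andP[].
rewrite le_eqVlt => /orP[/eqP<- _|t0].
  have : gradient_image U psi (gradient phi y) by rewrite -E; exists y.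
  by move=> [z Uz zy]; exists y, z; split => //; rewrite subr0 scale1r scale0r addr0.
rewrite le_eqVlt => /orP[/eqP->|t1].
  have : gradient_image U phi (gradient psi y) by rewrite E; exists y.
  by move=> [x Ux xy]; exists x, y; split => //; rewrite subrr scale0r scale1r add0r.
pose zeta x := t^-1 *: (y - (1 - t) *: x).
have zetaE x : (1 - t) *: x + t *: zeta x = y.
  by rewrite /zeta scalerA mulfV ?gt_eqF// scale1r addrC subrK.
pose k := `|t^-1 * (1 - t)| + 1.
have k0 : 0 < k by rewrite ltr_wpDl.
have zetaL x x' : `|zeta x - zeta x'| <= k * `|x - x'|.
  have -> : zeta x - zeta x' = (t^-1 * (1 - t)) *: (x' - x).
    by apply/rowP => i; rewrite !mxE; ring.
  rewrite normrZ.
  by rewrite [`|x' - x|]distrC ler_wpM2r// lerDl.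
pose K := closure U `&` zeta @^-1` closure U.
have KE x : K x = (closure U x /\ closure U (zeta x)) by [].
have cK : compact K.
  apply: (subclosed_compact _ cU) => [|x []//].
  apply: closedI; first exact: closed_closure.
  apply: closed_comp; last exact: closed_closure.
  by move=> x _; exact: (lipschitz_continuous k0 zetaL).
have Ky : K y.
  rewrite /K /= (_ : zeta y = y); first by split; exact: subset_closure.
  rewrite /zeta; apply/rowP => i; rewrite !mxE; field; by rewrite gt_eqF.
pose F x := (1 - t) * phi x + t * psi (zeta x).
have uF : ucont K F.
  apply: (alg_ucont_compact cK).
  apply: algD; apply: algM; try exact: alg_cst; apply: alg_gen.
    apply: ucontS (compact_ucont cU (calS_continuous Sphi)); exact: subIsetl.
  move=> e e0.
  have [d d0 dP] := compact_ucont cU (calS_continuous Spsi) e0.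
  exists (d / k); first by rewrite divr_gt0.
  move=> x x'; rewrite !KE => -[_ Kx] [_ Kx'] xx'; apply: dP => //.
  by apply: le_lt_trans (zetaL _ _) _; rewrite mulrC -ltr_pdivlMr.
have [x] := compact_EVT_min (ex_intro _ y Ky) cK (ucont_within uF).
move=> /set_mem Kx xmin0.
have [cx cz] : closure U x /\ closure U (zeta x) by rewrite -KE.
have xmin x' z' : U x' -> U z' ->
     (1 - t) *: x' + t *: z' = (1 - t) *: x + t *: zeta x ->
     (1 - t) * phi x + t * psi (zeta x) <= (1 - t) * phi x' + t * psi z'.
  rewrite zetaE => Ux' Uz' xz'.
  have z'E : z' = zeta x'.
    by rewrite /zeta -xz' [_ + _ - _]addrAC subrr add0r scalerA mulVf ?gt_eqF// scale1r.
  rewrite z'E; apply: xmin0; apply/mem_set.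
  suff : K x' by []; rewrite KE -z'E; by split; exact: subset_closure.
have t01 : 0 < t < 1 by rewrite t0.
have [Uz|bz] := closure_cases dU cz.
  have [|Ux gE] := minimizer_interior Sphi Spsi _ t01 cx Uz xmin.
    by rewrite E.
  by exists x, (zeta x).
have [Ux|bx] := closure_cases dU cx.
  have t01' : 0 < 1 - t < 1 by apply/andP; split; lra.
  have [||Uz gE] := @minimizer_interior psi phi _ _ _ Spsi Sphi _ t01' cz Ux.
  - by rewrite E.
  - move=> z' x' Uz' Ux'.
    have -> : 1 - (1 - t) = t by lra.
    rewrite addrC [RHS]addrC [leLHS]addrC [leRHS]addrC => zx; exact: xmin.
  by exists x, (zeta x).
have := xmin y y Uy Uy; rewrite -scalerDl subrK scale1r zetaE => /(_ erefl).
rewrite (calS_boundary Sphi bx) (calS_boundary Spsi bz) !mulr0 addr0.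
have h1 : 0 < (1 - t) * - phi y.
  by rewrite mulr_gt0 ?subr_gt0// oppr_gt0 (calS_neg n0 dU Sphi).
have h2 : 0 < t * - psi y.
  by rewrite mulr_gt0// oppr_gt0 (calS_neg n0 dU Spsi).
lra.
Qed.

End Interpolation.

Section InterpolationLipschitz.
Context {R : realType} {n : nat}.
Hypothesis n0 : (0 < n)%N.
Variable U : set 'rV[R]_n.
Hypothesis dU : smooth_strictly_convex_domain U.

Let cU := domain_compact dU.
Let vU := domain_convex dU.

(** Strong monotonicity of both gradients controls the gradient, and then both
   points, by the interpolated point and the time. *)
Lemma interpolation_lipschitz (phi psi : 'rV[R]_n -> R) :
  calS U phi -> calS U psi -> exists2 K : R, 0 < K &
  forall x z (t : R) x' z' (t' : R), U x -> U z -> U x' -> U z' ->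
    0 <= t <= 1 ->
    gradient phi x = gradient psi z -> gradient phi x' = gradient psi z' ->
    forall e : R, `|((1 - t) *: x + t *: z) - ((1 - t') *: x' + t' *: z')| <= e ->
      `|t - t'| <= e -> `|x - x'| <= K * e /\ `|z - z'| <= K * e.
Proof.
move=> Sphi Spsi.
have [c c0 cP] := calS_monotone n0 dU Sphi.
have [c' c'0 cP'] := calS_monotone n0 dU Spsi.
have [L L0 LP] := gradient_lipschitz cU vU (calS_usmooth dU Sphi).
have [L' L'0 LP'] := gradient_lipschitz cU vU (calS_usmooth dU Spsi).
have [M M0 MP] := domain_norm_bound dU.
(* [k |p - p'|^2] is a lower bound for the products of [p - p'] with [x - x']
   and with [z - z'] *)
pose k := Num.min (c / (L * L)) (c' / (L' * L')).
have k0 : 0 < k by rewrite lt_min !divr_gt0 ?mulr_gt0.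
have kc : k * (L * L) <= c by rewrite -ler_pdivlMr ?mulr_gt0// ge_min lexx.
have kc' : k * (L' * L') <= c'.
  by rewrite -ler_pdivlMr ?mulr_gt0// ge_min lexx orbT.
have nR : 0 < n%:R :> R by rewrite ltr0n.
pose N := n%:R * (1 + 2 * M) / k.
have N0 : 0 < N.
  by rewrite divr_gt0// mulr_gt0// ltr_pwDl// mulr_ge0// ltW.
pose K := n%:R * N / c + n%:R * N / c'.
have K0 : 0 < K by rewrite addr_gt0// divr_gt0// mulr_gt0.
exists K => // x z t x' z' t' Ux Uz Ux' Uz' /andP[t0 t1] g g' e ye te.
have e0 : 0 <= e by apply: le_trans te.
set p := gradient phi x in g; set p' := gradient phi x' in g'.
have sq (a b : R) : 0 <= a -> a * a <= b * a -> 0 <= b -> a <= b.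
  move=> a0 ab b0; have [->//|aN] := eqVneq a 0.
  by rewrite -(ler_pM2r (_ : 0 < a))// lt_neqAle eq_sym aN.
have mono (v : 'rV[R]_n -> R) (cv Lv : R) a b : 0 < cv -> 0 < Lv ->
    k * (Lv * Lv) <= cv ->
    (forall x y, U x -> U y ->
      cv * dot (x - y) (x - y) <= dot (gradient v x - gradient v y) (x - y)) ->
    (forall x y, U x -> U y ->
      `|gradient v y - gradient v x| <= Lv * `|y - x|) ->
    U a -> U b -> gradient v a = p -> gradient v b = p' ->
    k * (`|p - p'| * `|p - p'|) <= dot (p - p') (a - b).
  move=> cv0 Lv0 kv mv lv Ua Ub <- <-.
  apply: le_trans (mv a b Ua Ub).
  have := lv b a Ub Ua => h.
  apply: le_trans (_ : k * ((Lv * `|a - b|) * (Lv * `|a - b|)) <= _).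
    by rewrite ler_pM2l// ler_pM.
  rewrite (_ : _ * _ = k * (Lv * Lv) * (`|a - b| * `|a - b|)); last by ring.
  apply: ler_pM => //; last exact: sqr_norm_dot.
  by rewrite !mulr_ge0// ltW.
have m1 := mono phi c L x x' c0 L0 kc cP LP Ux Ux' erefl erefl.
have m2 := mono psi c' L' z z' c'0 L'0 kc' cP' LP' Uz Uz' (esym g) (esym g').
have pp : `|p - p'| <= N * e.
  apply: sq => //; last by rewrite mulr_ge0// ltW.
  rewrite -(ler_pM2l k0).
  have q0 : 0 <= 1 - t by lra.
  have := ler_wpM2l q0 m1; have := ler_wpM2l t0 m2.
  set Y := (1 - t) *: x + t *: z - _ in ye.
  have YE : Y - (t - t') *: (z' - x') = (1 - t) *: (x - x') + t *: (z - z').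
    by rewrite /Y; apply/rowP => i; rewrite !mxE; ring.
  have : `|Y - (t - t') *: (z' - x')| <= (1 + 2 * M) * e.
    apply: le_trans (ler_normB _ _) _; rewrite mulrDl mul1r lerD//.
    rewrite normrZ mulrC; apply: ler_pM => //.
    apply: le_trans (ler_normB _ _) _.
    by rewrite mulr_natl mulr2n lerD// MP.
  have := norm_dot (p - p') (Y - (t - t') *: (z' - x')).
  have dE : dot (p - p') (Y - (t - t') *: (z' - x')) =
      (1 - t) * dot (p - p') (x - x') + t * dot (p - p') (z - z').
    by rewrite YE [LHS]dotDr !dotZr.
  move=> h1 h2 h3 h4.
  have := le_trans (ler_norm _) h1; rewrite dE.
  have h5 : n%:R * (`|p - p'| * `|Y - (t - t') *: (z' - x')|) <=
      n%:R * (`|p - p'| * ((1 + 2 * M) * e)).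
    by rewrite ler_pM2l// ler_wpM2l.
  have -> : k * (N * e * `|p - p'|) = n%:R * (`|p - p'| * ((1 + 2 * M) * e)).
    by rewrite /N; field; rewrite gt_eqF.
  move: h3 h4 h5; lra.
have fromp (v : 'rV[R]_n -> R) (cv : R) a b : 0 < cv ->
    (forall x y, U x -> U y ->
      cv * dot (x - y) (x - y) <= dot (gradient v x - gradient v y) (x - y)) ->
    U a -> U b -> gradient v a = p -> gradient v b = p' ->
    `|a - b| <= n%:R * N / cv * e.
  move=> cv0 mv Ua Ub va vb; have := mv a b Ua Ub; rewrite va vb => h.
  apply: sq => //; last by rewrite mulr_ge0// ltW// divr_gt0// mulr_gt0.
  rewrite -(ler_pM2l cv0).
  apply: le_trans (_ : cv * dot (a - b) (a - b) <= _).
    by rewrite ler_pM2l// sqr_norm_dot.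
  apply: le_trans h _; apply: le_trans (ler_norm _) _.
  apply: le_trans (norm_dot _ _) _.
  rewrite (_ : cv * _ = n%:R * (N * e * `|a - b|)).
    by rewrite ler_pM2l// ler_wpM2r.
  by field; rewrite gt_eqF.
split.
  apply: le_trans (fromp phi c x x' c0 cP Ux Ux' erefl erefl) _.
  by rewrite ler_wpM2r// lerDl ltW// divr_gt0// mulr_gt0.
apply: le_trans (fromp psi c' z z' c'0 cP' Uz Uz' (esym g) (esym g')) _.
by rewrite ler_wpM2r// lerDr ltW// divr_gt0// mulr_gt0.
Qed.

End InterpolationLipschitz.

(** * Coercive matrices *)

Section CoerciveMatrices.
Context {R : realType} {n : nat}.
Implicit Types (A : 'M[R]_n) (w : 'rV[R]_n).

Definition coercive (c : R) A := forall w, c * dot w w <= dot (w *m A) w.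

Lemma norm_mulmx w A (M : R) : 0 <= M -> (forall i j, `|A i j| <= M) ->
  `|w *m A| <= n%:R * (M * `|w|).
Proof.
move=> M0 AM; apply/rV_normP => [|j]; first by rewrite !mulr_ge0.
rewrite mxE; apply: le_trans (ler_norm_sum _ _ _) _.
rewrite mulr_natl -[X in _ *+ X](card_ord n) -sumr_const.
apply: ler_sum => i _; rewrite normrM mulrC ler_pM//; exact: coord_norm.
Qed.

Lemma coercive_unit (c : R) A : 0 < c -> coercive c A -> A \in unitmx.
Proof.
move=> c0 cA; rewrite unitmxE unitfE; apply/negP => /det0P[w w0 wA].
have := cA w; rewrite wA dot0l leNgt; apply/negP; rewrite negbK.
by rewrite mulr_gt0// dot_gt0.
Qed.

Lemma coercive_inv_norm (c : R) A w : 0 < c -> coercive c A ->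
  `|w *m invmx A| <= n%:R / c * `|w|.
Proof.
move=> c0 cA; have uA := coercive_unit c0 cA.
set a := w *m invmx A; have wE : w = a *m A by rewrite /a mulmxKV.
have [->|a0] := eqVneq a 0; first by rewrite normr0 mulr_ge0// divr_ge0// ltW.
rewrite -(ler_pM2r (_ : 0 < `|a|)) ?normr_gt0// -(ler_pM2l c0).
apply: le_trans (_ : c * dot a a <= _); first by rewrite ler_pM2l// sqr_norm_dot.
apply: le_trans (cA a) _; rewrite -wE.
apply: le_trans (ler_norm _) _; apply: le_trans (norm_dot _ _) _.
by rewrite le_eqVlt; apply/orP; left; apply/eqP; field; rewrite gt_eqF.
Qed.

Lemma coercive_inv_entry (c : R) A i j : 0 < c -> coercive c A ->
  `|invmx A i j| <= n%:R / c.
Proof.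
move=> c0 cA; have := coercive_inv_norm (delta_mx 0 i) c0 cA.
rewrite -rowE => /(le_trans (coord_norm _ j)); rewrite mxE => /le_trans; apply.
rewrite -[leRHS]mulr1 ler_wpM2l//; first by rewrite divr_ge0// ltW.
by apply/rV_normP => // k; rewrite mxE; case: (_ && _); rewrite ?normr1 ?normr0.
Qed.

(** With [w = a A], the product [<w A^-1, w>] is [<a A, a>], and [|w|] is at most
   a multiple of [|a|]. *)
Lemma coercive_inv (c M : R) A : 0 < c -> 0 < M -> coercive c A ->
  (forall i j, `|A i j| <= M) ->
  coercive (c / (n%:R * ((n%:R * M) * (n%:R * M)) + 1)) (invmx A).
Proof.
move=> c0 M0 cA AM w; have uA := coercive_unit c0 cA.
set a := w *m invmx A; have wE : w = a *m A by rewrite /a mulmxKV.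
set N := n%:R * M.
have N0 : 0 <= N by rewrite mulr_ge0// ltW.
have k0 : 0 < n%:R * (N * N) + 1 by rewrite ltr_wpDl ?ltr01// mulr_ge0// mulr_ge0.
have -> : dot a w = dot (a *m A) a by rewrite dotC -wE.
apply: le_trans (cA a).
rewrite mulrAC ler_pdivrMr// -[leRHS]mulrA ler_pM2l//.
have wa : `|w| <= N * `|a|.
  by rewrite {1}wE -mulrA; apply: norm_mulmx => //; exact: ltW.
apply: le_trans (dot_le_norm _) _.
apply: le_trans (_ : n%:R * ((N * `|a|) * (N * `|a|)) <= _).
  by rewrite ler_wpM2l// ler_pM.
rewrite (_ : n%:R * _ = n%:R * (N * N) * (`|a| * `|a|)); last by ring.
rewrite [leRHS]mulrDr mulr1 [X in _ <= X + _]mulrC -[leLHS]addr0.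
have NN : 0 <= n%:R * (N * N) by rewrite mulr_ge0// mulr_ge0.
by rewrite lerD ?dot_ge0// ler_wpM2l// sqr_norm_dot.
Qed.

Lemma coerciveD (c c' t : R) A A' : 0 <= t <= 1 ->
  coercive c A -> coercive c' A' ->
  coercive (Num.min c c') ((1 - t) *: A + t *: A').
Proof.
move=> /andP[t0 t1] cA cA' w.
rewrite mulmxDr -!scalemxAr dotDl !dotZl.
have q0 : 0 <= 1 - t by lra.
have h1 : Num.min c c' * dot w w <= dot (w *m A) w.
  apply: le_trans (cA w); rewrite ler_wpM2r ?dot_ge0//.
  by rewrite ge_min lexx.
have h2 : Num.min c c' * dot w w <= dot (w *m A') w.
  apply: le_trans (cA' w); rewrite ler_wpM2r ?dot_ge0//.
  by rewrite ge_min lexx orbT.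
have := ler_wpM2l q0 h1; have := ler_wpM2l t0 h2; lra.
Qed.

Lemma norm_det A (M : R) : (forall i j, `|A i j| <= M) ->
  `|\det A| <= #|{perm 'I_n}|%:R * M ^+ n.
Proof.
move=> AM; apply: le_trans (ler_norm_sum _ _ _) _.
rewrite mulr_natl -sumr_const; apply: ler_sum => s _.
rewrite normrM normrX normrN1 expr1n mul1r normr_prod.
rewrite -[X in _ ^+ X](card_ord n) -prodr_const.
by apply: ler_prod => i _; rewrite normr_ge0 AM.
Qed.

(** The inverse of the determinant is the determinant of the inverse matrix,
   whose entries are bounded. *)
Lemma coercive_det (c : R) : 0 < c -> exists2 M : R, 0 < M &
  forall A, coercive c A -> \det A != 0 /\ `|(\det A)^-1| <= M.
Proof.
move=> c0; exists (#|{perm 'I_n}|%:R * (n%:R / c) ^+ n + 1).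
  by rewrite ltr_wpDl// mulr_ge0// exprn_ge0// divr_ge0// ltW.
move=> A cA; have uA := coercive_unit c0 cA; split.
  by move: uA; rewrite unitmxE unitfE.
rewrite -det_inv; apply: le_trans (_ : #|{perm 'I_n}|%:R * (n%:R / c) ^+ n <= _).
  by apply: norm_det => i j; exact: coercive_inv_entry.
by rewrite lerDl.
Qed.

End CoerciveMatrices.

Section CoerciveFields.
Context {R : realType} {V : normedModType R} {n : nat}.
Variable W : set V.
Hypothesis oW : open W.
Hypothesis cW : compact (closure W).

Lemma usmooth_invmx (A : V -> 'M[R]_n) (c : R) : 0 < c ->
  (forall x, W x -> coercive c (A x)) ->
  (forall i j, usmooth W (fun x => A x i j)) ->
  forall i j, usmooth W (fun x => invmx (A x) i j).
Proof.
move=> c0 cA sA i j; have [M M0 MP] := @coercive_det R n c c0.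
have sdet : usmooth W (fun x => \det (A x)).
  apply: alg_usmooth_closed => //; apply: alg_det => k l.
  by apply: alg_gen; exact: sA.
have sV : usmooth W (fun x => (\det (A x))^-1).
  apply: usmoothV => //; first by move=> x /cA/MP[].
  by exists M => // x /cA/MP[].
apply: alg_usmooth_closed => //; apply: alg_invmx.
- by move=> x /cA; exact: coercive_unit.
- by move=> k l; apply: alg_gen; exact: sA.
- exact: alg_gen.
Qed.

End CoerciveFields.

(** * Smoothness of the interpolation *)

Section Small.
Context {R : realType} {V V' : normedModType R}.

(** [f h = o(h)] at the origin. *)
Definition small (f : V -> V') := forall e : R, 0 < e ->
  exists2 d : R, 0 < d & forall h, `|h| < d -> `|f h| <= e * `|h|.

Lemma smallD f g : small f -> small g -> small (fun h => f h + g h).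
Proof.
move=> sf sg e e0; have e20 : 0 < e / 2 by rewrite divr_gt0.
have [d d0 dP] := sf _ e20; have [d' d'0 dP'] := sg _ e20.
exists (Num.min d d'); first by rewrite lt_min d0.
move=> h; rewrite lt_min => /andP[hd hd'].
rewrite (le_trans (ler_normD _ _))// (splitr e) mulrDl lerD//.
  exact: dP.
exact: dP'.
Qed.

Lemma smallN f : small f -> small (fun h => - f h).
Proof.
by move=> sf e /sf[d d0 dP]; exists d => // h /dP; rewrite normrN.
Qed.

Lemma eq_small (r : R) f g : 0 < r -> (forall h, `|h| < r -> f h = g h) ->
  small f -> small g.
Proof.
move=> r0 fg sf e /sf[d d0 dP]; exists (Num.min r d); first by rewrite lt_min r0.
by move=> h; rewrite lt_min => /andP[hr hd]; rewrite -fg//; exact: dP.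
Qed.

Lemma bounded_linear_differentiable (f L : V -> V') x (C : R) : 0 < C ->
  linear L -> (forall h, `|L h| <= C * `|h|) ->
  small (fun h => f (x + h) - f x - L h) ->
  differentiable f x /\ forall v, 'D_v f x = L v.
Proof.
move=> C0 lL bL sL.
pose mL := GRing.isLinear.Build _ _ _ _ L lL.
pose LL : {linear V -> V'} := HB.pack L mL.
have cL : continuous LL.
  apply: (lipschitz_continuous C0) => y z.
  by rewrite -linearB; exact: bL.
have [df dL] := eps_differentiable cL sL.
by split => // v; rewrite deriveE// dL.
Qed.

End Small.

Section SmallMatrix.
Context {R : realType} {V : normedModType R} {n : nat}.
Implicit Types f : V -> 'rV[R]_n.

Lemma mx_entry_bound m p (A : 'M[R]_(m, p)) i j : `|A i j| <= `|A|.
Proof. by apply: (mx_normP A (normr_ge0 A)).1. Qed.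

Lemma norm_mulmx_le (w : 'rV[R]_n) (A : 'M[R]_n) :
  `|w *m A| <= (n%:R * `|A| + 1) * `|w|.
Proof.
apply: le_trans (norm_mulmx w (normr_ge0 A) (mx_entry_bound A)) _.
by rewrite mulrA mulrDl lerDl mul1r.
Qed.

Lemma small_mulmx f (A : 'M[R]_n) : small f -> small (fun h => f h *m A).
Proof.
move=> sf e e0; set k := n%:R * `|A| + 1.
have k0 : 0 < k by rewrite ltr_wpDl// mulr_ge0.
have ek : 0 < e / k by rewrite divr_gt0.
have [d d0 dP] := sf _ ek; exists d => // h /dP fh.
apply: le_trans (norm_mulmx_le _ _) _; rewrite -/k.
by rewrite -ler_pdivlMl// mulrA [k^-1 * e]mulrC.
Qed.

Lemma smallZ f (a : R) : small f -> small (fun h => a *: f h).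
Proof.
move=> /(small_mulmx a%:M); congr small; apply/funext => h.
by rewrite mul_mx_scalar.
Qed.

End SmallMatrix.

Section GradientExpansion.
Context {R : realType} {n : nat}.
Variable U : set 'rV[R]_n.
Hypothesis oU : open U.

Lemma gradient_differentiable f x : usmooth U f -> U x ->
  differentiable (gradient f) x /\
  forall w, 'D_w (gradient f) x = w *m hessian std_basis f x.
Proof.
move=> sf Ux.
have dc i : differentiable (fun y => gradient f y 0 i) x.
  rewrite (_ : (fun y => _) = 'D_(std_basis i) f).
    by apply: usmooth_diff Ux; exact: usmooth_derive.
  by apply/funext => y; rewrite mxE.
have dg : differentiable (gradient f) x by exact: differentiable_rV.
split => // w; apply/rowP => i; rewrite derive_coord//.
rewrite (_ : (fun y => _) = 'D_(std_basis i) f); last first.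
  by apply/funext => y; rewrite mxE.
by rewrite (second_derive oU)// dot_basis.
Qed.

Lemma gradient_small f x : usmooth U f -> U x ->
  small (fun k => gradient f (x + k) - gradient f x
                  - k *m hessian std_basis f x).
Proof.
move=> sf Ux; have [dg dE] := gradient_differentiable sf Ux.
move=> e e0; have [d d0 dP] := differentiable_eps dg e0.
by exists d => // k /dP; rewrite -deriveE// dE.
Qed.

End GradientExpansion.

Section InterpolationSmooth.
Context {R : realType} {n : nat}.
Hypothesis n0 : (0 < n)%N.
Variable U : set 'rV[R]_n.
Hypothesis dU : smooth_strictly_convex_domain U.

Let oU := domain_open dU.
Let cU := domain_compact dU.
Let ST : normedModType R := @space_time R n.
Let W : set ST := cylinder U.
Let oW : open W := cylinder_open dU.
Let cW : compact (closure W) := cylinder_compact dU.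

Variables (phi psi : 'rV[R]_n -> R).
Hypothesis Sphi : calS U phi.
Hypothesis Spsi : calS U psi.
Let sphi := calS_usmooth dU Sphi.
Let spsi := calS_usmooth dU Spsi.

(** The cylinder together with its two ends, where the data are prescribed. *)
Definition slab : set ST := [set z | U z.1 /\ 0 <= z.2 <= 1].

(** [X z] and [Z z] are the gradients of the Legendre transforms of [phi] and
   [psi] at a common slope, chosen so that the gradient of the interpolated
   transform [(1 - t) phi^* + t psi^*] at this slope is the space component of
   [z]. *)
Definition interpolation (X Z : ST -> 'rV[R]_n) := forall z, slab z ->
  [/\ U (X z), U (Z z), gradient phi (X z) = gradient psi (Z z) &
      (1 - z.2) *: X z + z.2 *: Z z = z.1].

Variables X Z : ST -> 'rV[R]_n.
Hypothesis XZ : interpolation X Z.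

Lemma cylinder_slab z : W z -> slab z.
Proof.
by move=> /cylinderE[Uz /andP[t0 t1]]; split => //; rewrite !ltW.
Qed.

Lemma interpolation_lip : exists2 K : R, 0 < K & forall z z', slab z -> slab z' ->
  `|X z - X z'| <= K * `|z - z'| /\ `|Z z - Z z'| <= K * `|z - z'|.
Proof.
have [K K0 KP] := interpolation_lipschitz n0 dU Sphi Spsi.
exists K => // z z' sz sz'.
have [UX UZ g zE] := XZ sz; have [UX' UZ' g' zE'] := XZ sz'.
have := lexx `|z - z'|; rewrite {1}prod_norm_le/= => /andP[h1 h2].
apply: (KP _ _ z.2 _ _ z'.2) => //; first by case: sz.
by rewrite zE zE'.
Qed.

Definition inv_hess (v : 'rV[R]_n -> R) x := invmx (hessian std_basis v x).
(** The Hessian of the interpolated Legendre transform; its inverse is the space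
   Hessian of the geodesic. *)
Definition mean_inv_hess (z : ST) : 'M[R]_n :=
  (1 - z.2) *: inv_hess phi (X z) + z.2 *: inv_hess psi (Z z).

(** Common velocity of the two gradients when [z] moves with velocity [h]. *)
Definition gradient_velocity (z h : ST) : 'rV[R]_n :=
  (h.1 - h.2 *: (Z z - X z)) *m invmx (mean_inv_hess z).

Lemma hess_coercive (v : 'rV[R]_n -> R) : calS U v ->
  exists2 c : R, 0 < c & forall x, U x -> coercive c (hessian std_basis v x).
Proof.
move=> Sv; have [c c0 cP] := calS_hessian_pos n0 dU Sv.
by exists c => // x Ux w; exact: cP.
Qed.

Lemma hess_usmooth (v : 'rV[R]_n -> R) i j : calS U v ->
  usmooth U (fun x => hessian std_basis v x i j).
Proof.
move=> Sv; rewrite (_ : (fun x => _) =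
    'D_(std_basis i) ('D_(std_basis j) v)); last first.
  by apply/funext => x; rewrite mxE.
by do 2 apply: usmooth_derive; exact: calS_usmooth.
Qed.

Lemma inv_hess_coercive (v : 'rV[R]_n -> R) : calS U v ->
  exists2 c : R, 0 < c & forall x, U x ->
    coercive c (inv_hess v x).
Proof.
move=> Sv; have [c c0 cP] := hess_coercive Sv.
have bH (k : 'I_#|{: 'I_n * 'I_n}|) : bounded_on U
    (fun x => hessian std_basis v x (enum_val k).1 (enum_val k).2).
  by apply: ucont_bounded => //; exact/usmooth_ucont/hess_usmooth.
have [M M0 MP] := bounded_family bH.
exists (c / (n%:R * ((n%:R * M) * (n%:R * M)) + 1)).
  have nM : 0 <= n%:R * M by rewrite mulr_ge0// ltW.
  by rewrite divr_gt0// ltr_wpDl ?ltr01// mulr_ge0// mulr_ge0.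
move=> x Ux; apply: coercive_inv => //; first exact: cP.
move=> i j; have := MP (enum_rank (i, j)) x Ux.
by rewrite enum_rankK.
Qed.

Lemma mean_inv_hess_coercive : exists2 c : R, 0 < c & forall z, slab z ->
  coercive c (mean_inv_hess z).
Proof.
have [c c0 cP] := inv_hess_coercive Sphi.
have [c' c'0 cP'] := inv_hess_coercive Spsi.
exists (Num.min c c'); first by rewrite lt_min c0.
move=> z sz; have [UX UZ _ _] := XZ sz.
by apply: coerciveD; [case: sz|exact: cP|exact: cP'].
Qed.

(** Linearizing the two defining equations of [X] and [Z]: the increments of
   both gradients agree, and the weighted sum of the increments of [X] and [Z]
   is prescribed. *)
Lemma interpolation_differentiable z : W z ->
  (differentiable X z /\
   forall v, 'D_v X z = gradient_velocity z v *m inv_hess phi (X z)) /\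
  (differentiable Z z /\
   forall v, 'D_v Z z = gradient_velocity z v *m inv_hess psi (Z z)).
Proof.
move=> Wz; have sz := cylinder_slab Wz.
have [UX UZ gXZ zE] := XZ sz.
have [K K0 KP] := interpolation_lip.
have [r r0 rP] := open_normP oW Wz.
have [c c0 cP] := mean_inv_hess_coercive.
have uB := coercive_unit c0 (cP z sz).
have uphi : hessian std_basis phi (X z) \in unitmx.
  by have [c1 c10 cP1] := hess_coercive Sphi; exact: coercive_unit (cP1 _ UX).
have upsi : hessian std_basis psi (Z z) \in unitmx.
  by have [c1 c10 cP1] := hess_coercive Spsi; exact: coercive_unit (cP1 _ UZ).
set P := inv_hess phi (X z); set Q := inv_hess psi (Z z).
set B := mean_inv_hess z in uB.
pose dX h := X (z + h) - X z; pose dZ h := Z (z + h) - Z z.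
have Wh h : `|h| < r -> W (z + h).
  by move=> hr; apply: rP; rewrite [z + h]addrC addrK.
have lipX h : `|h| < r -> `|dX h| <= K * `|h|.
  move=> /Wh/cylinder_slab sh; have [+ _] := KP _ _ sh sz.
  by rewrite [z + h - z]addrAC subrr add0r.
have lipZ h : `|h| < r -> `|dZ h| <= K * `|h|.
  move=> /Wh/cylinder_slab sh; have [_] := KP _ _ sh sz.
  by rewrite [z + h - z]addrAC subrr add0r.
have comp (f : 'rV[R]_n -> 'rV[R]_n) (D : ST -> 'rV[R]_n) :
    small f -> (forall h, `|h| < r -> `|D h| <= K * `|h|) ->
    small (fun h => f (D h)).
  move=> sf lD e e0; have eK : 0 < e / K by rewrite divr_gt0.
  have [d d0 dP] := sf _ eK.
  exists (Num.min r (d / K)); first by rewrite lt_min r0 divr_gt0.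
  move=> h; rewrite lt_min => /andP[hr hd].
  apply: le_trans (dP _ _) _.
    by apply: le_lt_trans (lD h hr) _; rewrite mulrC -ltr_pdivlMr.
  by rewrite -mulrA ler_pM2l// ler_pdivrMl// lD.
pose r1 h := gradient phi (X z + dX h) - gradient phi (X z)
             - dX h *m hessian std_basis phi (X z).
pose r2 h := gradient psi (Z z + dZ h) - gradient psi (Z z)
             - dZ h *m hessian std_basis psi (Z z).
have s1 : small r1.
  exact: (comp (fun k => gradient phi (X z + k) - gradient phi (X z)
    - k *m hessian std_basis phi (X z)) dX (gradient_small oU sphi UX) lipX).
have s2 : small r2.
  exact: (comp (fun k => gradient psi (Z z + k) - gradient psi (Z z)
    - k *m hessian std_basis psi (Z z)) dZ (gradient_small oU spsi UZ) lipZ).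
pose q (h : ST) := h.2 *: (dZ h - dX h).
have s3 : small q.
  move=> e e0; exists (Num.min r (e / (K + K))).
    by rewrite lt_min r0 divr_gt0// addr_gt0.
  move=> h; rewrite lt_min => /andP[hr he].
  have h2 : `|h.2| <= `|h| by have := lexx `|h|; rewrite {1}prod_norm_le => /andP[].
  rewrite normrZ mulrC; apply: ler_pM => //.
  apply: le_trans (ler_normB _ _) _.
  apply: le_trans (lerD (lipZ h hr) (lipX h hr)) _.
  by rewrite -mulrDl mulrC -ler_pdivlMr ?addr_gt0// ltW.
pose dp h := gradient phi (X (z + h)) - gradient phi (X z).
pose a (h : ST) := h.1 - h.2 *: (Z z - X z).
pose E h := (1 - z.2) *: (r1 h *m P) + z.2 *: (r2 h *m Q) - q h.
have sE : small E.
  apply: smallD; last exact: smallN.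
  by apply: smallD; apply: smallZ; exact: small_mulmx.
have solve (u v : 'rV[R]_n) (A : 'M[R]_n) : A \in unitmx ->
    v = (u - (u - v *m A)) *m invmx A.
  by move=> uA; rewrite subKr mulmxK.
have balance (u v1 v2 k w : 'rV[R]_n) (A A' : 'M[R]_n) (t s : R) :
    u *m ((1 - t) *: A + t *: A') =
    (1 - t) *: ((u - v1) *m A) + t *: ((u - v2) *m A') + s *: k + w - s *: k
    + ((1 - t) *: (v1 *m A) + t *: (v2 *m A') - w).
  rewrite !mulmxBl mulmxDr -!scalemxAr.
  move: (u *m A) (v1 *m A) (u *m A') (v2 *m A') => u1 u2 u3 u4.
  by apply/rowP => j; rewrite !mxE; ring.
have dXE h : dX h = (dp h - r1 h) *m P.
  have -> : r1 h = dp h - dX h *m hessian std_basis phi (X z).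
    by rewrite /r1 /dp (_ : X z + dX h = X (z + h))// /dX subrKC.
  exact: solve.
have dZE h : `|h| < r -> dZ h = (dp h - r2 h) *m Q.
  move=> /Wh/cylinder_slab sh; have [_ _ gh _] := XZ sh.
  have -> : r2 h = dp h - dZ h *m hessian std_basis psi (Z z).
    by rewrite /r2 /dp gh gXZ (_ : Z z + dZ h = Z (z + h))// /dZ subrKC.
  exact: solve.
have dpE h : `|h| < r -> dp h *m B = a h + E h.
  move=> hr; have [_ _ _ zhE] := XZ (cylinder_slab (Wh h hr)).
  have h1E : h.1 = (1 - z.2) *: dX h + z.2 *: dZ h + h.2 *: (Z z - X z) + q h.
    have : (z + h).1 - z.1 = h.1 by rewrite /= [z.1 + _]addrC addrK.
    move=> <-; rewrite -{1}zhE -{1}zE /q /dX /dZ /=.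
    by apply/rowP => k; rewrite !mxE; ring.
  rewrite /a h1E {1}(dXE h) {1}(dZE h hr); exact: balance.
have dpE' h : `|h| < r -> dp h = (a h + E h) *m invmx B.
  by move=> hr; rewrite -dpE// mulmxK.
have norm1 (h : ST) : `|h.1| <= `|h| /\ `|h.2| <= `|h|.
  by have := lexx `|h|; rewrite {1}prod_norm_le => /andP[].
have alin : linear a.
  move=> k u v; rewrite /a (_ : (k *: u + v).1 = k *: u.1 + v.1)//.
  rewrite (_ : (k *: u + v).2 = k * u.2 + v.2)//.
  by apply/rowP => i; rewrite !mxE; ring.
have abound h : `|a h| <= (1 + `|Z z - X z|) * `|h|.
  have [h1 h2] := norm1 h; apply: le_trans (ler_normB _ _) _.
  by rewrite mulrDl mul1r lerD// normrZ mulrC ler_wpM2l.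
have split_error (u v w : 'rV[R]_n) (A A' : 'M[R]_n) :
    (v *m A - w) *m A' = ((u + v) *m A - w) *m A' - u *m A *m A'.
  by rewrite [(u + v) *m A]mulmxDl -addrA [in RHS]mulmxDl addrAC subrr add0r.
have lin2 (k : R) (u v : 'rV[R]_n) (A A' : 'M[R]_n) :
    (k *: u + v) *m A *m A' = k *: (u *m A *m A') + v *m A *m A'.
  by rewrite !mulmxDl -!scalemxAl.
have main (Y : ST -> 'rV[R]_n) (D : 'M[R]_n) (rr : ST -> 'rV[R]_n) : small rr ->
    (forall h, `|h| < r -> Y (z + h) - Y z = (dp h - rr h) *m D) ->
    differentiable Y z /\ forall v, 'D_v Y z = gradient_velocity z v *m D.
  move=> srr YE; pose L h := a h *m invmx B *m D.
  pose C := (n%:R * `|D| + 1) * ((n%:R * `|invmx B| + 1) * (1 + `|Z z - X z|)).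
  apply: (@bounded_linear_differentiable _ _ _ _ L _ C).
  - by rewrite !mulr_gt0// ?ltr_wpDl ?ltr01// ?mulr_ge0// ltr_pwDl.
  - by move=> k u v; rewrite /L alin; exact: lin2.
  - move=> h; apply: le_trans (norm_mulmx_le _ _) _.
    have k0 (A : 'M[R]_n) : 0 <= n%:R * `|A| + 1 by rewrite addr_ge0// mulr_ge0.
    rewrite /C -[leRHS]mulrA; apply: ler_wpM2l => //.
    apply: le_trans (norm_mulmx_le _ _) _.
    by rewrite -[leRHS]mulrA; apply: ler_wpM2l.
  - have sT : small (fun h => (E h *m invmx B - rr h) *m D).
      by apply: small_mulmx; apply: smallD; [exact: small_mulmx|exact: smallN].
    apply: (eq_small r0 _ sT) => h hr.
    by rewrite YE// dpE'// /L; exact: split_error.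
split; [exact: (main X P r1 s1 (fun h _ => dXE h))|exact: (main Z Q r2 s2 dZE)].
Qed.

End InterpolationSmooth.

Section InterpolationAlgebra.
Context {R : realType} {n : nat}.
Hypothesis n0 : (0 < n)%N.
Variable U : set 'rV[R]_n.
Hypothesis dU : smooth_strictly_convex_domain U.

Let oU := domain_open dU.
Let cU := domain_compact dU.
Let ST : normedModType R := @space_time R n.
Let W : set ST := cylinder U.
Let oW : open W := cylinder_open dU.
Let cW : compact (closure W) := cylinder_compact dU.

Variables (phi psi : 'rV[R]_n -> R).
Hypothesis Sphi : calS U phi.
Hypothesis Spsi : calS U psi.
Variables X Z : ST -> 'rV[R]_n.
Hypothesis XZ : interpolation U phi psi X Z.

Let M (z : ST) := mean_inv_hess phi psi X Z z.
Let velocity (z h : ST) := gradient_velocity phi psi X Z z h.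

Lemma usmooth_coord i : usmooth U (fun x : 'rV[R]_n => x 0 i).
Proof.
pose G := [set fun x : 'rV[R]_n => x 0 i].
apply: (@alg_usmooth _ _ U oU cU G); last exact: alg_gen.
- by move=> g -> x _; exact: differentiable_coord.
- by move=> g ->; exact: ucont_coord.
- move=> g v ->; apply: alg_eq (alg_cst _ _ (v 0 i)) => x _.
  have [_ ->] // : is_derive x v (fun x : 'rV[R]_n => x 0 i) (v 0 i).
  apply: eps_derive => e e0; exists 1 => // h _.
  rewrite !mxE -[h *: v 0 i]/(h * v 0 i) [x 0 i + _]addrC addrK subrr normr0.
  by rewrite mulr_ge0// ltW.
Qed.

Definition pulled_back : set (ST -> R) :=
  [set g | (exists2 f, usmooth U f & g = fun z => f (X z)) \/
           (exists2 f, usmooth U f & g = fun z => f (Z z))] `|`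
  [set (fun z => z.2)].

(** The determinant enters the derivatives of [X] and [Z] through the inverse of
   [M]. *)
Definition generators : set (ST -> R) :=
  pulled_back `|` [set (fun z => (\det (M z))^-1)].

Lemma snd_derive (z v : ST) :
  differentiable (fun z : ST => z.2) z /\ 'D_v (fun z : ST => z.2) z = v.2.
Proof.
have bl (h : ST) : `|h.2| <= 1 * `|h|.
  by rewrite mul1r; have := lexx `|h|; rewrite {1}prod_norm_le => /andP[].
have sm : small (fun h : ST => (z + h).2 - z.2 - h.2 : R^o).
  move=> e e0; exists 1 => // h _.
  by rewrite /= [z.2 + _]addrC addrK subrr normr0 mulr_ge0// ltW.
have [d ->] := @bounded_linear_differentiable R ST R^o (fun z => z.2)
  (fun z => z.2) z 1 ltr01 (fun _ _ _ => erefl) bl sm.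
by [].
Qed.

Lemma pulled_back_diff g : pulled_back g -> forall z, W z -> differentiable g z.
Proof.
move=> Gg z Wz.
have [[dX _] [dZ _]] := interpolation_differentiable n0 dU Sphi Spsi XZ Wz.
have [UX UZ _ _] := XZ (cylinder_slab Wz).
case: Gg => [[[f sf ->]|[f sf ->]]|->]; last exact: (snd_derive z 0).1.
  by apply: (chain_gradient 0 dX _).1; exact: usmooth_diff UX.
by apply: (chain_gradient 0 dZ _).1; exact: usmooth_diff UZ.
Qed.

Lemma pulled_back_ucont g : pulled_back g -> ucont W g.
Proof.
have [K K0 KP] := interpolation_lip n0 dU Sphi Spsi XZ.
have comp f (Y : ST -> 'rV[R]_n) : usmooth U f -> (forall z, W z -> U (Y z)) ->
    (forall z z', W z -> W z' -> `|Y z - Y z'| <= K * `|z - z'|) ->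
    ucont W (fun z => f (Y z)).
  move=> sf UY lY e e0; have [d d0 dP] := usmooth_ucont sf e0.
  exists (d / K); first by rewrite divr_gt0.
  move=> z z' Wz Wz' zz'; apply: dP; try exact: UY.
  by apply: le_lt_trans (lY z z' Wz Wz') _; rewrite mulrC -ltr_pdivlMr.
case=> [[[f sf ->]|[f sf ->]]|->].
- apply: comp => // [z /cylinder_slab/XZ[]//|z z' /cylinder_slab sz /cylinder_slab sz'].
  by have [] := KP z z' sz sz'.
- apply: comp => // [z /cylinder_slab/XZ[]//|z z' /cylinder_slab sz /cylinder_slab sz'].
  by have [] := KP z z' sz sz'.
- move=> e e0; exists e => // z z' _ _ zz'; apply/ltW/(le_lt_trans _ zz').
  by have := lexx `|z - z'|; rewrite {1}prod_norm_le => /andP[].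
Qed.

Lemma alg_X (f : 'rV[R]_n -> R) (G : set (ST -> R)) : pulled_back `<=` G ->
  usmooth U f -> alg W G (fun z => f (X z)).
Proof. by move=> sG sf; apply: alg_gen; apply: sG; left; left; exists f. Qed.

Lemma alg_Z (f : 'rV[R]_n -> R) (G : set (ST -> R)) : pulled_back `<=` G ->
  usmooth U f -> alg W G (fun z => f (Z z)).
Proof. by move=> sG sf; apply: alg_gen; apply: sG; left; right; exists f. Qed.

Lemma alg_time (G : set (ST -> R)) : pulled_back `<=` G ->
  alg W G (fun z => z.2).
Proof. by move=> sG; apply: alg_gen; apply: sG; right. Qed.

Lemma usmooth_inv_hess (v : 'rV[R]_n -> R) i j : calS U v ->
  usmooth U (fun x => inv_hess v x i j).
Proof.
move=> Sv; have [c c0 cP] := hess_coercive n0 dU Sv.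
apply: (@usmooth_invmx _ _ _ U oU cU _ c) => // k l.
exact: hess_usmooth.
Qed.

Lemma alg_mean (G : set (ST -> R)) i j : pulled_back `<=` G ->
  alg W G (fun z => M z i j).
Proof.
move=> sG.
have aT := alg_time sG.
have aP : alg W G (fun z => (1 - z.2) * inv_hess phi (X z) i j).
  apply: algM; first by apply: algB => //; exact: alg_cst.
  exact: (alg_X sG (usmooth_inv_hess i j Sphi)).
have aQ := algM aT (alg_Z sG (usmooth_inv_hess i j Spsi)).
have entry (A B : 'M[R]_n) (t : R) :
    (1 - t) * A i j + t * B i j = ((1 - t) *: A + t *: B) i j.
  by rewrite !mxE.
by apply: alg_eq (algD aP aQ) => z _; exact: entry.
Qed.

Let sub1 : pulled_back `<=` generators. Proof. by move=> g; left. Qed.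

Lemma alg_inv_mean i j : alg W generators (fun z => invmx (M z) i j).
Proof.
have [c c0 cP] := mean_inv_hess_coercive n0 dU Sphi Spsi XZ.
apply: alg_invmx.
- by move=> z /cylinder_slab/cP; exact: coercive_unit.
- by move=> k l; exact: alg_mean.
- by apply: alg_gen; right.
Qed.

Lemma alg_velocity (v : ST) i : alg W generators (fun z => velocity z v 0 i).
Proof.
have aa k : alg W generators (fun z => (v.1 - v.2 *: (Z z - X z)) 0 k).
  have aX := alg_X sub1 (usmooth_coord k).
  have aZ := alg_Z sub1 (usmooth_coord k).
  apply: alg_eq (algB (alg_cst _ _ (v.1 0 k)) (algM (alg_cst _ _ v.2) (algB aZ aX))).
  have entry (a x y : 'rV[R]_n) (t : R) :
      a 0 k - t * (x 0 k - y 0 k) = (a - t *: (x - y)) 0 k.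
    by rewrite !mxE.
  by move=> z _; exact: entry.
have : alg W generators (fun z =>
    \sum_k (v.1 - v.2 *: (Z z - X z)) 0 k * invmx (M z) k i).
  by apply: alg_sum => k _; apply: algM; [exact: aa|exact: alg_inv_mean].
have entry (a : 'rV[R]_n) (A : 'M[R]_n) :
    \sum_k a 0 k * A k i = (a *m A) 0 i.
  by rewrite mxE.
by apply: alg_eq => z _; exact: entry.
Qed.

Lemma alg_pulled_back_derive g v : pulled_back g -> alg W generators ('D_v g).
Proof.
have chain (f : 'rV[R]_n -> R) (Y : ST -> 'rV[R]_n) (D : ST -> 'M[R]_n) :
    usmooth U f -> (forall z, W z -> U (Y z)) ->
    (forall f, usmooth U f -> alg W generators (fun z => f (Y z))) ->
    (forall i j, alg W generators (fun z => D z i j)) ->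
    (forall z, W z -> differentiable Y z /\
       forall v, 'D_v Y z = velocity z v *m D z) ->
    alg W generators ('D_v (fun z => f (Y z))).
  move=> sf UY aY aD dY.
  have : alg W generators (fun z => \sum_i 'D_(std_basis i) f (Y z) *
      (\sum_k velocity z v 0 k * D z k i)).
    apply: alg_sum => i _; apply: algM.
      exact: (aY _ (usmooth_derive (std_basis i) sf)).
    by apply: alg_sum => k _; apply: algM; [exact: alg_velocity|exact: aD].
  apply: alg_eq => z Wz; have [dYz dE] := dY z Wz.
  rewrite (chain_gradient v dYz (usmooth_diff sf (UY z Wz))).2 dE.
  have entry (b a : 'rV[R]_n) (A : 'M[R]_n) :
      \sum_i b 0 i * (\sum_k a 0 k * A k i) = dot b (a *m A).
    by apply: eq_bigr => i _; rewrite mxE.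
  by rewrite -entry; apply: eq_bigr => i _; rewrite mxE.
case=> [[[f sf ->]|[f sf ->]]|->].
- apply: (chain f X (fun z => inv_hess phi (X z))) => //.
  + by move=> z /cylinder_slab/XZ[].
  + by move=> h sh; exact: alg_X.
  + by move=> i j; exact: (alg_X sub1 (usmooth_inv_hess i j Sphi)).
  + move=> z Wz.
    exact: (interpolation_differentiable n0 dU Sphi Spsi XZ Wz).1.
- apply: (chain f Z (fun z => inv_hess psi (Z z))) => //.
  + by move=> z /cylinder_slab/XZ[].
  + by move=> h sh; exact: alg_Z.
  + by move=> i j; exact: (alg_Z sub1 (usmooth_inv_hess i j Spsi)).
  + move=> z Wz.
    exact: (interpolation_differentiable n0 dU Sphi Spsi XZ Wz).2.
- by apply: alg_eq (alg_cst _ _ v.2) => z _; rewrite (snd_derive z v).2.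
Qed.

(** The derivatives of [f o X], [f o Z] and of the inverse determinant are
   polynomials in functions of the same kind, by the formula for the velocities
   of [X] and [Z]. *)
Lemma pulled_back_usmooth g : alg W pulled_back g -> usmooth W g.
Proof.
move=> ag.
have [c c0 cP] := mean_inv_hess_coercive n0 dU Sphi Spsi XZ.
have [N N0 NP] := @coercive_det R n c c0.
have cM z : W z -> \det (M z) != 0 /\ `|(\det (M z))^-1| <= N.
  by move=> /cylinder_slab/cP/NP.
have adet : alg W pulled_back (fun z => \det (M z)).
  by apply: alg_det => i j; exact: alg_mean.
have ddet := alg_diff oW pulled_back_diff adet.
apply: (@alg_usmooth _ _ W oW cW generators); last exact: algS ag.
- move=> h [Gh|->] z Wz; first exact: pulled_back_diff Gh z Wz.
  by apply: differentiableV; [exact: ddet|exact: (cM z Wz).1].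
- move=> h [Gh|->]; first exact: pulled_back_ucont.
  apply: ucontV; last exact: (alg_ucont cW pulled_back_ucont adet).
    by exists N => // z /cM[].
  by move=> z /cM[].
- move=> h v [Gh|->]; first exact: alg_pulled_back_derive.
  have aV : alg W generators (fun z => (\det (M z))^-1) by apply: alg_gen; right.
  have aD : alg W generators ('D_v (fun z => \det (M z))).
    apply: (alg_derive oW sub1 pulled_back_diff _ adet) => k Gk.
    exact: alg_pulled_back_derive.
  apply: alg_eq (algN (algM (algM aV aV) aD)) => z Wz.
  by rewrite derive_inv//; [exact: (cM z Wz).1|exact: ddet].
Qed.

End InterpolationAlgebra.

(** * The geodesic *)

Section GeodesicFunction.
Context {R : realType} {n : nat}.
Hypothesis n0 : (0 < n)%N.
Variable U : set 'rV[R]_n.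
Hypothesis dU : smooth_strictly_convex_domain U.

Let cU := domain_compact dU.
Let ST : normedModType R := @space_time R n.
Let W : set ST := cylinder U.
Let oW : open W := cylinder_open dU.
Let cW : compact (closure W) := cylinder_compact dU.

Variables (phi psi : 'rV[R]_n -> R).
Hypothesis Sphi : calS U phi.
Hypothesis Spsi : calS U psi.
Variables X Z : ST -> 'rV[R]_n.
Hypothesis XZ : interpolation U phi psi X Z.
Let sphi := calS_usmooth dU Sphi.
Let spsi := calS_usmooth dU Spsi.

(** The double Legendre transform of [(1 - t) phi^* + t psi^*]. The value zero
   outside of [U] is the prescribed one on the lateral boundary. *)
Definition geodesic (z : ST) : R :=
  if `[< U z.1 >] then (1 - z.2) * phi (X z) + z.2 * psi (Z z) else 0.

Let p (z : ST) := gradient phi (X z).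
(** The time derivative of the geodesic, by [geodesic_derive]. *)
Definition time_slope (z : ST) :=
  psi (Z z) - phi (X z) - dot (gradient phi (X z)) (Z z - X z).
Let tau := time_slope.

Lemma geodesicE z : U z.1 ->
  geodesic z = (1 - z.2) * phi (X z) + z.2 * psi (Z z).
Proof. by move=> Uz; rewrite /geodesic; case: asboolP. Qed.

Lemma geodesic_outside z : ~ U z.1 -> geodesic z = 0.
Proof. by move=> Uz; rewrite /geodesic; case: asboolP. Qed.

(** The supporting hyperplanes of [phi] at [X z] and of [psi] at [Z z] have the
   same slope, so their weighted sum only depends on the interpolated point:
   it is affine in space and time. *)
Lemma geodesic_support z z' : slab U z -> slab U z' ->
  geodesic z + (dot (p z) (z'.1 - z.1) + (z'.2 - z.2) * tau z) <= geodesic z'.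
Proof.
move=> sz sz'; have [UX UZ g zE] := XZ sz; have [UX' UZ' _ zE'] := XZ sz'.
rewrite !geodesicE; [|by case: sz'|by case: sz].
have [c c0 cP] := calS_support n0 dU Sphi.
have [c' c'0 cP'] := calS_support n0 dU Spsi.
have [_ /andP[t0 t1]] := sz'.
have q0 : 0 <= 1 - z'.2 by lra.
have h1 : phi (X z) + dot (p z) (X z' - X z) <= phi (X z').
  apply: le_trans (cP _ _ UX (subset_closure UX')).
  by rewrite lerDl mulr_ge0 ?dot_ge0// ltW.
have h2 : psi (Z z) + dot (p z) (Z z' - Z z) <= psi (Z z').
  rewrite /p g; apply: le_trans (cP' _ _ UZ (subset_closure UZ')).
  by rewrite lerDl mulr_ge0 ?dot_ge0// ltW.
apply: le_trans (lerD (ler_wpM2l q0 h1) (ler_wpM2l t0 h2)).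
rewrite -{1}zE' -{1}zE /tau /time_slope -/(p z) !dotBr !dotDr !dotZr.
by rewrite le_eqVlt; apply/orP; left; apply/eqP; ring.
Qed.

Lemma geodesic_convex : convex_function W geodesic.
Proof.
move=> t z z' /set_mem Wz /set_mem Wz'.
pose s : R := t%:num.
have s01 : 0 <= 1 - s <= 1.
  have : 0 <= s <= 1 by rewrite /s; apply/andP; split.
  by move=> /andP[? ?]; apply/andP; split; lra.
pose m : ST := s *: z + (1 - s) *: z'.
suff : geodesic m <= s * geodesic z + (1 - s) * geodesic z' by [].
have Wm : W m.
  have := cylinder_convex dU Wz Wz' s01.
  by rewrite (_ : 1 - (1 - s) = s)//; lra.
have := geodesic_support (cylinder_slab Wm) (cylinder_slab Wz).
have := geodesic_support (cylinder_slab Wm) (cylinder_slab Wz').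
have -> : z.1 - m.1 = (1 - s) *: (z.1 - z'.1).
  by apply/rowP => k; rewrite /m /= !mxE; ring.
have -> : z'.1 - m.1 = (- s) *: (z.1 - z'.1).
  by apply/rowP => k; rewrite /m /= !mxE; ring.
have -> : z.2 - m.2 = (1 - s) * (z.2 - z'.2).
  by rewrite (_ : m.2 = s * z.2 + (1 - s) * z'.2)//; ring.
have -> : z'.2 - m.2 = (- s) * (z.2 - z'.2).
  by rewrite (_ : m.2 = s * z.2 + (1 - s) * z'.2)//; ring.
rewrite !dotZr => h' h; have /andP[s0 s1] := s01.
have s0' : 0 <= s by lra.
have := ler_wpM2l s0' h; have := ler_wpM2l s0 h'; lra.
Qed.

Lemma geodesic_lipschitz_slab : exists2 K : R, 0 < K & forall z z',
  slab U z -> slab U z' -> `|geodesic z' - geodesic z| <= K * `|z' - z|.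
Proof.
have [N N0 NP] := domain_norm_bound dU.
have [M M0 MP] := ucont_bounded cU (usmooth_ucont sphi).
have [M' M'0 MP'] := ucont_bounded cU (usmooth_ucont spsi).
have [P P0 PP] := @bounded_family _ _ U _
  (fun i => 'D_(std_basis i) phi) (fun i =>
  ucont_bounded cU (usmooth_ucont (usmooth_derive (std_basis i) sphi))).
have pP z : slab U z -> `|p z| <= P.
  move=> sz; have [UX _ _ _] := XZ sz; apply/rV_normP; first exact: ltW.
  by move=> i; rewrite mxE; exact: PP.
have [T T0 tP] : exists2 T : R, 0 <= T & forall z, slab U z -> `|tau z| <= T.
  exists (M' + M + n%:R * (P * (N + N))).
    by rewrite !addr_ge0// ?mulr_ge0// ?addr_ge0// ltW.
  move=> z sz; have [UX UZ _ _] := XZ sz.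
  apply: le_trans (ler_normB _ _) _; apply: lerD.
    by apply: le_trans (ler_normB _ _) _; rewrite lerD ?MP ?MP'.
  apply: le_trans (norm_dot _ _) _; rewrite ler_wpM2l//.
  apply: ler_pM => //; first exact: pP.
  by apply: le_trans (ler_normB _ _) _; rewrite lerD ?NP.
exists (n%:R * P + T + 1).
  by rewrite ltr_wpDl ?ltr01// addr_ge0// mulr_ge0// ltW.
move=> z z' sz sz'.
have one a b : slab U a -> slab U b ->
    - ((n%:R * P + T + 1) * `|b - a|) <= geodesic b - geodesic a.
  move=> sa sb; have := geodesic_support sa sb.
  have := lexx `|b - a|; rewrite {1}prod_norm_le/= => /andP[d1 d2].
  have e1 : `|dot (p a) (b.1 - a.1)| <= n%:R * P * `|b - a|.
    apply: le_trans (norm_dot _ _) _; rewrite -mulrA ler_wpM2l//.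
    by apply: ler_pM => //; exact: pP.
  have e2 : `|(b.2 - a.2) * tau a| <= T * `|b - a|.
    by rewrite normrM mulrC; apply: ler_pM => //; exact: tP.
  move: e1 e2; rewrite !ler_norml => /andP[e1 _] /andP[e2 _].
  move: (dot _ _) ((b.2 - a.2) * _) (`|b - a|) (normr_ge0 (b - a)) e1 e2.
  by move=> d u r r0 e1 e2 e3; rewrite !mulrDl mul1r; lra.
rewrite ler_norml one//=; have := one z' z sz' sz.
by rewrite -[z - z']opprB normrN lerNl opprB.
Qed.

(** If [(1 - t) x + t z = y] and [b] lies outside of the convex set [U], then
   neither [x + (b - y) / (1 - t)] nor [z + (b - y) / t] can be in [U]; hence
   both summands of the value at [y] are controlled by the distance to [b]. *)
Lemma geodesic_boundary_bound : exists2 K : R, 0 < K & forall z b,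
  slab U z -> ~ U b -> `|geodesic z| <= K * `|b - z.1|.
Proof.
have vU := domain_convex dU.
have [L L0 LP] := calS_exit dU Sphi; have [L' L'0 LP'] := calS_exit dU Spsi.
exists (L + L'); first exact: addr_gt0.
move=> z b sz nb; have [UX UZ _ zE] := XZ sz; have [Uz t01] := sz.
have /andP[t0 t1] := t01; rewrite geodesicE//.
apply: le_trans (ler_normD _ _) _; rewrite [leRHS]mulrDl; apply: lerD.
  have [->|t1'] := eqVneq z.2 1; first by rewrite subrr mul0r normr0 mulr_ge0// ltW.
  have q0 : 0 < 1 - z.2 by rewrite subr_gt0 lt_neqAle t1' t1.
  pose x' := X z + (1 - z.2)^-1 *: (b - z.1).
  have nx' : ~ U x'.
    move=> Ux'; apply: nb; have := vU _ _ Ux' UZ z.2 t01.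
    rewrite (_ : _ + _ = b)// /x' -{1}zE.
    by apply/rowP => k; rewrite !mxE; field; rewrite gt_eqF.
  have := LP _ _ UX nx'; rewrite /x' [X z + _]addrC addrK normrZ gtr0_norm ?invr_gt0//.
  rewrite normrM gtr0_norm// => h; rewrite -ler_pdivlMl//.
  by apply: le_trans h _; rewrite mulrCA.
have [->|t0'] := eqVneq z.2 0; first by rewrite mul0r normr0 mulr_ge0// ltW.
have q0 : 0 < z.2 by rewrite lt_neqAle eq_sym t0' t0.
pose z' := Z z + z.2^-1 *: (b - z.1).
have nz' : ~ U z'.
  move=> Uz'; apply: nb; have := vU _ _ UX Uz' z.2 t01.
  rewrite (_ : _ + _ = b)// /z' -{1}zE.
  by apply/rowP => k; rewrite !mxE; field; rewrite gt_eqF.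
have := LP' _ _ UZ nz'; rewrite /z' [Z z + _]addrC addrK normrZ gtr0_norm ?invr_gt0//.
rewrite normrM gtr0_norm// => h; rewrite -ler_pdivlMl//.
by apply: le_trans h _; rewrite mulrCA.
Qed.

Lemma geodesic_continuous : {within closure W, continuous geodesic}.
Proof.
have [K K0 KP] := geodesic_lipschitz_slab.
have [L L0 LP] := geodesic_boundary_bound.
have lip z z' : closure W z -> closure W z' ->
    `|geodesic z - geodesic z'| <= (K + L) * `|z - z'|.
  have main a b : closure W a -> closure W b -> U a.1 ->
      `|geodesic a - geodesic b| <= (K + L) * `|a - b|.
    move=> ca cb Ua.
    have sl c : closure W c -> U c.1 -> slab U c.
      by case: c => x t /cylinder_closure[_ t01] Ux; split.
    have [Ub|Ub] := pselect (U b.1).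
      apply: le_trans (KP _ _ (sl b cb Ub) (sl a ca Ua)) _.
      by rewrite ler_wpM2r// lerDl ltW.
    rewrite (geodesic_outside Ub) subr0.
    apply: le_trans (LP a b.1 (sl a ca Ua) Ub) _.
    have := lexx `|a - b|; rewrite {1}prod_norm_le/= => /andP[d1 _].
    rewrite distrC; apply: ler_pM => //; first exact: ltW.
    by rewrite lerDr ltW.
  move=> cz cz'; have [Uz|Uz] := pselect (U z.1); first exact: main.
  have [Uz'|Uz'] := pselect (U z'.1).
    by rewrite distrC [`|z - z'|]distrC; exact: main.
  rewrite !geodesic_outside// subrr normr0 mulr_ge0//; exact/ltW/addr_gt0.
apply: ucont_within => e e0; exists (e / (K + L)).
  by rewrite divr_gt0// addr_gt0.
move=> z z' cz cz' zz'; apply: le_trans (lip z z' cz cz') _.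
by rewrite mulrC -ler_pdivlMr ?addr_gt0// ltW.
Qed.

Lemma geodesic_usmooth : usmooth W geodesic.
Proof.
apply: (pulled_back_usmooth n0 dU Sphi Spsi XZ).
have sG : pulled_back U X Z `<=` pulled_back U X Z by [].
have aT := alg_time sG.
have a1 := algM (algB (alg_cst W _ 1) aT) (alg_X sG sphi).
have a2 := algM aT (alg_Z sG spsi).
by apply: alg_eq (algD a1 a2) => z Wz; rewrite geodesicE//; case: Wz.
Qed.

Lemma geodesic_derive z v : W z ->
  'D_v geodesic z = dot (p z) v.1 + v.2 * tau z.
Proof.
move=> Wz; apply: (derive_support oW Wz).
  by apply: diff_derivable; exact: (usmooth_diff geodesic_usmooth).
move=> h Wh; have := geodesic_support (cylinder_slab Wz) (cylinder_slab Wh).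
have -> : (z + h *: v).1 - z.1 = h *: v.1 by rewrite /= [z.1 + _]addrC addrK.
have -> : (z + h *: v).2 - z.2 = h * v.2 by rewrite /= [z.2 + _]addrC addrK.
by rewrite dotZr -mulrA -mulrDr.
Qed.

End GeodesicFunction.

Section GeodesicEquation.
Context {R : realType} {n : nat}.
Hypothesis n0 : (0 < n)%N.
Variable U : set 'rV[R]_n.
Hypothesis dU : smooth_strictly_convex_domain U.

Let ST : normedModType R := @space_time R n.
Let W : set ST := cylinder U.
Let oW : open W := cylinder_open dU.
Let cW : compact (closure W) := cylinder_compact dU.

Variables (phi psi : 'rV[R]_n -> R).
Hypothesis Sphi : calS U phi.
Hypothesis Spsi : calS U psi.
Variables X Z : ST -> 'rV[R]_n.
Hypothesis XZ : interpolation U phi psi X Z.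
Let u : ST -> R := geodesic U phi psi X Z.
Let su : usmooth W u := geodesic_usmooth n0 dU Sphi Spsi XZ.
Let p (z : ST) := gradient phi (X z).

Lemma space_sum (w : 'rV[R]_n) :
  ((w, 0) : ST) = \sum_i w 0 i *: (space_basis i : ST).
Proof.
rewrite {1}(row_sum_delta w).
rewrite (big_morph (fun x : 'rV[R]_n => (x, 0) : ST) (id1 := 0)
  (op1 := fun a b : ST => a + b))//; last first.
  by move=> a b; congr pair; rewrite /= addr0.
by apply: eq_bigr => i _; congr pair; rewrite /= scaler0.
Qed.

Lemma derive_space (f : ST -> R) z w : differentiable f z ->
  'D_((w, 0) : ST) f z = \sum_i w 0 i * 'D_(space_basis i) f z.
Proof.
move=> df; rewrite space_sum deriveE// linear_sum; apply: eq_bigr => i _.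
by rewrite linearZ deriveE.
Qed.

(** The pair [(X z, Z z)] solves the defining equations at every point of the
   segment from [(X z, 0)] to [(Z z, 1)], and the solution is unique. *)
Lemma interpolation_ray z (h : R) : W z ->
  W (z + h *: ((Z z - X z, 1) : ST)) ->
  X (z + h *: ((Z z - X z, 1) : ST)) = X z /\
  Z (z + h *: ((Z z - X z, 1) : ST)) = Z z.
Proof.
set z' := z + _ => Wz Wz'; have sz := cylinder_slab Wz.
have sz' := cylinder_slab Wz'.
have [UX UZ g zE] := XZ sz; have [UX' UZ' g' zE'] := XZ sz'.
have [K K0 KP] := interpolation_lipschitz n0 dU Sphi Spsi.
have := KP _ _ z'.2 _ _ z'.2 UX' UZ' UX UZ sz'.2 g' g 0.
rewrite zE' subrr normr0 (_ : z'.1 - _ = 0); last first.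
  have -> : z'.1 = z.1 + h *: (Z z - X z) by [].
  have -> : z'.2 = z.2 + h * 1 by [].
  by rewrite -{1}zE; apply/rowP => k; rewrite !mxE; ring.
rewrite normr0 lexx mulr0 => /(_ isT isT)[].
by rewrite !normr_le0 !subr_eq0 => /eqP-> /eqP->.
Qed.

(** The space-time gradient of [u] only depends on [X] and [Z], hence is constant
   along the segments above, whose direction is therefore in the kernel of the
   Hessian. *)
Lemma geodesic_det z : W z -> \det (hessian space_time_basis u z) = 0.
Proof.
move=> Wz; pose d : ST := (Z z - X z, 1).
pose om : 'rV[R]_(n + 1) := row_mx (Z z - X z) (const_mx 1).
apply/eqP/det0P; exists om.
  apply/eqP => /rowP/(_ (rshift n 0)); rewrite row_mxEr !mxE => /eqP.
  by rewrite oner_eq0.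
apply/rowP => j; rewrite !mxE.
pose f := 'D_(space_time_basis j) u.
have df : differentiable f z by exact: usmooth_diff (usmooth_derive _ su) Wz.
have [_ Dd] : is_derive z d f 0.
  have [r r0 rP] := open_normP oW Wz.
  apply: eps_derive => e e0.
  have d1 : 0 < `|d| + 1 by rewrite ltr_wpDl.
  exists (r / (`|d| + 1)); first by rewrite divr_gt0.
  move=> h; rewrite ltr_pdivlMr// => hd.
  have Wh : W (z + h *: d).
    apply: rP; rewrite [z + _]addrC addrK normrZ.
    by apply: le_lt_trans hd; rewrite ler_wpM2l// lerDl.
  have [XE ZE] := interpolation_ray Wz Wh.
  rewrite /f !(geodesic_derive n0 dU Sphi Spsi XZ)// /time_slope XE ZE.
  by rewrite subrr sub0r scaler0 oppr0 normr0 mulr_ge0// ltW.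
transitivity ('D_d f z); last exact: Dd.
have -> : d = ((Z z - X z, 0) : ST) + ((0, 1) : ST).
  by congr pair; rewrite /= ?addr0 ?add0r.
rewrite deriveE// linearD -!deriveE// derive_space//.
rewrite big_split_ord/= big_ord1; congr (_ + _).
  by apply: eq_bigr => i _; rewrite row_mxEl [hessian _ _ _ _ _]mxE /= space_time_basisl.
by rewrite row_mxEr mxE mul1r [hessian _ _ _ _ _]mxE /= space_time_basisr.
Qed.

Lemma dot_convex (a b : 'rV[R]_n) (t : R) : 0 <= t <= 1 ->
  dot ((1 - t) *: a + t *: b) ((1 - t) *: a + t *: b) <=
  (1 - t) * dot a a + t * dot b b.
Proof.
move=> /andP[t0 t1].
have : 0 <= (1 - t) * t * dot (a - b) (a - b).
  by rewrite mulr_ge0 ?dot_ge0// mulr_ge0// subr_ge0.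
rewrite dotBl !dotBr !dotDl !dotDr !dotZl !dotZr [dot b a]dotC; lra.
Qed.

(** The gradient of [u] at a fixed time inherits the modulus of monotonicity of
   the two data, by convexity of the square. *)
Lemma geodesic_monotone : exists2 c : R, 0 < c & forall z z',
  slab U z -> slab U z' -> z.2 = z'.2 ->
  c * dot (z.1 - z'.1) (z.1 - z'.1) <= dot (p z - p z') (z.1 - z'.1).
Proof.
have [c c0 cP] := calS_monotone n0 dU Sphi.
have [c' c'0 cP'] := calS_monotone n0 dU Spsi.
pose m := Num.min c c'.
have m0 : 0 < m by rewrite lt_min c0.
exists m => // z z' sz sz' zz'.
have [UX UZ g zE] := XZ sz; have [UX' UZ' g' zE'] := XZ sz'.
have [_ t01] := sz; have /andP[t0 t1] := t01.
have dE : z.1 - z'.1 = (1 - z.2) *: (X z - X z') + z.2 *: (Z z - Z z').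
  by rewrite -{1}zE -{1}zE' -zz'; apply/rowP => k; rewrite !mxE; ring.
have h1 : m * dot (X z - X z') (X z - X z') <= dot (p z - p z') (X z - X z').
  apply: le_trans (cP _ _ UX UX'); rewrite ler_wpM2r ?dot_ge0//.
  by rewrite ge_min lexx.
have h2 : m * dot (Z z - Z z') (Z z - Z z') <= dot (p z - p z') (Z z - Z z').
  rewrite /p g g'; apply: le_trans (cP' _ _ UZ UZ').
  by rewrite ler_wpM2r ?dot_ge0// ge_min lexx orbT.
have q0 : 0 <= 1 - z.2 by lra.
have := ler_wpM2l q0 h1; have := ler_wpM2l t0 h2.
have := ler_wpM2l (ltW m0) (dot_convex (X z - X z') (Z z - Z z') t01).
by rewrite dE [in X in _ -> _ -> _ -> _ <= X]dotDr !dotZr; lra.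
Qed.

Lemma geodesic_hessian_pos : exists2 c : R, 0 < c & forall z (w : 'rV[R]_n),
  W z -> c * dot w w <= dot (w *m hessian space_basis u z) w.
Proof.
have [c c0 cP] := geodesic_monotone; exists c => // z w Wz.
pose v : ST := (w, 0).
have FE y : W y -> 'D_v u y = dot (p y) w.
  by move=> Wy; rewrite (geodesic_derive n0 dU Sphi Spsi XZ)//= mul0r addr0.
have dF : differentiable ('D_v u) z by exact: usmooth_diff (usmooth_derive _ su) Wz.
have -> : dot (w *m hessian space_basis u z) w = 'D_v ('D_v u) z.
  rewrite [RHS](@eq_derive_open _ _ _ W _
    (fun y => \sum_i w 0 i * 'D_(space_basis i) u y) _ _ oW Wz); last first.
    by move=> y Wy; rewrite derive_space//; exact: usmooth_diff su Wy.
  have di i : differentiable ('D_(space_basis i) u) z.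
    exact: usmooth_diff (usmooth_derive _ su) Wz.
  rewrite -fct_sumE derive_sum; last first.
    move=> i; apply: diff_derivable.
    by apply: differentiableM; [exact: differentiable_cst|exact: di].
  rewrite dotC; apply: eq_bigr => i _.
  rewrite deriveMl; last exact: (@diff_derivable _ _ _ _ z v (di i)).
  congr (_ * _); rewrite (derive_space w (di i)) mxE.
  by apply: eq_bigr => j _; rewrite mxE.
apply/ler_addgt0Pr => e e0.
have [d d0 dP] := derive_eps (@diff_derivable _ _ _ _ z v dF) e0.
have [r r0 rP] := open_normP oW Wz.
have v1 : 0 < `|v| + 1 by rewrite ltr_wpDl.
pose h := Num.min (d / 2) (r / (`|v| + 1)).
have h0 : 0 < h by rewrite lt_min !divr_gt0.
have hd : `|h| < d by rewrite gtr0_norm// gt_min; apply/orP; left; lra.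
have Wh : W (z + h *: v).
  apply: rP; rewrite [z + _]addrC addrK normrZ gtr0_norm//.
  apply: lt_le_trans (_ : h * (`|v| + 1) <= _); first by rewrite ltr_pM2l// ltrDl.
  by rewrite -ler_pdivlMr// ge_min lexx orbT.
have := cP _ _ (cylinder_slab Wh) (cylinder_slab Wz).
have -> : (z + h *: v).1 - z.1 = h *: w by rewrite /= [z.1 + _]addrC addrK.
have -> : (z + h *: v).2 = z.2 by rewrite /= scaler0 addr0.
move=> /(_ erefl); rewrite dotZl !dotZr mulrCA ler_pM2l// dotBl => mono.
have := dP h hd; rewrite (gtr0_norm h0) !FE// ler_norml => /andP[_].
rewrite -[h *: 'D_v ('D_v u) z]/(h * 'D_v ('D_v u) z) => up.
rewrite -(ler_pM2l h0); lra.
Qed.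

Lemma geodesic_posdef (x : 'rV[R]_n) (t : R) : closure U x -> 0 <= t <= 1 ->
  posdef (ext_value W (hessian space_basis u) (x, t)).
Proof.
move=> cx t01.
have cz : closure W ((x, t) : ST) by exact/cylinder_closure.
have /choice[H HP] : forall ij : 'I_n * 'I_n, exists G,
    ucont (closure W) G /\ forall z, W z -> G z =
    iter_derive [:: space_basis ij.1; space_basis ij.2] u z.
  move=> [i j]; apply: (usmooth_extension (U := U)).
  by do 2 apply: usmooth_derive.
rewrite (@ext_hessian _ _ W _ space_basis u (fun i j => H (i, j)) _ cz); last 2 first.
- by move=> i j; exact: (HP _).1.
- by move=> i j z Wz; exact: (HP (i, j)).2 z Wz.
have [c c0 cP] := geodesic_hessian_pos.
split.
  apply/matrixP => i j; rewrite !mxE.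
  apply: (closure_eq (HP (j, i)).1 (HP (i, j)).1 _ cz).
  move=> z Wz; rewrite ((HP (j, i)).2 z Wz) ((HP (i, j)).2 z Wz).
  apply: (mixed_derivatives _ _ oW Wz).
  exact: usmooth_smooth_on.
move=> w w0; rewrite -dot_mx; apply: (@lt_le_trans _ _ (c * dot w w)).
  by rewrite mulr_gt0// dot_gt0.
rewrite -subr_ge0.
pose F z := \sum_i (\sum_j w 0 j * H (j, i) z) * w 0 i - c * dot w w.
have FE z : F z = dot (w *m \matrix_(i, j) H (i, j) z) w - c * dot w w.
  rewrite /F; congr (_ - _); apply: eq_bigr => i _; rewrite mxE; congr (_ * _).
  by apply: eq_bigr => j _; rewrite mxE.
rewrite -FE; move: cz; apply: (closure_ge0 (W := W)).
  apply: ucont_within.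
  apply: (alg_ucont_compact cW).
  apply: algB; last exact: alg_cst.
  apply: alg_sum => i _; apply: algM; last exact: alg_cst.
  apply: alg_sum => j _; apply: algM; first exact: alg_cst.
  by apply: alg_gen; exact: (HP _).1.
move=> z Wz; rewrite FE subr_ge0; apply: le_trans (cP z w Wz) _.
rewrite (_ : hessian _ _ _ = \matrix_(i, j) H (i, j) z)//.
by apply/matrixP => i j; rewrite !mxE; exact/esym/(HP (i, j)).2.
Qed.

Lemma geodesic_initial x : U x -> u (x, 0) = phi x.
Proof.
move=> Ux; have s0 : slab U ((x, 0) : ST) by split => //=; rewrite lexx ler01.
have [_ _ _] := XZ s0; rewrite /= subr0 scale1r scale0r addr0 => XE.
by rewrite /u geodesicE// XE /= subr0 mul1r mul0r addr0.
Qed.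

Lemma geodesic_terminal x : U x -> u (x, 1) = psi x.
Proof.
move=> Ux; have s1 : slab U ((x, 1) : ST) by split => //=; rewrite lexx ler01.
have [_ _ _] := XZ s1; rewrite /= subrr scale1r scale0r add0r => ZE.
by rewrite /u geodesicE// ZE /= subrr mul1r mul0r add0r.
Qed.

Lemma geodesic_smooth_geodesic : smooth_geodesic U phi psi u.
Proof.
have uc := geodesic_continuous n0 dU Sphi Spsi XZ.
split.
- split; last exact: uc.
  exact: (geodesic_convex n0 dU Sphi Spsi XZ).
- exact: geodesic_det.
- split; [exact: geodesic_initial|exact: geodesic_terminal|].
  move=> x t /(boundaryE dU)[_ nUx] _; exact: geodesic_outside.
- exact: usmooth_smooth_upto.
- exact: geodesic_posdef.
Qed.

End GeodesicEquation.

Lemma interpolation_choice {R : realType} {n : nat} (U : set 'rV[R]_n)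
    (phi psi : 'rV[R]_n -> R) : (0 < n)%N -> smooth_strictly_convex_domain U ->
  calS U phi -> calS U psi -> gradient_image U phi = gradient_image U psi ->
  exists X Z : space_time -> 'rV[R]_n, interpolation U phi psi X Z.
Proof.
move=> n0 dU Sphi Spsi E.
have /choice[F FP] : forall z : @space_time R n, exists xz : 'rV[R]_n * 'rV[R]_n,
    slab U z -> [/\ U xz.1, U xz.2, gradient phi xz.1 = gradient psi xz.2 &
      (1 - z.2) *: xz.1 + z.2 *: xz.2 = z.1].
  move=> z; have [sz|nz] := pselect (slab U z); last by exists (0, 0).
  have [Uz t01] := sz.
  have [x [x' xx']] := interpolation_exists n0 dU Sphi Spsi E Uz t01.
  by exists (x, x').
by exists (fun z => (F z).1), (fun z => (F z).2) => z /FP.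
Qed.

Theorem theorem0p3 (R : realType) (n : nat) (n_gt0 : (0 < n)%N)
    (U : set 'rV[R]_n) (phi psi : 'rV[R]_n -> R)
    (dom_U : smooth_strictly_convex_domain U)
    (S_phi : calS U phi) (S_psi : calS U psi) :
  joined_by_smooth_geodesic U phi psi <->
  gradient_image U phi = gradient_image U psi.
Proof.
split=> [[u geo]|E]; first exact: geodesic_gradient_image geo.
have [X [Z XZ]] := interpolation_choice n_gt0 dom_U S_phi S_psi E.
exists (geodesic U phi psi X Z); exact: geodesic_smooth_geodesic.
Qed.
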